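(* Let $\eta\in(0,1)$. Then the following hold. 1. There exists a constant $c>0$ depending only on $\eta$ such that for all positive integers $s_1\le d_1$, $s_2\le d_2$, $$(\mu^* )^2\ \ge\ c\,\big[(\psi_{12}+\psi_{21})\wedge\phi_{12}\wedge\phi_{21}\big].$$ 2. There exists a constant $C'>0$ depending only on $\eta$ such that for all positive integers $s_1\le d_1$, $s_2\le d_2$: if $\mu^2\ge C'\,[(\psi_{12}+\psi_{21})\wedge\phi_{12}\wedge\phi_{21}]$, then the test $\Delta^*$ (defined in the context, with suitable truncation constants and cutoffs) satisfies $\mathcal R(\Delta^*,\mu)\le\eta$. Consequently, $$(\mu^* )^2\ \le\ C'\,\big[(\psi_{12}+\psi_{21})\wedge\phi_{12}\wedge\phi_{21}\big].$$
   Context: Notation: $[n]=\{1,\dots,n\}$; $\mathcal P_k(n)$ is the set of subsets of $[n]$ of cardinality $k$; $a\wedge b=\min\{a,b\}$; $\mathbf 1(\cdot)$ is the indicator. Model and testing problem. Let $d_1,d_2,s_1,s_2$ be positive integers with $s_1\le d_1$, $s_2\le d_2$. One observes $\mathbf Y=\mathbf X+\mathbf E\in\mathbb R^{d_1\times d_2}$ with $\mathbf X$ deterministic and $\mathbf E$ having i.i.d. $N(0,1)$ entries; $\mathbb P_{\mathbf X}$ denotes the law of $\mathbf Y$, and $\mathbb P_0$ the law for $\mathbf X=0$. For $\mu>0$, $\Theta(s_1,s_2,d_1,d_2,\mu)$ is the set of matrices $\mathbf M\in\mathbb R^{d_1\times d_2}$ for which there exist $S_1\in\mathcal P_{s_1}(d_1)$,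 $S_2\in\mathcal P_{s_2}(d_2)$ with $\mathbf M_{ij}\ge\mu$ for $(i,j)\in S_1\times S_2$ and $\mathbf M_{ij}=0$ otherwise. A test is a measurable function $\Delta$ of $\mathbf Y$ with values in $\{0,1\}$; its risk is $$\mathcal R(\Delta,\mu)=\mathbb P_0(\Delta=1)+\sup_{\mathbf X\in\Theta(s_1,s_2,d_1,d_2,\mu)}\mathbb P_{\mathbf X}(\Delta=0).$$ The minimax risk is $\mathcal R^*(\mu)=\inf_\Delta\mathcal R(\Delta,\mu)$ and the minimax separation rate at level $\eta$ is $\mu^*=\mu^*(s_1,s_2,d_1,d_2)=\inf\{\mu>0:\mathcal R^*(\mu)<\eta\}$. Rate quantities. $$\psi_{12}=\tfrac1{s_1}\log\!\Big(1+\tfrac{d_2}{s_2^2}\log\big(e\tbinom{d_1}{s_1}\big)\Big),\qquad \phi_{12}=\tfrac{d_1}{s_1^2}\log\!\Big(1+\tfrac{d_2}{s_2^2}\Big),$$ $$\beta_{12}=\tfrac1{s_1s_2}\log\tbinom{d_2}{s_2}\,\mathbf 1\Big\{\tfrac{d_1}{s_1^2}\log\big(e\tbinom{d_2}{s_2}\big)>1\Big\},$$ and $\psi_{21},\phi_{21},\beta_{21}$ are obtained by swapping $(s_1,d_1)$ with $(s_2,d_2)$. Put $\tilde R=(\psi_{12}+\beta_{21})\wedge(\psi_{21}+\beta_{12})\wedge\phi_{12}\wedge\phi_{21}$. Tests. For $\tau>0$ and $Z\sim N(0,1)$ let $\nu_\tau=\mathbb E[Z^2\mid |Z|>\tau]$.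 Let $\bar{\mathbf Y}_j=d_1^{-1/2}\sum_{i=1}^{d_1}\mathbf Y_{ij}$, and $\bar{\mathbf Y}_{J_1,j}=s_1^{-1/2}\sum_{i\in J_1}\mathbf Y_{ij}$ for $J_1\in\mathcal P_{s_1}(d_1)$. With constants $C>0$ (truncation constants, possibly different in each), let $\tau_1=\sqrt{C\log(1+d_2/s_2^2)}$ and $\tilde\tau_1=\sqrt{C\log(1+\frac{d_2}{s_2^2}\log(e\binom{d_1}{s_1}))}$, and define $$t_{\mathrm{tr},1}=\sum_{j=1}^{d_2}(\bar{\mathbf Y}_j^2-\nu_{\tau_1})\mathbf 1(|\bar{\mathbf Y}_j|>\tau_1),\qquad t_{\mathrm{mtr},1}=\max_{J_1\in\mathcal P_{s_1}(d_1)}\sum_{j=1}^{d_2}(\bar{\mathbf Y}_{J_1,j}^2-\nu_{\tilde\tau_1})\mathbf 1(|\bar{\mathbf Y}_{J_1,j}|>\tilde\tau_1),$$ $$t_{\mathrm{lin}}=\tfrac1{\sqrt{d_1d_2}}\sum_{i,j}\mathbf Y_{ij},\qquad t_{\mathrm{ml},1}=\max_{J_1\in\mathcal P_{s_1}(d_1)}\tfrac1{\sqrt{d_2}}\sum_{j=1}^{d_2}\bar{\mathbf Y}_{J_1,j}.$$ The statistics $t_{\mathrm{tr},2},t_{\mathrm{mtr},2},t_{\mathrm{ml},2}$ are obtained by exchanging the roles of rows and columns, i.e. of $(s_1,d_1)$ and $(s_2,d_2)$. For cutoffs $h_1,h_1',h_2,h_2',h_3,h_3',h_4,h_4'>0$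 define: $\Delta_a=\mathbf 1(t_{\mathrm{tr},1}>h_1)$ if $d_2/s_2^2\ge1$, and $\Delta_a=\mathbf 1(t_{\mathrm{lin}}>h_2)$ otherwise; $\Delta_b=\mathbf 1(t_{\mathrm{tr},2}>h_1')$ if $d_1/s_1^2\ge1$, and $\Delta_b=\mathbf 1(t_{\mathrm{lin}}>h_2')$ otherwise; $\Delta_c=\mathbf 1(t_{\mathrm{mtr},1}>h_3)$ if $\frac{d_2}{s_2^2}\log(e\binom{d_1}{s_1})\ge1$, and $\Delta_c=\mathbf 1(t_{\mathrm{ml},1}>h_4)$ otherwise; $\Delta_d=\mathbf 1(t_{\mathrm{mtr},2}>h_3')$ if $\frac{d_1}{s_1^2}\log(e\binom{d_2}{s_2})\ge1$, and $\Delta_d=\mathbf 1(t_{\mathrm{ml},2}>h_4')$ otherwise. Finally $\Delta^*=\Delta_a$ if $\tilde R=\phi_{12}$; $\Delta^*=\Delta_b$ if $\tilde R=\phi_{21}$; $\Delta^*=\Delta_c$ if $\tilde R=\psi_{12}+\beta_{21}$; $\Delta^*=\Delta_d$ if $\tilde R=\psi_{21}+\beta_{12}$ (in case of ties, the first applicable case in this list). The cutoffs and truncation constants may depend on $\eta,s_1,s_2,d_1,d_2$, but not on $\mu$ or $\mathbf X$. *)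

(* Defs.v *)
From HB Require Import structures.
From mathcomp Require Import all_boot all_order all_algebra.
From mathcomp Require Import all_classical all_reals all_analysis.

Set Implicit Arguments.
Unset Strict Implicit.
Unset Printing Implicit Defensive.

Import Order.TTheory GRing.Theory Num.Theory.
Import numFieldNormedType.Exports.

Local Open Scope classical_set_scope.
Local Open Scope ring_scope.

Definition mx_entry_preimages {d} {T : measurableType d} (m n : nat) :
    set (set 'M[T]_(m, n)) :=
  [set A | exists (i : 'I_m) (j : 'I_n) (B : set T),
    measurable B /\ A = [set M : 'M[T]_(m, n) | B (M i j)]].

Definition mx_display : measure_display -> measure_display.
Proof. exact. Qed.

Section measurable_matrix.
Context {d} {T : measurableType d} (m n : nat).

Let mx0 : <<s @mx_entry_preimages d T m n >> set0.
Proof. exact: sigma_algebra0. Qed.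

Let mxC A : <<s @mx_entry_preimages d T m n >> A ->
  <<s @mx_entry_preimages d T m n >> (~` A).
Proof. exact: sigma_algebraC. Qed.

Let mxU (F : (set 'M[T]_(m, n))^nat) :
  (forall i, <<s @mx_entry_preimages d T m n >> (F i)) ->
  <<s @mx_entry_preimages d T m n >> (\bigcup_i (F i)).
Proof. exact: sigma_algebra_bigcup. Qed.

HB.instance Definition _ := @isMeasurable.Build (mx_display d)
  'M[T]_(m, n) <<s @mx_entry_preimages d T m n >> mx0 mxC mxU.

End measurable_matrix.

Lemma measurable_entry {d} {T : measurableType d} m n (i : 'I_m) (j : 'I_n) :
  measurable_fun [set: 'M[T]_(m, n)] (fun M : 'M[T]_(m, n) => M i j).
Proof.
move=> _ B mB; rewrite setTI; apply: sub_sigma_algebra.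
by exists i, j, B.
Qed.

Section iid.
Context {d} {T : measurableType d} {R : realType}.

Definition tcons n (x : T * n.-tuple T) : n.+1.-tuple T :=
  [the n.+1.-tuple T of x.1 :: x.2].

Lemma measurable_tcons n : measurable_fun setT (@tcons n).
Proof. exact: (measurable_cons measurable_fst measurable_snd). Qed.

HB.instance Definition _ n :=
  isMeasurableFun.Build _ _ _ _ (@tcons n) (@measurable_tcons n).

(* law of n independent random variables, each of law P *)
Fixpoint iid_law (P : probability T R) (n : nat) :
    probability (n.-tuple T) R :=
  match n with
  | 0 => \d_ [tuple]
  | k.+1 => distribution (P \x iid_law P k)%E (@tcons k)
  end.

Lemma iid_law_rect (P : probability T R) n (A : 'I_n -> set T) :
  (forall i, measurable (A i)) ->
  iid_law P n [set t | forall i, A i (tnth t i)] = (\prod_(i < n) P (A i))%E.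
Proof.
elim: n A => [|n IH] A mA /=.
  rewrite big_ord0 diracE mem_set// => -[]//.
rewrite /distribution /pushforward.
have -> : @tcons n @^-1` [set t | forall i, A i (tnth t i)] =
    A ord0 `*` [set t | forall i, A (lift ord0 i) (tnth t i)].
  apply/seteqP; split => -[x t] /=.
    by move=> H; split => [|i]; [exact: (H ord0)|
      have := H (lift ord0 i); rewrite tnthS].
  move=> [H0 HS] i; have [j ->|->] := unliftP ord0 i; last exact: H0.
  by rewrite tnthS; exact: HS.
rewrite product_measure1E//; first by
  rewrite big_ord_recl; congr (_ * _)%E;
  exact: (IH (fun i => A (lift ord0 i))).
rewrite (_ : [set t : n.-tuple T | _] = \bigcap_(i in [set: 'I_n])
    ((fun t : n.-tuple T => tnth t i) @^-1` A (lift ord0 i))); last first.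
  by apply/seteqP; split => t /= H i; [move=> _; exact: H|exact: H].
apply: fin_bigcap_measurable => // i _.
by rewrite -[X in measurable X]setTI; exact: measurable_tnth.
Qed.

End iid.

Section gaussian_matrix.
Context {R : realType}.

(* normal_prob is a measure on measurableTypeR R, which has the same sets as
   the canonical measurable structure of R but another display *)
Definition std_normal : set R -> \bar R := normal_prob (0 : R) 1.

HB.instance Definition _ := @isMeasure.Build _ R R std_normal
  (@measure0 _ _ _ (normal_prob (0 : R) 1))
  (@measure_ge0 _ _ _ (normal_prob (0 : R) 1))
  (@measure_semi_sigma_additive _ _ _ (normal_prob (0 : R) 1)).

HB.instance Definition _ := @Measure_isProbability.Build _ R R std_normal
  (@probability_setT _ _ _ (normal_prob (0 : R) 1)).

Definition mx_of_rows m n (t : m.-tuple (n.-tuple R)) : 'M[R]_(m, n) :=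
  \matrix_(i, j) tnth (tnth t i) j.

Lemma measurable_mx_of_rows m n : measurable_fun setT (@mx_of_rows m n).
Proof.
apply: (measurability (@mx_entry_preimages _ R m n)) => //.
move=> _ [_ [i [j [B [mB ->]]]] <-].
rewrite setTI (_ : _ @^-1` _ =
    ((fun t : n.-tuple R => tnth t j) \o
     (fun t : m.-tuple (n.-tuple R) => tnth t i)) @^-1` B).
  by rewrite -[X in measurable X]setTI;
    apply: measurableT_comp => //; exact: measurable_tnth.
by apply/seteqP; split => t /=; rewrite mxE.
Qed.

HB.instance Definition _ m n := isMeasurableFun.Build _ _ _ _
  (@mx_of_rows m n) (@measurable_mx_of_rows m n).

Definition gaussian_mx (m n : nat) : probability 'M[R]_(m, n) R :=
  distribution (iid_law (iid_law std_normal n) m)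
    (@mx_of_rows m n).

Lemma gaussian_mx_rect m n (A : 'I_m -> 'I_n -> set R) :
  (forall i j, measurable (A i j)) ->
  gaussian_mx m n [set M | forall i j, A i j (M i j)] =
  (\prod_(i < m) \prod_(j < n) std_normal (A i j))%E.
Proof.
move=> mA; rewrite /gaussian_mx /= /distribution /pushforward.
rewrite (_ : _ @^-1` _ = [set t : m.-tuple (n.-tuple R) |
    forall i, [set u | forall j, A i j (tnth u j)] (tnth t i)]).
  apply: etrans (iid_law_rect (A := fun i => [set u : n.-tuple R |
    forall j, A i j (tnth u j)]) _ _) _; last first.
    by apply: eq_bigr => i _; exact: iid_law_rect.
  move=> i /=; rewrite (_ : [set u | _] = \bigcap_(j in [set: 'I_n])
      ((fun t : n.-tuple R => tnth t j) @^-1` A i j)); last first.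
    by apply/seteqP; split => t /= H j; [move=> _; exact: H|exact: H].
  apply: fin_bigcap_measurable => // j _.
  by rewrite -[X in measurable X]setTI; exact: measurable_tnth.
by apply/seteqP; split => t /= H i j; have := H i j; rewrite mxE.
Qed.

End gaussian_matrix.

Section testing.
Context {R : realType} {d1 d2 : nat}.
Implicit Types (X Y M : 'M[R]_(d1, d2)) (D : 'M[R]_(d1, d2) -> bool).

Definition law X : set 'M[R]_(d1, d2) -> \bar R :=
  pushforward (@gaussian_mx R d1 d2) (fun E => X + E).

Definition Theta (s1 s2 : nat) (mu : R) : set 'M[R]_(d1, d2) :=
  [set M : 'M[R]_(d1, d2) | exists (S1 : {set 'I_d1}) (S2 : {set 'I_d2}),
     [/\ #|S1| = s1, #|S2| = s2,
         forall i j, (i \in S1) && (j \in S2) -> mu <= M i j &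
         forall i j, ~~ ((i \in S1) && (j \in S2)) -> M i j = 0]].

Definition is_test D : Prop := measurable_fun setT D.

Definition risk (s1 s2 : nat) D (mu : R) : \bar R :=
  (law 0%R [set Y | D Y] +
   ereal_sup [set law X [set Y | ~~ D Y] | X in Theta s1 s2 mu])%E.

End testing.

Definition minimax_risk {R : realType} (s1 s2 d1 d2 : nat) (mu : R) : \bar R :=
  ereal_inf [set risk s1 s2 D mu | D in @is_test R d1 d2].

Definition mu_star {R : realType} (eta : R) (s1 s2 d1 d2 : nat) : \bar R :=
  ereal_inf [set mu%:E | mu in
    [set mu : R | 0 < mu /\ (minimax_risk s1 s2 d1 d2 mu < eta%:E)%E]].

Section rates.
Context {R : realType}.

(* The quantities with index 12 are obtained from the arguments s1 d1 s2 d2,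
   those with index 21 from the arguments s2 d2 s1 d1. *)

Definition log_e_bin (d s : nat) : R := ln (expR 1 * 'C(d, s)%:R).

Definition psi (s1 d1 s2 d2 : nat) : R :=
  s1%:R^-1 * ln (1 + d2%:R / s2%:R ^+ 2 * log_e_bin d1 s1).

Definition phi (s1 d1 s2 d2 : nat) : R :=
  d1%:R / s1%:R ^+ 2 * ln (1 + d2%:R / s2%:R ^+ 2).

Definition beta (s1 d1 s2 d2 : nat) : R :=
  (s1%:R * s2%:R)^-1 * ln ('C(d2, s2)%:R) *
  (1 < d1%:R / s1%:R ^+ 2 * log_e_bin d2 s2)%R%:R.

Definition rate (s1 d1 s2 d2 : nat) : R :=
  Num.min (psi s1 d1 s2 d2 + psi s2 d2 s1 d1)
    (Num.min (phi s1 d1 s2 d2) (phi s2 d2 s1 d1)).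

Definition Rtilde (s1 d1 s2 d2 : nat) : R :=
  Num.min (psi s1 d1 s2 d2 + beta s2 d2 s1 d1)
    (Num.min (psi s2 d2 s1 d1 + beta s1 d1 s2 d2)
      (Num.min (phi s1 d1 s2 d2) (phi s2 d2 s1 d1))).

End rates.

Section statistics.
Context {R : realType}.

(* E[Z ^ 2 | |Z| > tau] for Z of law N(0, 1) *)
Definition nu (tau : R) : R :=
  (\int[@std_normal R]_(z in [set z : R | tau < `|z|]) (z ^+ 2)) /
  fine (std_normal [set z : R | tau < `|z|]).

Definition trunc_sq (tau x : R) : R :=
  (x ^+ 2 - nu tau) * (tau < `|x|)%R%:R.

Definition col_mean {d1 d2} (Y : 'M[R]_(d1, d2)) (j : 'I_d2) : R :=
  (Num.sqrt d1%:R)^-1 * \sum_(i < d1) Y i j.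

Definition sub_col_mean {d1 d2} (s1 : nat) (J1 : {set 'I_d1})
    (Y : 'M[R]_(d1, d2)) (j : 'I_d2) : R :=
  (Num.sqrt s1%:R)^-1 * \sum_(i in J1) Y i j.

Definition tau_tr (C : R) (s2 d2 : nat) : R :=
  Num.sqrt (C * ln (1 + d2%:R / s2%:R ^+ 2)).

Definition tau_mtr (C : R) (s1 d1 s2 d2 : nat) : R :=
  Num.sqrt (C * ln (1 + d2%:R / s2%:R ^+ 2 * log_e_bin d1 s1)).

Definition t_tr {d1 d2} (C : R) (s2 : nat) (Y : 'M[R]_(d1, d2)) : R :=
  \sum_(j < d2) trunc_sq (tau_tr C s2 d2) (col_mean Y j).

Definition t_lin {d1 d2} (Y : 'M[R]_(d1, d2)) : R :=
  (Num.sqrt (d1%:R * d2%:R))^-1 * \sum_(i < d1) \sum_(j < d2) Y i j.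

(* The maxima are taken in \bar R, with unit -oo; they are finite since
   they range over a nonempty set when s1 <= d1. *)
Definition t_mtr {d1 d2} (C : R) (s1 s2 : nat) (Y : 'M[R]_(d1, d2)) : \bar R :=
  \big[maxe/-oo%E]_(J1 : {set 'I_d1} | #|J1| == s1)
    (\sum_(j < d2) trunc_sq (tau_mtr C s1 d1 s2 d2)
                            (sub_col_mean s1 J1 Y j))%:E.

Definition t_ml {d1 d2} (s1 : nat) (Y : 'M[R]_(d1, d2)) : \bar R :=
  \big[maxe/-oo%E]_(J1 : {set 'I_d1} | #|J1| == s1)
    ((Num.sqrt d2%:R)^-1 * \sum_(j < d2) sub_col_mean s1 J1 Y j)%:E.

End statistics.

(* Truncation constant, cutoff of the truncated statistic and cutoff of the
   linear statistic. *)
Record tuning (R : realType) := Tuning {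
  trunc_const : R;
  cut_tr : R;
  cut_lin : R;
}.

Definition tuning_pos {R : realType} (k : tuning R) : Prop :=
  [/\ 0 < trunc_const k, 0 < cut_tr k & 0 < cut_lin k].

Section tests.
Context {R : realType}.
Implicit Types k : tuning R.

Definition sum_test {d1 d2} k (s2 : nat) (Y : 'M[R]_(d1, d2)) : bool :=
  if 1 <= d2%:R / s2%:R ^+ 2 :> R then cut_tr k < t_tr (trunc_const k) s2 Y
  else cut_lin k < t_lin Y.

Definition max_test {d1 d2} k (s1 s2 : nat) (Y : 'M[R]_(d1, d2)) : bool :=
  if 1 <= d2%:R / s2%:R ^+ 2 * log_e_bin d1 s1 :> R
  then ((cut_tr k)%:E < t_mtr (trunc_const k) s1 s2 Y)%E
  else ((cut_lin k)%:E < t_ml s1 Y)%E.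

(* Rows and columns are exchanged by transposing the observation: the
   linear statistic is invariant under transposition. *)
Definition Delta_star {d1 d2} (ka kb kc kd : tuning R) (s1 s2 : nat)
    (Y : 'M[R]_(d1, d2)) : bool :=
  if Rtilde s1 d1 s2 d2 == phi s1 d1 s2 d2 :> R then sum_test ka s2 Y
  else if Rtilde s1 d1 s2 d2 == phi s2 d2 s1 d1 :> R then sum_test kb s1 Y^T
  else if Rtilde s1 d1 s2 d2 == psi s1 d1 s2 d2 + beta s2 d2 s1 d1 :> R
  then max_test kc s1 s2 Y
  else max_test kd s2 s1 Y^T.

End tests.

(* Main.v *)
(* Upper bound. Each test compares, for some set of rows, a sum over the columns of
   a function of a normal variable with a cutoff; a Chernoff bound for the columns
   and a union bound over the sets of s1 rows control both errors as soon as mu^2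
   exceeds the matching term of Rtilde. Moreover Rtilde <= 4 rate, because
   s1 <= log (e C(d2, s2)) forces beta_21 <= 3 psi_21 and the opposite inequality
   forces beta_12 <= 3 psi_21.

   Lower bound. Le Cam's method with the uniform prior on the signals
   mu 1_{S1 x S2} reduces the claim to bounding the average over (S1, S2) of
   exp (m |S1 & T1| |S2 & T2|) for m proportional to mu^2. Put p = s1^2 / d1 and
   q = s2^2 / d2. Averaging over S2 leaves exp (q (e^{m h} - 1)) with
   h = |S1 & T1|, whose frequency of the value k is at most
   exp (k - k log (k / p)). When m is at most a small multiple of
   psi_12, phi_12 and phi_21, the exponent is at most k (2 + log (k / p)) / 4, by
   convexity in log k and inspection of the end points, so the tail wins; psi_21 is
   handled by exchanging rows and columns. *)

From HB Require Import structures.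
Require Import Defs.
From mathcomp Require Import all_boot all_order all_algebra.
From mathcomp Require Import all_classical all_reals all_analysis.
From mathcomp Require Import measurable_realfun ring lra.

Set Implicit Arguments.
Unset Strict Implicit.
Unset Printing Implicit Defensive.

Import Order.TTheory GRing.Theory Num.Theory.
Import numFieldNormedType.Exports.

Local Open Scope classical_set_scope.
Local Open Scope ring_scope.

(** * Gaussian integrals *)

(** Along a fixed set of rows the normalized column sums are independent standard normals, so
    Chernoff bounds factorize and all rests on one-dimensional moments. The constant [nu] centres
    the truncated square and so removes the term of first order in l from its moment generating
    function, leaving exp (O(l^2 exp (- tau^2 / 4))). With truncation constant 8 the last factor is
    (1 + x)^-2, where x = d2 / s2^2 * L and L = log (e C(d1, s1)); for l of order L / s2 the d2
    columns then cost O(L), like the union bound. Paying for L itself is the origin of beta_21.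

    In the lower bound the frequency estimate says nothing about overlaps near their mean p, an
    obstacle when p >= 1, and it only yields a large constant K as second moment, whereas risk at
    least eta asks for 1 + (1 - eta)^2. Dividing mu^2 by a further constant closes this gap. Each
    constraint on m has its own range: psi_12 governs the largest overlaps, phi_12 those of order p
    when p >= 1, and phi_21, helped by psi_12, a single common row when p < 1. *)

Section gaussian_integrals.
Context {R : realType}.
Implicit Types (f g : R -> \bar R) (a b : R).
Local Notation leb := (@lebesgue_measure R).
Local Notation N := (@std_normal R).
Local Notation pdf := (normal_pdf (0 : R) 1).

Lemma ge0_integral_normal_prob (f : measurableTypeR R -> \bar R) :
  measurable_fun [set: measurableTypeR R] f -> (forall x, 0 <= f x)%E ->
  (\int[normal_prob (0 : R) 1]_x f x = \int[leb]_x (f x * (pdf x)%:E))%E.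
Proof.
move=> mf f0.
have mp : measurable_fun [set: measurableTypeR R] (EFin \o pdf).
  by apply/measurable_EFinP; exact: measurable_normal_pdf.
have dom := normal_prob_dominates (0 : R) 1.
rewrite -(Radon_Nikodym_SigmaFinite.change_of_variables dom)//=.
apply: ae_eq_integral => //.
- apply: emeasurable_funM => //; apply: (measurable_int leb).
  exact: Radon_Nikodym_SigmaFinite.f_integrable.
- exact: emeasurable_funM.
(* The Radon-Nikodym derivative is abstract; it agrees with [pdf] almost everywhere because both
   integrate to the measure of every measurable set. *)
- apply: ae_eqe_mul2l => /=.
  apply: integral_ae_eq => //=.
  + exact: Radon_Nikodym_SigmaFinite.f_integrable.
  + by move=> E _ mE; rewrite -Radon_Nikodym_SigmaFinite.f_integral.
Qed.

Lemma ge0_integral_std_normal f : measurable_fun [set: R] f -> (forall x, 0 <= f x)%E ->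
  (\int[N]_x f x = \int[leb]_x (f x * (pdf x)%:E))%E.
Proof.
move=> mf f0; rewrite -ge0_integral_normal_prob//.
(* Pushing forward along the identity moves the integral between the two displays carried by the
   same sets. *)
rewrite -(@ge0_integral_pushforward _ _ (measurableTypeR R) R R (@idfun R) _
  (normal_prob (0 : R) 1) setT f)//.
by move=> _ Y mY; rewrite setTI; exact: mY.
Qed.

(** The push-forward of Lebesgue measure under x -> b x + a, multiplied by b, gives each half-open
    interval its length; uniqueness of Lebesgue measure concludes. *)
Lemma ge0_integral_affine f a b : 0 < b -> measurable_fun [set: R] f ->
  (forall x, 0 <= f x)%E ->
  (\int[leb]_x f x = b%:E * \int[leb]_x f (b * x + a)%R)%E.
Proof.
move=> b0 mf f0.
pose h : measurableTypeR R -> measurableTypeR R := fun x => b * x + a.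
have mh : measurable_fun setT h.
  by apply: measurable_funD => //; exact: measurable_funM.
have /= -> : (\int[leb]_x f (b * x + a)%R = \int[pushforward leb h]_x f x)%E.
  by rewrite ge0_integral_pushforward.
rewrite -(@ge0_integral_mscale _ _ _ (pushforward leb h) setT measurableT (NngNum (ltW b0)))//.
apply: eq_measure_integral => //= A mA _.
apply: lebesgue_measure_unique => //= _ [[u v]] _ <-.
rewrite /mscale /= /pushforward.
have -> : h @^-1` `]u, v]%classic = `](u - a) / b, (v - a) / b]%classic.
  apply/seteqP; split => x; rewrite /h /= !in_itv/= ltr_pdivrMr// ler_pdivlMr//.
    by move=> /andP[? ?]; apply/andP; split; lra.
  by move=> /andP[? ?]; apply/andP; split; lra.
rewrite !lebesgue_measure_itv/= !lte_fin ltr_pM2r ?invr_gt0// ltrD2r.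
case: ifPn => uv; last by rewrite mule0.
by rewrite -EFinD -EFinM; congr (_%:E); field; rewrite gt_eqF.
Qed.

Lemma std_normal_pdfE x : pdf x = (Num.sqrt (pi *+ 2))^-1 * expR (- x ^+ 2 / 2).
Proof.
by rewrite normal_pdfE ?oner_neq0// /normal_peak /normal_fun expr1n mul1r subr0.
Qed.

Lemma normal_peakE b : 0 < b -> normal_peak b = (b * Num.sqrt (pi *+ 2))^-1.
Proof.
by move=> b0; rewrite /normal_peak -mulrnAr sqrtrM ?sqr_ge0// sqrtr_sqr gtr0_norm.
Qed.

Lemma measurable_gaussian_tilt a :
  measurable_fun [set: R] (fun x : R => (expR (a * x - a ^+ 2 / 2))%:E).
Proof.
apply/measurable_EFinP; apply: measurableT_comp => //.
by apply: measurable_funB => //; exact: measurable_funM.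
Qed.

(** The Cameron-Martin formula in dimension one, from which the likelihood ratio of a shifted matrix
    is built entry by entry. *)
Lemma std_normal_shift f a : measurable_fun [set: R] f -> (forall x, 0 <= f x)%E ->
  (\int[N]_x f (x + a)%R = \int[N]_x (f x * (expR (a * x - a ^+ 2 / 2))%:E))%E.
Proof.
move=> mf f0.
have mw := measurable_gaussian_tilt a.
have mp : measurable_fun [set: R] (EFin \o pdf).
  by apply/measurable_EFinP; exact: measurable_normal_pdf.
have ms : measurable_fun [set: R] (fun x : R => f (x + a)).
  by apply: measurableT_comp => //; exact: measurable_funD.
rewrite !ge0_integral_std_normal//; last 2 first.
  exact: emeasurable_funM.
  by move=> x; rewrite mule_ge0// lee_fin expR_ge0.
rewrite [RHS](@ge0_integral_affine _ a 1)//; last 2 first.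
  by apply: emeasurable_funM => //; exact: emeasurable_funM.
  by move=> x; rewrite !mule_ge0// lee_fin ?expR_ge0 ?normal_pdf_ge0.
rewrite mul1e; apply: eq_integral => x _; rewrite mul1r -muleA; congr (_ * _)%E.
rewrite -EFinM; congr EFin; rewrite !std_normal_pdfE mulrCA -expRD; congr (_ * expR _).
by field.
Qed.

Lemma std_normal_scale f b : 0 < b -> measurable_fun [set: R] f -> (forall x, 0 <= f x)%E ->
  (\int[N]_x f (b * x)%R =
   \int[leb]_x (f x * (normal_pdf (0 : R) b x)%:E))%E.
Proof.
move=> b0 mf f0.
have mp c : measurable_fun [set: R] (EFin \o normal_pdf (0 : R) c).
  by apply/measurable_EFinP; exact: measurable_normal_pdf.
have ms : measurable_fun [set: R] (fun x : R => f (b * x)).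
  by apply: measurableT_comp => //; exact: measurable_funM.
rewrite ge0_integral_std_normal; [|exact: ms|by []].
rewrite [RHS](@ge0_integral_affine _ 0 b); [|by []| |]; last 2 first.
  by apply: emeasurable_funM => //; exact: mp.
  by move=> x; rewrite !mule_ge0// lee_fin normal_pdf_ge0.
rewrite -ge0_integralZl//; last 3 first.
  apply: emeasurable_funM.
    apply: (measurableT_comp mf) => //.
    by apply: measurable_funD => //; exact: measurable_funM.
  apply: (measurableT_comp (mp b)) => //.
  by apply: measurable_funD => //; exact: measurable_funM.
  by move=> x _; rewrite mule_ge0// lee_fin normal_pdf_ge0.
  by rewrite lee_fin ltW.
apply: eq_integral => x _; rewrite addr0 muleCA; congr (_ * _)%E.
rewrite -EFinM; congr EFin; rewrite std_normal_pdfE normal_pdfE ?gt_eqF//.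
rewrite normal_peakE// /normal_fun subr0 exprMn mulrA; congr (_ * expR _); last first.
  by field; rewrite gt_eqF.
by rewrite invfM mulrA divff ?mul1r// gt_eqF.
Qed.

(** Completing the square factors the joint density of x and a x + b y into the marginal, of
    deviation r, and a conditional normal density of x that integrates to one. For b = 0 the
    conditional law degenerates, hence the separate case. *)
Lemma std_normal_convolution f a b : 0 <= a -> 0 <= b -> measurable_fun [set: R] f ->
  (forall x, 0 <= f x)%E ->
  (\int[N]_x \int[N]_y f (a * x + b * y)%R =
   \int[N]_x f (Num.sqrt (a ^+ 2 + b ^+ 2) * x)%R)%E.
Proof.
move=> a0 b0 mf f0.
have [->|bn0] := eqVneq b 0.
  rewrite expr0n addr0 sqrtr_sqr ger0_norm//.
  apply: eq_integral => x _; under eq_integral do rewrite mul0r addr0.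
  by rewrite integral_cst//= probability_setT mule1.
have {}b0 : 0 < b by rewrite lt_def bn0.
set r := Num.sqrt _.
have r0 : 0 < r.
  by rewrite sqrtr_gt0 ltr_wpDl ?sqr_ge0// exprn_gt0.
have r2 : r ^+ 2 = a ^+ 2 + b ^+ 2 by rewrite sqr_sqrtr// addr_ge0 ?sqr_ge0.
have mp c e : measurable_fun [set: R] (EFin \o normal_pdf (c : R) e).
  by apply/measurable_EFinP; exact: measurable_normal_pdf.
have mD c : measurable_fun [set: R] (fun y : R => f (c + y)).
  by apply: (measurableT_comp mf) => //; exact: measurable_funD.
have E1 x : (\int[N]_y f (a * x + b * y)%R =
    \int[leb]_y (f y * (normal_pdf (a * x) b y)%:E))%E.
  rewrite (@std_normal_scale (fun y => f (a * x + y)%R)); [|exact: b0|exact: mD|by []].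
  rewrite [RHS](@ge0_integral_affine _ (a * x) 1); [|by []| |]; last 2 first.
    by apply: emeasurable_funM => //; exact: mp.
    by move=> y; rewrite mule_ge0// lee_fin normal_pdf_ge0.
  rewrite mul1e; apply: eq_integral => y _; rewrite mul1r addrC; congr (_ * _%:E)%E.
  by rewrite !normal_pdfE// /normal_fun subr0 addrK.
under eq_integral do rewrite E1.
rewrite [RHS]std_normal_scale; [|exact: r0|exact: mf|exact: f0].
have mpp : measurable_fun [set: R * R] (fun z : R * R => normal_pdf (a * z.1) b z.2).
  under eq_fun do rewrite normal_pdfE//.
  apply: measurable_funM => //; apply: measurableT_comp => //.
  apply: measurable_funM => //; apply: measurableT_comp => //.
  apply: measurable_funX; apply: measurable_funB => //.
  by apply: measurable_funM => //.
have mF : measurable_fun [set: R * measurableTypeR R]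
  (fun z : R * measurableTypeR R => f z.2 * (normal_pdf (a * z.1) b z.2)%:E)%E.
  apply: emeasurable_funM; last exact/measurable_EFinP.
  exact: measurableT_comp.
have F0 z : (0 <= f z.2 * (normal_pdf (a * z.1) b z.2)%:E)%E.
  by rewrite mule_ge0// lee_fin normal_pdf_ge0.
rewrite (@fubini_tonelli _ _ _ _ R N leb (fun z => f z.2 * (normal_pdf (a * z.1) b z.2)%:E)%E mF F0).
apply: eq_integral => y _ /=.
have mpx : measurable_fun [set: R] (fun x : R => (normal_pdf (a * x) b y)%:E).
  apply/measurable_EFinP.
  exact: (measurable_fun_pair1 (f := fun z : R * R => normal_pdf (a * z.1) b z.2) y mpp).
rewrite ge0_integralZl//; last by move=> x _; rewrite lee_fin normal_pdf_ge0.
congr (_ * _)%E.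
rewrite ge0_integral_std_normal; [|exact: mpx|by move=> x; rewrite lee_fin normal_pdf_ge0].
under eq_integral => x _.
  have -> : ((normal_pdf (a * x) b y)%:E * (normal_pdf 0 1 x)%:E =
    (normal_pdf 0 r y)%:E * (normal_pdf (a * y / r ^+ 2) (b / r) x)%:E)%E.
    rewrite -!EFinM; congr EFin; rewrite std_normal_pdfE !normal_pdfE ?gt_eqF ?divr_gt0//.
    rewrite !normal_peakE ?divr_gt0// /normal_fun mulrACA [RHS]mulrACA -!expRD; congr (_ * expR _).
      have : 0 < Num.sqrt (pi *+ 2 : R) by rewrite sqrtr_gt0 mulrn_wgt0// pi_gt0.
      by move: (Num.sqrt _) => t t0; field; rewrite !gt_eqF.
    rewrite expr_div_n subr0 r2.
    have : a ^+ 2 + b ^+ 2 != 0 by rewrite -r2 gt_eqF// exprn_gt0.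
    by move=> ?; field; apply/andP; split.
  over.
rewrite /= ge0_integralZl//; last 3 first.
  by apply/measurable_EFinP; exact: measurable_normal_pdf.
  by move=> x _; rewrite lee_fin normal_pdf_ge0.
  by rewrite lee_fin normal_pdf_ge0.
by rewrite integral_normal_pdf mule1.
Qed.

Lemma integral_expR_std_normal a :
  (\int[N]_x (expR (a * x))%:E = (expR (a ^+ 2 / 2))%:E)%E.
Proof.
have mw := measurable_gaussian_tilt a.
have := @std_normal_shift (cst 1%E) a (measurable_cst _) (fun _ => lee01).
rewrite integral_cst//= probability_setT mule1.
under eq_integral do rewrite mul1e.
move=> /(congr1 (fun z => (expR (a ^+ 2 / 2))%:E * z)%E); rewrite mule1 => ->.
rewrite -ge0_integralZl//.
by apply: eq_integral => x _; rewrite -EFinM -expRD subrKC.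
Qed.

(** The exponent 3/8 - 1/2 = - 1/8 is that of the normal density of deviation 2, and the value is
    the ratio of the two normalizations. This function dominates all later integrands built from
    squares. *)
Lemma integral_expR_sqr_std_normal :
  (\int[N]_x (expR (3 / 8 * x ^+ 2))%:E = 2%:E)%E.
Proof.
rewrite ge0_integral_std_normal; last 2 first.
  by apply/measurable_EFinP; apply: measurableT_comp => //; apply: measurable_funM.
  by move=> x; rewrite lee_fin expR_ge0.
under eq_integral => x _.
  have -> : ((expR (3 / 8 * x ^+ 2))%:E * (pdf x)%:E =
    2%:E * (normal_pdf 0 2 x)%:E)%E.
    rewrite -!EFinM; congr EFin; rewrite std_normal_pdfE normal_pdfE//.
    rewrite normal_peakE// /normal_fun mulrCA -expRD [RHS]mulrA; congr (_ * expR _).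
      by rewrite invfM mulrA divff ?mul1r.
    by field.
  over.
rewrite /= ge0_integralZl//; last 2 first.
  by apply/measurable_EFinP; exact: measurable_normal_pdf.
  by move=> x _; rewrite lee_fin normal_pdf_ge0.
by rewrite integral_normal_pdf mule1.
Qed.

End gaussian_integrals.

(** * Integrals over independent coordinates and Gaussian matrices *)

Lemma emeasurable_prod d (T : measurableType d) (R : realType) (D : set T)
    (I : Type) (s : seq I) (h : I -> T -> \bar R) :
  (forall i, measurable_fun D (h i)) ->
  measurable_fun D (fun x => \prod_(i <- s) h i x)%E.
Proof.
move=> mh; elim: s => [|i s ih].
  by under eq_fun do rewrite big_nil; exact: measurable_cst.
by under eq_fun do rewrite big_cons; exact: emeasurable_funM.
Qed.

Section iid_integrals.
Context {d} {T : measurableType d} {R : realType} (P : probability T R).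
Local Open Scope ereal_scope.

Lemma ge0_integral_iid_lawS n (F : n.+1.-tuple T -> \bar R) :
  measurable_fun setT F -> (forall t, 0 <= F t) ->
  \int[iid_law P n.+1]_t F t =
  \int[P]_x \int[iid_law P n]_t F (@tcons d T n (x, t)).
Proof.
move=> mF F0 /=.
rewrite ge0_integral_distribution// fubini_tonelli1//.
  by apply: (measurableT_comp mF); exact: measurable_tcons.
by move=> x; exact: F0.
Qed.

Lemma tnth_tcons0 n (x : T) (t : n.-tuple T) : tnth (@tcons d T n (x, t)) ord0 = x.
Proof. by []. Qed.

Lemma tnth_tconsS n (x : T) (t : n.-tuple T) i :
  tnth (@tcons d T n (x, t)) (lift ord0 i) = tnth t i.
Proof. by rewrite tnthS. Qed.

Lemma ge0_integral_iid_prod n (f : 'I_n -> T -> \bar R) :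
  (forall i, measurable_fun setT (f i)) -> (forall i x, 0 <= f i x) ->
  \int[iid_law P n]_t (\prod_(i < n) f i (tnth t i)) = \prod_(i < n) \int[P]_x f i x.
Proof.
elim: n f => [|n IH] f mf f0.
  under eq_integral do rewrite big_ord0.
  by rewrite big_ord0 integral_cst// mul1e; exact: probability_setT.
rewrite ge0_integral_iid_lawS; last 2 first.
  by apply: emeasurable_prod => i; apply: measurableT_comp => //; exact: measurable_tnth.
  by move=> t; apply: prode_ge0.
rewrite big_ord_recl -IH//.
under eq_integral => x _.
  under eq_integral => t _.
    rewrite big_ord_recl tnth_tcons0.
    under eq_bigr do rewrite tnth_tconsS.
    over.
  rewrite ge0_integralZl//; last 2 first.
    by apply: emeasurable_prod => i; apply: measurableT_comp => //; exact: measurable_tnth.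
    by move=> t _; apply: prode_ge0.
  over.
rewrite /= ge0_integralZr//.
by apply: integral_ge0 => t _; apply: prode_ge0.
Qed.

(** A change of variables in each coordinate multiplies the weights. The coordinate space is left
    general because the lemma serves twice: for the entries of a row, then for the rows of a
    matrix. *)
Lemma ge0_integral_iid_transform n (g : 'I_n -> T -> T) (w : 'I_n -> T -> \bar R)
    (F : n.-tuple T -> \bar R) :
  (forall i, measurable_fun setT (g i)) ->
  (forall i, measurable_fun setT (w i)) -> (forall i x, 0 <= w i x) ->
  (forall i f, measurable_fun setT f -> (forall x, 0 <= f x) ->
     \int[P]_x f (g i x) = \int[P]_x (f x * w i x)) ->
  measurable_fun setT F -> (forall t, 0 <= F t) ->
  \int[iid_law P n]_t F [tuple g i (tnth t i) | i < n] =
  \int[iid_law P n]_t (F t * \prod_(i < n) w i (tnth t i)).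
Proof.
have mT k (h : 'I_k -> T -> T) : (forall i, measurable_fun setT (h i)) ->
    measurable_fun setT (fun t : k.-tuple T => [tuple h i (tnth t i) | i < k]).
  move=> mh; apply/measurable_fun_tnthP => i.
  under [X in measurable_fun _ X]eq_fun do rewrite /= tnth_mktuple.
  by apply: measurableT_comp => //; exact: measurable_tnth.
have mW k (h : 'I_k -> T -> \bar R) : (forall i, measurable_fun setT (h i)) ->
    measurable_fun setT (fun t : k.-tuple T => \prod_(i < k) h i (tnth t i)).
  move=> mh; apply: emeasurable_prod => i.
  by apply: measurableT_comp => //; exact: measurable_tnth.
elim: n g w F => [|n IH] g w F mg mw w0 H mF F0.
  by apply: eq_integral => t _; rewrite big_ord0 mule1; congr F; apply: eq_from_tnth => -[].
have mtc x : measurable_fun setT (fun t : n.-tuple T => @tcons d T n (x, t)).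
  by apply: (measurableT_comp (@measurable_tcons _ _ n)).
rewrite ge0_integral_iid_lawS; last 2 first.
- by apply: (measurableT_comp mF); exact: mT.
- by move=> t; exact: F0.
rewrite ge0_integral_iid_lawS; last 2 first.
- by apply: emeasurable_funM => //; exact: mW.
- by move=> t; rewrite mule_ge0// prode_ge0.
pose G x := \int[iid_law P n]_t (F (@tcons d T n (x, t)) *
   \prod_(i < n) w (lift ord0 i) (tnth t i)).
have mFG : measurable_fun setT (fun z : T * n.-tuple T => F (@tcons d T n z) *
   \prod_(i < n) w (lift ord0 i) (tnth z.2 i)).
  apply: emeasurable_funM.
    by apply: (measurableT_comp mF); exact: measurable_tcons.
  by apply: (measurableT_comp (mW n (fun i => w (lift ord0 i)) _)).
have FG0 (z : T * n.-tuple T) : 0 <= F (@tcons d T n z) *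
   \prod_(i < n) w (lift ord0 i) (tnth z.2 i).
  by rewrite mule_ge0// prode_ge0.
transitivity (\int[P]_x G (g ord0 x)).
  congr (integral _ _ _); apply/funext => x; rewrite /G.
  rewrite -(IH (fun i => g (lift ord0 i)) (fun i => w (lift ord0 i))
     (fun t => F (@tcons d T n (g ord0 x, t))))//; last 2 first.
  - by move=> i f; exact: H.
  - exact: (measurableT_comp mF).
  apply: eq_integral => t _; congr F; apply: eq_from_tnth => i.
  have [j ->|->] := unliftP ord0 i.
    by rewrite tnth_tconsS !tnth_mktuple tnth_tconsS.
  by rewrite tnth_tcons0 !tnth_mktuple.
rewrite H; last 2 first.
  exact: (measurable_fun_fubini_tonelli_F _ mFG FG0).
  by move=> x; apply: integral_ge0 => t _; exact: (FG0 (x, t)).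
apply: eq_integral => x _; rewrite /G -ge0_integralZr//; last first.
  by apply: (measurableT_comp mFG); exact: pair1_measurable.
apply: eq_integral => t _; rewrite big_ord_recl tnth_tcons0 -muleA; congr (_ * _).
by rewrite muleC; congr (_ * _); apply: eq_bigr => i _; rewrite tnth_tconsS.
Qed.

End iid_integrals.

Section gaussian_matrices.
Context {R : realType}.
Local Notation N := (@std_normal R).
Local Notation NI := (@iid_law _ _ R N).
Local Open Scope ereal_scope.

(** Induction on the rows: the later rows act on each column like r times one standard normal, and
    [std_normal_convolution] merges it with the entry of the first row. *)
Lemma ge0_integral_iid_columns m n (a : 'I_m -> R) (f : 'I_n -> R -> \bar R) :
  (forall i, 0 <= a i)%R ->
  (forall j, measurable_fun [set: R] (f j)) -> (forall j x, 0 <= f j x) ->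
  \int[iid_law (NI n) m]_t
    (\prod_(j < n) f j (\sum_(i < m) a i * tnth (tnth t i) j)%R) =
  \prod_(j < n) \int[N]_x f j (Num.sqrt (\sum_(i < m) a i ^+ 2) * x)%R.
Proof.
elim: m a f => [|m IH] a f a0 mf f0.
  under eq_integral do under eq_bigr do rewrite big_ord0.
  rewrite integral_cst// [X in _ * X](_ : _ = 1); last exact: probability_setT.
  rewrite mule1; apply: eq_bigr => j _; rewrite big_ord0 sqrtr0; under eq_integral do rewrite mul0r.
  by rewrite integral_cst//= probability_setT mule1.
set b : 'I_m -> R := fun i => a (lift ord0 i).
set r := Num.sqrt (\sum_(i < m) b i ^+ 2)%R.
have me j k : measurable_fun setT (fun t : m.+1.-tuple (n.-tuple R) => tnth (tnth t k) j).
  apply: (measurableT_comp (f := fun t : n.-tuple R => tnth t j)).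
    exact: measurable_tnth.
  exact: measurable_tnth.
have maff j (x : R) : measurable_fun [set: R] (fun y : R => f j (x + y)%R).
  by apply: (measurableT_comp (mf j)) => //; exact: measurable_funD.
rewrite ge0_integral_iid_lawS; last 2 first.
- apply: emeasurable_prod => j; apply: (measurableT_comp (mf j)).
  by apply: measurable_sum => i; exact: measurable_funM.
- by move=> t; apply: prode_ge0.
pose G j x := \int[N]_z f j (a ord0 * x + r * z)%R.
have mGG j : measurable_fun [set: R * R] (fun z : R * R => f j (a ord0 * z.1 + r * z.2)%R).
  apply: (measurableT_comp (mf j)) => //.
  by apply: measurable_funD; apply: measurable_funM.
transitivity (\int[NI n]_u \prod_(j < n) G j (tnth u j)).
  apply: eq_integral => u _.
  rewrite -(IH b (fun j y => f j (a ord0 * tnth u j + y)%R))//; last by move=> i; exact: a0.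
  apply: eq_integral => t _; apply: eq_bigr => j _; congr (f j).
  rewrite big_ord_recl tnth_tcons0; congr (_ + _)%R.
  by apply: eq_bigr => i _; rewrite tnth_tconsS.
rewrite (@ge0_integral_iid_prod _ _ _ N n G); last 2 first.
- by move=> j; exact: (measurable_fun_fubini_tonelli_F _ (mGG j)).
- by move=> j x; apply: integral_ge0.
apply: eq_bigr => j _; rewrite std_normal_convolution ?sqrtr_ge0// /r big_ord_recl.
by rewrite [in X in _ = X]addrC sqr_sqrtr ?sumr_ge0// => [|i _]; rewrite ?sqr_ge0// addrC.
Qed.

Lemma ge0_integral_gaussian_mx m n (F : 'M[R]_(m, n) -> \bar R) :
  measurable_fun setT F -> (forall M, 0 <= F M) ->
  \int[@gaussian_mx R m n]_M F M = \int[iid_law (NI n) m]_t F (mx_of_rows t).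
Proof. by move=> mF F0; rewrite ge0_integral_distribution. Qed.

Lemma measurable_lincomb_col m n (a : 'I_m -> R) (j : 'I_n) :
  measurable_fun [set: 'M[R]_(m, n)] (fun M => (\sum_(i < m) a i * M i j)%R).
Proof.
by apply: measurable_sum => i; apply: measurable_funM => //; exact: measurable_entry.
Qed.

Lemma gaussian_mx_columns m n (a : 'I_m -> R) (f : 'I_n -> R -> \bar R) :
  (forall i, 0 <= a i)%R -> (\sum_(i < m) a i ^+ 2 = 1)%R ->
  (forall j, measurable_fun [set: R] (f j)) -> (forall j x, 0 <= f j x) ->
  \int[@gaussian_mx R m n]_M
    (\prod_(j < n) f j (\sum_(i < m) a i * M i j)%R) =
  \prod_(j < n) \int[N]_x f j x.
Proof.
move=> a0 a1 mf f0; rewrite ge0_integral_gaussian_mx; last 2 first.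
- apply: emeasurable_prod => j; apply: (measurableT_comp (mf j)).
  exact: measurable_lincomb_col.
- by move=> M; apply: prode_ge0.
transitivity (\prod_(j < n) \int[N]_x f j (Num.sqrt (\sum_(i < m) a i ^+ 2) * x)%R).
  rewrite -ge0_integral_iid_columns//; apply: eq_integral => t _.
  by apply: eq_bigr => j _; congr (f j); apply: eq_bigr => i _; rewrite mxE.
by rewrite a1 sqrtr1; apply: eq_bigr => j _; apply: eq_integral => x _; rewrite mul1r.
Qed.

Lemma gaussian_mx_entries m n (f : 'I_m -> 'I_n -> R -> \bar R) :
  (forall i j, measurable_fun [set: R] (f i j)) -> (forall i j x, 0 <= f i j x) ->
  \int[@gaussian_mx R m n]_M (\prod_(i < m) \prod_(j < n) f i j (M i j)) =
  \prod_(i < m) \prod_(j < n) \int[N]_x f i j x.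
Proof.
move=> mf f0; rewrite ge0_integral_gaussian_mx; last 2 first.
- apply: emeasurable_prod => i; apply: emeasurable_prod => j.
  by apply: (measurableT_comp (mf i j)); exact: measurable_entry.
- by move=> M; apply: prode_ge0 => i _; apply: prode_ge0.
transitivity (\int[iid_law (NI n) m]_t
    (\prod_(i < m) (fun i u => \prod_(j < n) f i j (tnth u j)) i (tnth t i))).
  apply: eq_integral => t _; apply: eq_bigr => i _; apply: eq_bigr => j _.
  by rewrite mxE.
rewrite (@ge0_integral_iid_prod _ _ _ (NI n) m (fun i u => \prod_(j < n) f i j (tnth u j))); last 2 first.
- move=> i; apply: emeasurable_prod => j; apply: (measurableT_comp (mf i j)).
  exact: measurable_tnth.
- by move=> i u; apply: prode_ge0.
by apply: eq_bigr => i _; rewrite ge0_integral_iid_prod.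
Qed.

Lemma measurable_addmx m n (X : 'M[R]_(m, n)) :
  measurable_fun setT (fun E => X + E)%R.
Proof.
apply: (measurability (@mx_entry_preimages _ R m n)) => //.
move=> _ [_ [i [j [B [mB ->]]]] <-]; rewrite setTI.
have -> : (fun E : 'M[R]_(m, n) => X + E)%R @^-1` [set M | B (M i j)] =
    (fun E : 'M[R]_(m, n) => X i j + E i j)%R @^-1` B.
  by apply/seteqP; split => E /=; rewrite mxE.
rewrite -[Y in measurable Y]setTI.
have mE : measurable_fun setT (fun E : 'M[R]_(m, n) => X i j + E i j)%R.
  by apply: measurable_funD => //; exact: measurable_entry.
exact: mE.
Qed.

Lemma gaussian_mx_shift m n (X : 'M[R]_(m, n)) (F : 'M[R]_(m, n) -> \bar R) :
  measurable_fun setT F -> (forall M, 0 <= F M) ->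
  \int[@gaussian_mx R m n]_E F (X + E)%R =
  \int[@gaussian_mx R m n]_E (F E * \prod_(i < m) \prod_(j < n)
     (expR (X i j * E i j - X i j ^+ 2 / 2))%:E).
Proof.
move=> mF F0.
have mS := measurable_addmx X.
have mw := @measurable_gaussian_tilt R.
have w0 (a x : R) : 0 <= (expR (a * x - a ^+ 2 / 2))%:E by rewrite lee_fin expR_ge0.
pose g i (u : n.-tuple R) := [tuple (tnth u j + X i j)%R | j < n].
pose w i (u : n.-tuple R) :=
  \prod_(j < n) (expR (X i j * tnth u j - X i j ^+ 2 / 2))%:E.
have mg i : measurable_fun setT (g i).
  apply/measurable_fun_tnthP => j.
  under [Y in measurable_fun _ Y]eq_fun do rewrite /= tnth_mktuple.
  by apply: measurable_funD => //; exact: measurable_tnth.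
have mwr i : measurable_fun setT (w i).
  apply: emeasurable_prod => j; apply: (measurableT_comp (mw _)).
  exact: measurable_tnth.
rewrite ge0_integral_gaussian_mx//; last first.
  exact: (measurableT_comp mF).
rewrite ge0_integral_gaussian_mx; last 2 first.
- apply: emeasurable_funM => //; apply: emeasurable_prod => i.
  apply: emeasurable_prod => j; apply: (measurableT_comp (mw _)).
  exact: measurable_entry.
- by move=> M; rewrite mule_ge0//; apply: prode_ge0 => i _; apply: prode_ge0.
transitivity (\int[iid_law (NI n) m]_t
    (F \o @mx_of_rows R m n) [tuple g i (tnth t i) | i < m]).
  apply: eq_integral => t _ /=; congr F; apply/matrixP => i j.
  by rewrite !mxE !tnth_mktuple addrC.
rewrite (@ge0_integral_iid_transform _ _ _ (NI n) m g w); last 6 first.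
- exact: mg.
- exact: mwr.
- by move=> i u; apply: prode_ge0.
- move=> i f mf f0.
  rewrite -(@ge0_integral_iid_transform _ _ _ N n (fun j x => x + X i j)%R
    (fun j x => (expR (X i j * x - X i j ^+ 2 / 2))%:E))//.
  + by move=> j; exact: measurable_funD.
  + by move=> j h mh h0; rewrite std_normal_shift.
- by apply: (measurableT_comp mF); exact: measurable_mx_of_rows.
- by move=> t; exact: F0.
apply: eq_integral => t _ /=; congr (_ * _); apply: eq_bigr => i _.
by apply: eq_bigr => j _; rewrite mxE.
Qed.

End gaussian_matrices.

(** * Tests and transposition *)

Section transposition.
Context {R : realType}.

Lemma measurable_mx_rect m n (A : 'I_m -> 'I_n -> set R) :
  (forall i j, measurable (A i j)) ->
  measurable [set M : 'M[R]_(m, n) | forall i j, A i j (M i j)].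
Proof.
move=> mA; rewrite (_ : [set M : 'M[R]_(m, n) | _] =
    \bigcap_(i in [set: 'I_m]) \bigcap_(j in [set: 'I_n])
      ((fun M : 'M[R]_(m, n) => M i j) @^-1` A i j)).
  apply: fin_bigcap_measurable => // i _; apply: fin_bigcap_measurable => // j _.
  by rewrite -[X in measurable X]setTI; exact: measurable_entry.
by apply/seteqP; split => M /= H i => [_ j _|j]; [exact: H|exact: (H i I j I)].
Qed.

Lemma measurable_trmx m n : measurable_fun [set: 'M[R]_(m, n)] (@trmx R m n).
Proof.
apply: (measurability (@mx_entry_preimages _ R n m)) => //.
move=> _ [_ [i [j [B [mB ->]]]] <-]; rewrite setTI.
have -> : @trmx R m n @^-1` [set M | B (M i j)] =
    (fun M : 'M[R]_(m, n) => M j i) @^-1` B.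
  by apply/seteqP; split => M /=; rewrite mxE.
by rewrite -[Y in measurable Y]setTI; exact: measurable_entry.
Qed.

HB.instance Definition _ m n := isMeasurableFun.Build _ _ _ _
  (@trmx R m n) (@measurable_trmx m n).

(** The two laws give a rectangle the same product, taken in two orders. Rectangles are stable under
    intersection and generate the sigma-algebra. *)
Lemma gaussian_mx_trmx m n (A : set 'M[R]_(n, m)) : measurable A ->
  @gaussian_mx R m n (@trmx R m n @^-1` A) = @gaussian_mx R n m A.
Proof.
pose G : set (set 'M[R]_(n, m)) := [set Y | exists B : 'I_n -> 'I_m -> set R,
  (forall i j, measurable (B i j)) /\ Y = [set M : 'M[R]_(n, m) | forall i j, B i j (M i j)]].
apply: (@measure_unique _ _ _ G (fun=> setT) _ _ _ _
  (distribution (gaussian_mx m n) (@trmx R m n)) (gaussian_mx n m)).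
- apply/seteqP; split.
    apply: smallest_sub; first exact: smallest_sigma_algebra.
    move=> _ [i [j [B [mB ->]]]]; apply: sub_sigma_algebra.
    exists (fun k l => if (k == i) && (l == j) then B else setT); split.
      by move=> k l; case: ifP.
    apply/seteqP; split => M /=.
      by move=> BM k l; case: ifP => // /andP[/eqP-> /eqP->].
    by move=> /(_ i j); rewrite !eqxx.
  apply: smallest_sub; first exact: sigma_algebra_measurable.
  by move=> _ [B [mB ->]]; exact: measurable_mx_rect.
- move=> _ _ [B [mB ->]] [B' [mB' ->]]; exists (fun i j => B i j `&` B' i j).
  split; first by move=> i j; exact: measurableI.
  apply/seteqP; split => M /=; first by move=> [H H'] i j; split.
  by move=> H; split => i j; have [] := H i j.
- by move=> _; exists (fun _ _ => setT); split => //; apply/seteqP; split.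
- by rewrite bigcup_const//; exists 0%N.
- move=> _ [B [mB ->]]; apply: etrans; last exact: (esym (gaussian_mx_rect mB)).
  rewrite exchange_big /=.
  apply: etrans; last exact: (gaussian_mx_rect (A := fun i j => B j i)).
  congr (gaussian_mx _ _ _).
  apply/seteqP; split => M /= H i j; first by have := H j i; rewrite mxE.
  by rewrite mxE; exact: H.
- by move=> _; rewrite [X in (X < _)%E](_ : _ = 1%E) ?ltry//; exact: probability_setT.
Qed.

Lemma measurable_test m n (D : 'M[R]_(m, n) -> bool) (b : bool) : is_test D ->
  measurable [set Y | D Y = b].
Proof.
move=> mD; have := mD measurableT [set b] I; rewrite setTI.
by congr measurable.
Qed.

Lemma measurable_testN m n (D : 'M[R]_(m, n) -> bool) : is_test D ->
  measurable [set Y | ~~ D Y].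
Proof.
move=> mD; rewrite (_ : [set Y | ~~ D Y] = [set Y | D Y = false]).
  exact: measurable_test.
by apply/seteqP; split => Y /=; case: (D Y).
Qed.

Lemma law_trmx m n (X : 'M[R]_(m, n)) (A : set 'M[R]_(n, m)) : measurable A ->
  law X [set Y | A Y^T] = law X^T A.
Proof.
move=> mA; rewrite /law /pushforward.
have mXA : measurable ((fun E => X^T + E) @^-1` A).
  by rewrite -[Y in measurable Y]setTI; exact: (measurable_addmx X^T measurableT).
apply: etrans (gaussian_mx_trmx mXA); congr (gaussian_mx _ _ _); apply/seteqP; split => E /=.
  by rewrite linearD.
by rewrite linearD.
Qed.

Lemma Theta_trmx m n (s1 s2 : nat) (mu : R) (X : 'M[R]_(m, n)) :
  Theta s1 s2 mu X -> Theta s2 s1 mu X^T.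
Proof.
move=> [S1 [S2 [c1 c2 H1 H2]]]; exists S2, S1; split => // i j ij.
  by rewrite mxE; apply: H1; rewrite andbC.
by rewrite mxE; apply: H2; rewrite andbC.
Qed.

Lemma is_test_trmx m n (D : 'M[R]_(n, m) -> bool) : is_test D ->
  is_test (fun Y : 'M[R]_(m, n) => D Y^T).
Proof. by move=> mD; apply: (measurableT_comp mD); exact: measurable_trmx. Qed.

Lemma risk_trmx m n (s1 s2 : nat) (D : 'M[R]_(n, m) -> bool) (mu : R) :
  is_test D ->
  (risk s1 s2 (fun Y : 'M[R]_(m, n) => D Y^T) mu <= risk s2 s1 D mu)%E.
Proof.
move=> mD; rewrite /risk; apply: leeD.
  by rewrite (law_trmx _ (A := [set Y | D Y]))// ?trmx0//; exact: measurable_test.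
apply: ge_ereal_sup => _ [X TX <-]; apply: ereal_sup_ubound.
exists X^T; first exact: Theta_trmx.
by rewrite -(law_trmx _ (A := [set Y | ~~ D Y]))//; exact: measurable_testN.
Qed.

End transposition.

(** * Chernoff bound for column sums *)

Section chernoff.
Context {R : realType}.
Local Notation N := (@std_normal R).

Lemma sub_col_meanE m n s (J : {set 'I_m}) (M : 'M[R]_(m, n)) j :
  sub_col_mean s J M j = \sum_(i < m) ((Num.sqrt s%:R)^-1 *+ (i \in J)) * M i j.
Proof.
rewrite /sub_col_mean mulr_sumr [LHS]big_mkcond; apply: eq_bigr => i _.
by case: (i \in J); rewrite ?mulr0n ?mul0r.
Qed.

Lemma measurable_sub_col_mean m n s (J : {set 'I_m}) (j : 'I_n) :
  measurable_fun [set: 'M[R]_(m, n)] (fun M => sub_col_mean s J M j).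
Proof.
under eq_fun do rewrite sub_col_meanE.
exact: measurable_lincomb_col.
Qed.

Lemma sub_col_meanD m n s (J : {set 'I_m}) (X M : 'M[R]_(m, n)) j :
  sub_col_mean s J (X + M) j = sub_col_mean s J X j + sub_col_mean s J M j.
Proof.
rewrite !sub_col_meanE -big_split /=; apply: eq_bigr => i _.
by rewrite mxE mulrDr.
Qed.

(** The functions depend on the column because, under the alternative, signal columns and pure noise
    columns need different moment bounds. *)
Lemma chernoff_columns m n s (J : {set 'I_m}) (g : 'I_n -> R -> R) (u B : R)
    (b : 'I_n -> R) :
  #|J| = s -> (0 < s)%N ->
  (forall j, measurable_fun [set: R] (g j)) ->
  (forall j, \int[N]_x (expR (g j x))%:E <= (expR (b j))%:E)%E ->
  \sum_(j < n) b j <= B ->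
  (@gaussian_mx R m n [set M | (u <= \sum_(j < n) g j (sub_col_mean s J M j))%R]
    <= (expR (B - u))%:E)%E.
Proof.
move=> cJ s0 mg gb bB.
have mgj j : measurable_fun [set: 'M[R]_(m, n)] (fun M => g j (sub_col_mean s J M j)).
  by apply: (measurableT_comp (mg j)); exact: measurable_sub_col_mean.
set A := [set M | _].
have mA : measurable A.
  have mS : measurable_fun [set: 'M[R]_(m, n)]
    (fun M => \sum_(j < n) g j (sub_col_mean s J M j)).
    exact: measurable_sum.
  have := mS measurableT `[u, +oo[%classic (measurable_itv _).
  by rewrite setTI; congr measurable; apply/seteqP; split => M /=; rewrite in_itv/= andbT.
pose F (M : 'M[R]_(m, n)) := (\prod_(j < n) (expR (g j (sub_col_mean s J M j)))%:E)%E.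
have mF : measurable_fun setT F.
  apply: emeasurable_prod => j; apply/measurable_EFinP.
  exact: measurableT_comp.
have F0 M : (0 <= F M)%E by apply: prode_ge0 => j _; rewrite lee_fin expR_ge0.
have FE M : F M = (expR (\sum_(j < n) g j (sub_col_mean s J M j)))%:E.
  by rewrite /F expR_sum prodEFin.
have intF : (\int[@gaussian_mx R m n]_M F M <= (expR B)%:E)%E.
  under eq_integral do rewrite /F.
  under eq_integral do under eq_bigr do rewrite sub_col_meanE.
  rewrite (@gaussian_mx_columns _ _ _ _ (fun j x => (expR (g j x))%:E)).
  - apply: (@le_trans _ _ (\prod_(j < n) (expR (b j))%:E)%E).
      apply: (proj2 (big_ind2 (fun x y => 0 <= x /\ x <= y)%E _ _ _)) => [|x1 x2 y1 y2|j _].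
      + by [].
      + by move=> [? ?] [? ?]; split; [exact: mule_ge0|exact: lee_pmul].
      + by split; [apply: integral_ge0 => x _; rewrite lee_fin expR_ge0|exact: gb].
    by rewrite prodEFin -expR_sum lee_fin ler_expR.
  - by move=> i; rewrite mulrn_wge0// invr_ge0 sqrtr_ge0.
  - rewrite (eq_bigr (fun i => if i \in J then s%:R^-1 else 0)); last first.
      move=> i _; case: (i \in J) => /=; last by rewrite mulr0n expr0n.
      by rewrite mulr1n exprVn sqr_sqrtr.
    rewrite -big_mkcond /= sumr_const cJ -[LHS]mulr_natr mulVf// pnatr_eq0.
    by rewrite -lt0n.
  - by move=> j; apply/measurable_EFinP; exact: measurableT_comp.
  - by move=> j x; rewrite lee_fin expR_ge0.
have uA : ((expR u)%:E * @gaussian_mx R m n A <= \int[@gaussian_mx R m n]_M F M)%E.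
  rewrite -integral_cst//; apply: (@le_trans _ _ (\int[@gaussian_mx R m n]_(M in A) F M)%E); last first.
    exact: ge0_subset_integral.
  apply: ge0_le_integral => //.
  - by move=> M _; rewrite lee_fin expR_ge0.
  - exact: measurable_funTS.
  - by move=> M AM; rewrite FE lee_fin ler_expR.
have -> : @gaussian_mx R m n A = ((expR (- u))%:E * ((expR u)%:E * @gaussian_mx R m n A))%E.
  by rewrite muleA -EFinM -expRD addNr expR0 mul1e.
rewrite addrC expRD EFinM lee_wpmul2l ?lee_fin ?expR_ge0//.
exact: le_trans uA intF.
Qed.

End chernoff.

(** * The truncated square of a normal variable *)

Section exp_bounds.
Context {R : realType}.
Implicit Types x u : R.

Lemma expR_le1Dx_expR x : expR x <= 1 + x * expR x.
Proof.
have := ler_wpM2r (expR_ge0 x) (expR_ge1Dx (- x)).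
rewrite -expRD addNr expR0 mulrDl mul1r mulNr => H; lra.
Qed.

(** The linear term is kept exact, so that it disappears when u has mean zero. *)
Lemma expR_le_quadratic u : expR u <= 1 + u + u ^+ 2 * expR `|u|.
Proof.
have [u0|u0] := leP 0 u.
  have := ler_wpM2l u0 (expR_le1Dx_expR u).
  have := expR_le1Dx_expR u; rewrite ger0_norm//.
  by move: (expR u) => e h1 h2; nra.
have -> : expR u = (expR `|u|)^-1 by rewrite -expRN ltr0_norm// opprK.
rewrite {2}(_ : u = - `|u|); last by rewrite ltr0_norm// opprK.
rewrite -[u ^+ 2]real_normK ?num_real//.
have v0 : 0 <= `|u| by [].
move: `|u| v0 => v v0.
have e1 := expR_ge1Dx v.
apply: (@le_trans _ _ (1 - v + v ^+ 2)); last first.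
  rewrite lerD2l; apply: ler_peMr; first exact: sqr_ge0.
  by apply: le_trans e1; rewrite lerDl.
(* Rests on (1 + v) (1 - v + v^2) = 1 + v^3 >= 1. *)
rewrite invf_ple ?posrE ?expR_gt0//; last by nra.
apply: le_trans e1; rewrite -[X in X <= _]mul1r ler_pdivrMr; last by nra.
by nra.
Qed.

End exp_bounds.

Section truncated_square.
Context {R : realType}.
Local Notation N := (@std_normal R).
Implicit Types (tau l z : R).

Lemma integral_std_normal_cst (k : R) : (\int[N]__ k%:E = k%:E)%E.
Proof. by rewrite integral_cst//= probability_setT mule1. Qed.

Lemma measurable_expR_sqr l : measurable_fun [set: R] (fun z : R => expR (l * z ^+ 2)).
Proof. by apply: measurableT_comp => //; apply: measurable_funM. Qed.

Lemma le_integral_std_normal (f : R -> R) (a b : R) :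
  measurable_fun [set: R] f -> (forall z, 0 <= f z) -> 0 <= a -> 0 <= b ->
  (forall z, f z <= a + b * expR (3 / 8 * z ^+ 2)) ->
  (\int[N]_z (f z)%:E <= (a + 2 * b)%:E)%E.
Proof.
move=> mf f0 a0 b0 fab.
apply: (@le_trans _ _ (\int[N]_z (a%:E + b%:E * (expR (3 / 8 * z ^+ 2))%:E))%E).
  apply: ge0_le_integral => //.
  - by move=> z _; rewrite lee_fin.
  - exact/measurable_EFinP.
  - apply: emeasurable_funD => //; apply: emeasurable_funM => //.
    by apply/measurable_EFinP; exact: measurable_expR_sqr.
  - by move=> z _; rewrite -EFinM -EFinD lee_fin.
rewrite ge0_integralD//; last 2 first.
- by move=> z _; rewrite mule_ge0// lee_fin ?expR_ge0.
- apply: emeasurable_funM => //.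
  by apply/measurable_EFinP; exact: measurable_expR_sqr.
rewrite integral_std_normal_cst ge0_integralZl//; last first.
- by apply/measurable_EFinP; exact: measurable_expR_sqr.
by rewrite integral_expR_sqr_std_normal -EFinM -EFinD mulrC.
Qed.

Lemma sqr_le_expR z : z ^+ 2 <= 8 * expR (1 / 8 * z ^+ 2).
Proof. by have := expR_ge1Dx (1 / 8 * z ^+ 2); lra. Qed.

(** The weight 3/8 splits as 1/8 + 1/4: the first part absorbs the factor z^2, the second the
    exponential. The integral is then at most 1 + 16 l. *)
Lemma integral_expR_sqr_le l : 0 <= l <= 1 / 4 ->
  (\int[N]_z (expR (l * z ^+ 2))%:E <= (expR (16 * l))%:E)%E.
Proof.
move=> /andP[l0 l1].
apply: (@le_trans _ _ (1 + 2 * (8 * l))%:E); last first.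
  by rewrite lee_fin; apply: le_trans (expR_ge1Dx _); lra.
apply: le_integral_std_normal => //.
- exact: measurable_expR_sqr.
- by rewrite mulr_ge0.
move=> z; apply: le_trans (expR_le1Dx_expR _) _; rewrite lerD2l.
have z0 : 0 <= z ^+ 2 by exact: sqr_ge0.
have -> : 3 / 8 * z ^+ 2 = 1 / 8 * z ^+ 2 + 1 / 4 * z ^+ 2 by field.
rewrite expRD mulrA; apply: ler_pM => //.
- exact: mulr_ge0.
- by have := ler_wpM2l l0 (sqr_le_expR z); rewrite [X in _ <= X]mulrCA [X in _ <= X]mulrA.
- by rewrite ler_expR ler_wpM2r.
Qed.

Definition tail_set tau : set R := [set z | tau < `|z|].

Lemma measurable_tail_set tau : measurable (tail_set tau).
Proof.
have mn : measurable_fun [set: R] (fun z : R => `|z|) by exact: measurableT_comp.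
have := mn measurableT `]tau, +oo[%classic (measurable_itv _).
by rewrite setTI; congr measurable; apply/seteqP; split => z /=; rewrite in_itv/= andbT.
Qed.

Let integrable_expR_sqr : N.-integrable setT (fun z => (expR (3 / 8 * z ^+ 2))%:E).
Proof.
apply/integrableP; split; first by apply/measurable_EFinP; exact: measurable_expR_sqr.
under eq_integral do rewrite gee0_abs ?lee_fin ?expR_ge0//.
by rewrite integral_expR_sqr_std_normal ltry.
Qed.

Let integrable_sqr : N.-integrable setT (fun z => (z ^+ 2)%:E).
Proof.
apply: (le_integrable _ _ _ (integrableZl measurableT 8 integrable_expR_sqr)) => //.
  by apply/measurable_EFinP; exact: measurable_funX.
move=> z _; rewrite /= lee_fin !ger0_norm ?sqr_ge0 ?mulr_ge0 ?expR_ge0//.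
apply: le_trans (sqr_le_expR z) _; rewrite ler_wpM2l// ler_expR ler_wpM2r ?sqr_ge0//.
lra.
Qed.

Let p tau : R := fine (N (tail_set tau)).
Let q tau : R := \int[N]_(z in tail_set tau) (z ^+ 2).

Let pE tau : N (tail_set tau) = (p tau)%:E.
Proof. by rewrite fineK// fin_num_measure//; exact: measurable_tail_set. Qed.

Let qE tau : (\int[N]_(z in tail_set tau) (z ^+ 2)%:E = (q tau)%:E)%E.
Proof.
rewrite fineK//; apply: integrable_fin_num; first exact: measurable_tail_set.
by apply: integrableS integrable_sqr => //; exact: measurable_tail_set.
Qed.

(** Only the mass of ]tau, tau + 1] is kept, with the density bounded below by its value at the
    right end; sqrt (2 pi) <= 3 follows from pi < 4. *)
Lemma tail_lower_bound tau : 0 <= tau ->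
  expR (- (tau + 1) ^+ 2 / 2) <= 3 * p tau.
Proof.
move=> t0.
have pi0 := @pi_gt0 R.
have p2 : 0 <= pi *+ 2 :> R by rewrite mulr2n addr_ge0// ltW.
set r : R := Num.sqrt (pi *+ 2).
have r0 : 0 < r by rewrite sqrtr_gt0 mulrn_wgt0.
have r3 : r <= 3.
  have := @pihalf_lt2 R; rewrite ltr_pdivrMr// => pi4.
  rewrite -(ler_pXn2r (n := 2)) ?nnegrE ?(ltW r0)// (sqr_sqrtr p2).
  lra.
suff : r^-1 * expR (- (tau + 1) ^+ 2 / 2) <= p tau.
  rewrite ler_pdivrMl// => H; apply: le_trans H _; rewrite ler_wpM2r//.
  by rewrite /p fine_ge0.
rewrite -lee_fin -pE.
have mI : measurable `]tau, tau + 1]%classic by exact: measurable_itv.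
apply: (@le_trans _ _ (N `]tau, tau + 1]%classic)); last first.
  apply: le_measure; rewrite ?inE//; first exact: measurable_tail_set.
  move=> z /=; rewrite in_itv/= => /andP[tz _].
  by rewrite /tail_set/= ger0_norm// (le_trans t0)// ltW.
rewrite /std_normal /normal_prob.
apply: (@le_trans _ _ (\int[lebesgue_measure]_(z in `]tau, (tau + 1)%R])
   (r^-1 * expR (- (tau + 1) ^+ 2 / 2))%:E)%E).
  rewrite integral_cst//= lebesgue_measure_itv/= lte_fin ltrDl ltr01.
  by rewrite -EFinD -EFinM addrAC subrr add0r mulr1.
apply: ge0_le_integral => //.
- by move=> z _; rewrite lee_fin mulr_ge0 ?invr_ge0 ?expR_ge0 ?(ltW r0).
- by apply/measurable_EFinP; apply: measurable_funTS; exact: measurable_normal_pdf.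
- move=> z /=; rewrite in_itv/= => /andP[tz zt].
  rewrite lee_fin std_normal_pdfE ler_wpM2l ?invr_ge0 ?(ltW r0)// ler_expR.
  by rewrite ler_pM2r ?invr_gt0// lerN2; nra.
Qed.

Let p_gt0 tau : 0 <= tau -> 0 < p tau.
Proof.
by move=> t0; have := tail_lower_bound t0; have := expR_gt0 (- (tau + 1) ^+ 2 / 2); lra.
Qed.

Lemma nu_ge_sqr tau : 0 <= tau -> tau ^+ 2 <= nu tau.
Proof.
move=> t0; rewrite /nu -/(tail_set tau) -/(p tau) -/(q tau) ler_pdivlMr ?p_gt0//.
rewrite -lee_fin EFinM -qE -pE -integral_cst; last exact: measurable_tail_set.
apply: ge0_le_integral => //; first exact: measurable_tail_set.
- by move=> z _; rewrite lee_fin sqr_ge0.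
- by apply/measurable_EFinP; exact: measurable_funX.
- move=> z /= tz; rewrite lee_fin -[leRHS]real_normK ?num_real//.
  by rewrite ler_pXn2r ?nnegrE// ltW.
Qed.

Lemma nu_le_sqr tau : 1 <= tau -> nu tau <= 64 * tau ^+ 2.
Proof.
move=> t1; have t0 : 0 <= tau by lra.
have p0 := p_gt0 t0.
rewrite /nu -/(tail_set tau) -/(p tau) -/(q tau) ler_pdivrMr//.
(* Beyond M the integral of z^2 is at most 16 exp (- (tau + 1)^2), which [tail_lower_bound] converts
   into 48 p. Below M the integrand is at most M^2 <= 16 tau^2, whence 64 = 16 + 48. *)
set M := 2 * (tau + 1).
have M4 : M ^+ 2 / 4 = (tau + 1) ^+ 2 by rewrite /M; field.
have qM : q tau <= M ^+ 2 * p tau + 2 * (8 * expR (- (M ^+ 2 / 4))).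
  rewrite -lee_fin -qE EFinD EFinM -pE -integral_cst; last exact: measurable_tail_set.
  have mA := measurable_tail_set tau.
  apply: (@le_trans _ _ (\int[N]_(z in tail_set tau) ((M ^+ 2)%:E +
      (8 * expR (- (M ^+ 2 / 4)))%:E * (expR (3 / 8 * z ^+ 2))%:E))%E).
    apply: ge0_le_integral => //.
    - by move=> z _; rewrite lee_fin sqr_ge0.
    - by apply/measurable_EFinP; exact: measurable_funX.
    - apply: measurable_funTS; apply: emeasurable_funD => //; apply: emeasurable_funM => //.
      by apply/measurable_EFinP; exact: measurable_expR_sqr.
    - move=> z _; rewrite -EFinM -EFinD lee_fin.
      have [zM|Mz] := leP (z ^+ 2) (M ^+ 2).
        by rewrite ler_wpDr// !mulr_ge0 ?expR_ge0.
      rewrite ler_wpDl ?sqr_ge0//; apply: le_trans (sqr_le_expR z) _.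
      rewrite -[leRHS]mulrA ler_wpM2l// -expRD ler_expR; lra.
  rewrite ge0_integralD//; last 2 first.
  - by move=> z _; rewrite lee_fin sqr_ge0.
  - apply: measurable_funTS; apply: emeasurable_funM => //.
    by apply/measurable_EFinP; exact: measurable_expR_sqr.
  apply: leeD => //.
  rewrite ge0_integralZl; [|by []| | |]; last 3 first.
  - by apply: measurable_funTS; apply/measurable_EFinP; exact: measurable_expR_sqr.
  - by move=> z _; rewrite lee_fin expR_ge0.
  - by rewrite lee_fin mulr_ge0 ?expR_ge0.
  rewrite (mulrC 2) [leRHS]EFinM lee_wpmul2l//.
  rewrite -integral_expR_sqr_std_normal; apply: ge0_subset_integral => //.
  - by apply/measurable_EFinP; exact: measurable_expR_sqr.
have := tail_lower_bound t0; rewrite M4 in qM.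
have : expR (- (tau + 1) ^+ 2) <= expR (- (tau + 1) ^+ 2 / 2).
  by rewrite ler_expR; have := sqr_ge0 (tau + 1); lra.
move=> h1 h2; apply: le_trans qM _.
have -> : M ^+ 2 = 4 * (tau + 1) ^+ 2 by rewrite /M; ring.
have a1 : (tau + 1) ^+ 2 <= 4 * tau ^+ 2 by nra.
have a2 : 1 <= tau ^+ 2 by nra.
have := ler_wpM2r (ltW p0) a1; have := ler_wpM2r (ltW p0) a2; lra.
Qed.

Lemma trunc_sqE tau z : trunc_sq tau z = (z ^+ 2 - nu tau) * \1_(tail_set tau) z.
Proof.
rewrite /trunc_sq indicE; case: (boolP (tau < `|z|)) => tz; first by rewrite mem_set.
by rewrite memNset//=; apply/negP.
Qed.

Lemma measurable_trunc_sq tau : measurable_fun [set: R] (trunc_sq tau).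
Proof.
rewrite (_ : trunc_sq tau = fun z => (z ^+ 2 - nu tau) * \1_(tail_set tau) z); last first.
  by apply/funext => z; rewrite trunc_sqE.
apply: measurable_funM; last by apply: measurable_indic; exact: measurable_tail_set.
by apply: measurable_funB => //; exact: measurable_funX.
Qed.

Let integrable_trunc tau : N.-integrable setT (fun z => (trunc_sq tau z)%:E).
Proof.
have ic : N.-integrable setT (fun z => (`|nu tau|)%:E).
  exact: finite_measure_integrable_cst.
apply: (le_integrable _ _ _ (integrableD measurableT integrable_sqr ic)) => //.
  by apply/measurable_EFinP; exact: measurable_trunc_sq.
move=> z _; rewrite trunc_sqE /= lee_fin normrM.
rewrite (@le_trans _ _ `|z ^+ 2 - nu tau|)//.
  rewrite -[leRHS]mulr1 ler_wpM2l// indicE; case: (_ \in _); rewrite ?normr1 ?normr0//.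
rewrite (le_trans (ler_normB _ _))// [leRHS]ger0_norm ?addr_ge0 ?sqr_ge0//.
by rewrite ger0_norm ?sqr_ge0.
Qed.

Lemma integral_trunc_sq tau : 0 <= tau -> (\int[N]_z (trunc_sq tau z)%:E = 0)%E.
Proof.
move=> t0; have mA := measurable_tail_set tau.
have -> : (\int[N]_z (trunc_sq tau z)%:E =
    \int[N]_(z in tail_set tau) ((z ^+ 2)%:E - (nu tau)%:E))%E.
  rewrite [RHS]integral_mkcond; apply: eq_integral => z _.
  rewrite trunc_sqE patchE indicE; case: (_ \in _); last by rewrite mulr0.
  by rewrite mulr1 EFinB.
rewrite (@integralB_EFin _ _ _ N _ (fun z => z ^+ 2) (cst (nu tau)) mA); last 2 first.
- by apply: integrableS integrable_sqr.
- exact: finite_measure_integrable_cst.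
have -> : (\int[N]_(z in tail_set tau) (cst (nu tau) z)%:E = (nu tau)%:E * N (tail_set tau))%E.
  by rewrite -integral_cst.
rewrite qE pE -EFinM -EFinB /nu -/(tail_set tau) -/(p tau) -/(q tau).
by rewrite divfK ?subrr// gt_eqF// p_gt0.
Qed.

(** Below the threshold z^2 <= tau^2 <= nu, so truncation only raises the value. On signal columns
    the plain square can therefore be used as a lower bound. *)
Lemma trunc_sq_ge tau z : 0 <= tau -> z ^+ 2 - nu tau <= trunc_sq tau z.
Proof.
move=> t0; rewrite /trunc_sq; case: ltP => tz /=; rewrite ?mulr1 ?mulr0// subr_le0.
apply: le_trans (nu_ge_sqr t0).
by rewrite -[leLHS]real_normK ?num_real// ler_pXn2r ?nnegrE.
Qed.

(** In the quadratic expansion the linear term integrates to zero. The remainder lives on |z| > tau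
    and grows at most like exp (z^2 / 8); comparison with exp (3 z^2 / 8) gains the factor exp (-
    tau^2 / 4). *)
Lemma integral_expR_trunc_sq tau l : 1 <= tau -> `|l| <= 1 / 1024 ->
  (\int[N]_z (expR (l * trunc_sq tau z))%:E <=
    (expR (l ^+ 2 * (2 ^+ 22 * expR (- (tau ^+ 2 / 4)))))%:E)%E.
Proof.
move=> t1 l1; have t0 : 0 <= tau by lra.
(* 2^21 = 64^2 * 512, where 64 comes from [nu_le_sqr] and 512 from z^4 <= 512 exp (z^2 / 16). The
   range 1 / 1024 = 1 / (64 * 16) keeps |l| times the truncated square below z^2 / 16. *)
set K := l ^+ 2 * (2 ^+ 21 * expR (- (tau ^+ 2 / 4))).
have K0 : 0 <= K by rewrite /K mulr_ge0 ?sqr_ge0// mulr_ge0 ?exprn_ge0 ?expR_ge0.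
apply: (@le_trans _ _ (1 + 2 * K)%:E); last first.
  rewrite lee_fin; apply: le_trans (expR_ge1Dx _).
  rewrite lerD2l /K exprS -[2 * 2 ^+ 21 * _]mulrA.
  by move: (2 ^+ 21 * _) (l ^+ 2) => u v; lra.
have mW := measurable_trunc_sq tau.
have ml : measurable_fun [set: R] (fun z => l * trunc_sq tau z) by exact: measurable_funM.
apply: (@le_trans _ _ (\int[N]_z ((1 + l * trunc_sq tau z)%:E +
    K%:E * (expR (3 / 8 * z ^+ 2))%:E))%E).
  apply: ge0_le_integral => //.
  - by apply/measurable_EFinP; exact: measurableT_comp.
  - apply: emeasurable_funD; first by apply/measurable_EFinP; exact: measurable_funD.
    apply: emeasurable_funM => //.
    by apply/measurable_EFinP; exact: measurable_expR_sqr.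
  move=> z _; rewrite -EFinM -EFinD lee_fin.
  apply: le_trans (expR_le_quadratic _) _; rewrite lerD2l.
  have [tz|zt] := ltP tau `|z|; last first.
    by rewrite /trunc_sq ltNge zt /= !mulr0 expr0n mul0r mulr_ge0// expR_ge0.
  have z2 : 0 <= z ^+ 2 by exact: sqr_ge0.
  have tz2 : tau ^+ 2 <= z ^+ 2.
    by rewrite -[leRHS]real_normK ?num_real// ler_pXn2r ?nnegrE// ltW.
  have Wz : `|trunc_sq tau z| <= 64 * z ^+ 2.
    rewrite /trunc_sq tz /= mulr1 ler_norml; apply/andP; split.
      have := nu_le_sqr t1; lra.
    have := nu_ge_sqr t0; have := sqr_ge0 tau; lra.
  have lW : `|l * trunc_sq tau z| <= z ^+ 2 / 16.
    rewrite normrM; apply: le_trans (ler_pM _ _ l1 Wz) _ => //.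
    by rewrite mulrA; lra.
  have E : expR (3 / 8 * z ^+ 2) * expR (- (tau ^+ 2 / 4)) >= expR (z ^+ 2 / 8).
    by rewrite -expRD ler_expR; lra.
  have z4 : z ^+ 4 <= 512 * expR (z ^+ 2 / 16).
    have y0 : 0 <= z ^+ 2 / 16 by lra.
    have := expR_ge1Dxn 1 y0; rewrite (_ : 2`! = 2)%N//.
    by move: (expR _) => e; lra.
  apply: (@le_trans _ _ (l ^+ 2 * (64 * z ^+ 2) ^+ 2 * expR (z ^+ 2 / 16))).
    apply: ler_pM; rewrite ?sqr_ge0 ?expR_ge0 ?ler_expR// exprMn ler_wpM2l ?sqr_ge0//.
    rewrite -[leLHS]real_normK ?num_real// ler_pXn2r ?nnegrE//.
    by rewrite mulr_ge0.
  rewrite /K -[leLHS]mulrA -[leRHS]mulrA; apply: ler_wpM2l; first exact: sqr_ge0.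
  apply: (@le_trans _ _ (2 ^+ 21 * expR (z ^+ 2 / 8))); last first.
    by rewrite -[leRHS]mulrA; apply: ler_wpM2l; [exact: exprn_ge0|rewrite [leRHS]mulrC].
  have -> : z ^+ 2 / 8 = z ^+ 2 / 16 + z ^+ 2 / 16 by field.
  rewrite expRD mulrA ler_wpM2r ?expR_ge0//.
  rewrite exprMn -exprM.
  by move: z4; move: (z ^+ (2 * 2)) (expR _) => a b; lra.
rewrite integralD//=; last 2 first.
- apply: (@eq_integrable _ _ _ N _ measurableT (fun z => 1%E + l%:E * (trunc_sq tau z)%:E)%E).
    by move=> z _; rewrite -EFinM -EFinD.
  apply: integrableD => //; last exact: integrableZl.
  exact: finite_measure_integrable_cst.
- exact: integrableZl.
under eq_integral do rewrite EFinD EFinM.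
rewrite integralD//=; last 2 first.
- exact: finite_measure_integrable_cst.
- exact: integrableZl.
rewrite integral_std_normal_cst integralZl// integral_trunc_sq// mule0 adde0.
by rewrite integralZl// integral_expR_sqr_std_normal -EFinM -EFinD mulrC.
Qed.

End truncated_square.

(** * Scan tests *)

Lemma lt_bigmaxe (R : realType) (I : finType) (P : pred I) (F : I -> R) (c : R) :
  (c%:E < \big[maxe/-oo%E]_(i | P i) (F i)%:E)%E = [exists i, P i && (c < F i)].
Proof.
transitivity (has (fun i => P i && (c < F i)) (index_enum I)).
  elim: (index_enum I) => [|i r IH]; first by rewrite big_nil.
  rewrite big_cons /= -IH; case: (P i) => //=.
  by rewrite lt_max lte_fin.
apply/hasP/existsP => [[i _ Pi]|[i Pi]]; first by exists i.
by exists i; rewrite ?mem_index_enum.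
Qed.

Lemma probability_union_bound d (T : measurableType d) (R : realType)
    (P : probability T R) (I : finType) (Q : pred I) (A : I -> set T) (b : R) :
  (forall i, measurable (A i)) -> (forall i, Q i -> (P (A i) <= b%:E)%E) ->
  (P [set x | exists2 i, Q i & A i x] <= (#|Q|%:R * b)%:E)%E.
Proof.
move=> mA Ab.
have -> : [set x | exists2 i, Q i & A i x] = \big[setU/set0]_(i in Q) A i.
  rewrite -bigcup_pred; apply/seteqP; split => x /=.
    by move=> [i Qi Ai]; exists i.
  by move=> [i /= Qi Ai]; exists i.
have -> : (#|Q|%:R * b)%:E = (\sum_(i in Q) b%:E)%E.
  by rewrite sumEFin sumr_const mulr_natl.
elim: (index_enum I) => [|i r IH]; first by rewrite !big_nil measure0.
rewrite !big_cons; case: ifPn => // Qi.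
apply: le_trans (measureU2 _ _ _) _ => //; first exact: bigsetU_measurable.
by apply: leeD => //; exact: Ab.
Qed.

Lemma card_subsets_of_size n k : #|[pred S : {set 'I_n} | #|S| == k]| = 'C(n, k).
Proof. by rewrite -[in RHS](card_ord n) -card_draws; apply: eq_card => S; rewrite !inE. Qed.

Section scan.
Context {R : realType} {d1 d2 : nat}.
Local Notation N := (@std_normal R).
Implicit Types (g : R -> R) (s : nat) (c l b u : R).

(** Common form of the quadratic and linear regimes: [g] is the truncated square or a multiple of
    the identity. *)
Definition scan_test g s c (Y : 'M[R]_(d1, d2)) : bool :=
  [exists J : {set 'I_d1}, (#|J| == s) && (c < \sum_(j < d2) g (sub_col_mean s J Y j))].

Lemma measurable_scan_statistic g s (J : {set 'I_d1}) : measurable_fun [set: R] g ->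
  measurable_fun [set: 'M[R]_(d1, d2)] (fun Y => \sum_(j < d2) g (sub_col_mean s J Y j)).
Proof.
move=> mg; apply: measurable_sum => j.
by apply: (measurableT_comp mg); exact: measurable_sub_col_mean.
Qed.

Lemma measurable_scan_set g s c (J : {set 'I_d1}) : measurable_fun [set: R] g ->
  measurable [set Y : 'M[R]_(d1, d2) | c < \sum_(j < d2) g (sub_col_mean s J Y j)].
Proof.
move=> mg; have := measurable_scan_statistic s J mg measurableT (measurable_itv `]c, +oo[).
by rewrite setTI; congr measurable; apply/seteqP; split => M /=; rewrite in_itv/= andbT.
Qed.

Lemma scan_testE g s c : [set Y | scan_test g s c Y] =
  [set Y | exists2 J : {set 'I_d1}, #|J| == s &
     [set Y : 'M[R]_(d1, d2) | c < \sum_(j < d2) g (sub_col_mean s J Y j)] Y].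
Proof.
apply/seteqP; split => Y /=.
  by move=> /existsP[J /andP[cJ h]]; exists J.
by move=> [J cJ h]; apply/existsP; exists J; rewrite cJ.
Qed.

Lemma is_test_scan g s c : measurable_fun [set: R] g -> is_test (scan_test g s c).
Proof.
move=> mg; apply: (measurable_fun_bool true).
rewrite setTI (_ : _ @^-1` _ = [set Y | scan_test g s c Y]) //.
rewrite scan_testE (_ : [set Y | _] = \big[setU/set0]_(J in [pred J : {set 'I_d1} | #|J| == s])
  [set Y : 'M[R]_(d1, d2) | c < \sum_(j < d2) g (sub_col_mean s J Y j)]); last first.
  rewrite -bigcup_pred; apply/seteqP; split => x /=.
    by move=> [J QJ AJ]; exists J.
  by move=> [J /= QJ AJ]; exists J.
by apply: bigsetU_measurable => J _; exact: measurable_scan_set.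
Qed.

Lemma scan_test_null g s c l b B : (0 < s)%N -> measurable_fun [set: R] g -> 0 < l ->
  (\int[N]_x (expR (l * g x))%:E <= (expR b)%:E)%E -> d2%:R * b <= B ->
  (law 0%R [set Y | scan_test g s c Y] <= ('C(d1, s)%:R * expR (B - l * c))%:E)%E.
Proof.
move=> s0 mg l0 gb bB.
have -> : law 0%R [set Y | scan_test g s c Y] =
    @gaussian_mx R d1 d2 [set Y | scan_test g s c Y].
  rewrite /law /pushforward; congr (gaussian_mx _ _ _).
  by apply/seteqP; split => Y /=; rewrite add0r.
rewrite scan_testE.
rewrite -card_subsets_of_size.
apply: probability_union_bound => J; first exact: measurable_scan_set.
move=> /= /eqP cJ.
apply: le_trans (chernoff_columns (g := fun _ x => l * g x)
   (b := fun _ => b) (B := B) (l * c) cJ s0 _ _ _).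
- apply: le_measure; rewrite ?inE.
  + exact: measurable_scan_set.
  + have ml : measurable_fun [set: R] (fun x => l * g x) by exact: measurable_funM.
    have := measurable_scan_statistic s J ml measurableT (measurable_itv `[l * c, +oo[).
    by rewrite setTI; congr measurable; apply/seteqP; split => M /=; rewrite in_itv/= andbT.
  + by move=> Y /= h; rewrite -mulr_sumr ler_pM2l// ltW.
- by move=> _; exact: measurable_funM.
- by move=> _; exact: gb.
- by rewrite sumr_const card_ord -mulr_natl.
Qed.

(** A maximum is missed only if the favourable set J is missed too, so no union bound enters. Here
    [m j] is the sure gain of column j and [h j] its random loss; a miss forces the total loss up to
    the total gain minus [c]. *)
Lemma scan_test_miss g s c l (X : 'M[R]_(d1, d2)) (J : {set 'I_d1})
    (m : 'I_d2 -> R) (h : 'I_d2 -> R -> R) (b : 'I_d2 -> R) B u :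
  (0 < s)%N -> #|J| = s -> measurable_fun [set: R] g -> 0 < l ->
  (forall j, measurable_fun [set: R] (h j)) ->
  (forall j z, m j - h j z <= g (sub_col_mean s J X j + z)) ->
  (forall j, \int[N]_x (expR (l * h j x))%:E <= (expR (b j))%:E)%E ->
  \sum_(j < d2) b j <= B -> u <= l * (\sum_(j < d2) m j - c) ->
  (law X [set Y | ~~ scan_test g s c Y] <= (expR (B - u))%:E)%E.
Proof.
move=> s0 cJ mg l0 mh gmh hb bB um; rewrite /law /pushforward.
have mlh j : measurable_fun [set: R] (fun x => l * h j x) by exact: measurable_funM.
apply: le_trans (chernoff_columns (g := fun j x => l * h j x) u cJ s0 mlh hb bB).
have ms := measurable_testN (@is_test_scan _ s c mg).
apply: le_measure; rewrite ?inE.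
- by rewrite -[Y in measurable Y]setTI; exact: (measurable_addmx X measurableT).
- have mS : measurable_fun [set: 'M[R]_(d1, d2)]
    (fun M => \sum_(j < d2) l * h j (sub_col_mean s J M j)).
    apply: measurable_sum => j; apply: (measurableT_comp (mlh j)).
    exact: measurable_sub_col_mean.
  have := mS measurableT _ (measurable_itv `[u, +oo[).
  by rewrite setTI; congr measurable; apply/seteqP; split => M /=; rewrite in_itv/= andbT.
- move=> E /= /existsPn /(_ J); rewrite cJ eqxx /= -leNgt => h1.
  apply: le_trans um _; rewrite -mulr_sumr ler_pM2l//.
  rewrite lerBlDl -lerBlDr; apply: le_trans h1; rewrite -sumrB; apply: ler_sum => j _.
  by rewrite sub_col_meanD.
Qed.

End scan.

(** * Elementary bounds on logarithms and binomial coefficients *)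

Section log_bounds.
Context {R : realType}.
Implicit Types x y : R.

Lemma expR_log_e_bin d s : (s <= d)%N -> expR (log_e_bin d s) = expR 1 * 'C(d, s)%:R :> R.
Proof. by move=> sd; rewrite lnK// posrE mulr_gt0 ?expR_gt0// ltr0n bin_gt0. Qed.

Lemma log_e_binE d s : (s <= d)%N -> log_e_bin d s = 1 + ln 'C(d, s)%:R :> R.
Proof.
move=> sd; rewrite /log_e_bin lnM ?expRK// posrE ?expR_gt0//.
by rewrite ltr0n bin_gt0.
Qed.

Lemma ln_bin_ge0 d s : (s <= d)%N -> 0 <= ln 'C(d, s)%:R :> R.
Proof. by move=> sd; rewrite ln_ge0// ler1n bin_gt0. Qed.

Lemma log_e_bin_ge1 d s : (s <= d)%N -> 1 <= log_e_bin d s :> R.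
Proof. by move=> sd; rewrite log_e_binE// lerDl ln_bin_ge0. Qed.

Lemma bin_le_expR d s : (s <= d)%N -> 'C(d, s)%:R <= expR (log_e_bin d s) :> R.
Proof.
move=> sd; rewrite expR_log_e_bin// ler_peMl// -expR0 ler_expR//.
Qed.

Lemma ler_div_sqr1D x : 0 < x -> x / (1 + x) ^+ 2 <= 1.
Proof. by move=> x0; rewrite ler_pdivrMr ?exprn_gt0//; nra. Qed.

Lemma ln1D_ge x : 0 <= x -> x / (1 + x) <= ln (1 + x).
Proof.
move=> x0; have y0 : 0 < 1 + x by lra.
have := @le_ln1Dx _ (- (x / (1 + x))).
have -> : 1 - x / (1 + x) = (1 + x)^-1 by field; rewrite gt_eqF.
rewrite lnV ?posrE// => H.
have : - 1 < - (x / (1 + x)) by rewrite ltrN2 ltr_pdivrMr//; lra.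
by move=> /H; rewrite lerN2.
Qed.

Lemma ln1D_ge_half x : 0 <= x <= 1 -> x / 2 <= ln (1 + x).
Proof.
move=> /andP[x0 x1]; apply: le_trans (ln1D_ge x0).
by apply: ler_wpM2l => //; rewrite lef_pV2 ?posrE; lra.
Qed.

Lemma ln1D_ge12 x : 1 <= x -> 1 / 2 <= ln (1 + x).
Proof.
move=> x1; apply: le_trans (ln1D_ge _); last by lra.
by rewrite ler_pdivlMr; lra.
Qed.

Lemma ler_ln1D x y : 0 <= x -> x <= y -> ln (1 + x) <= ln (1 + y).
Proof. by move=> x0 xy; rewrite ler_ln ?posrE; lra. Qed.

Lemma ln1D_ge0 x : 0 <= x -> 0 <= ln (1 + x).
Proof. by move=> x0; rewrite ln_ge0// lerDl. Qed.

End log_bounds.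

(** * Error probabilities of the scan tests *)

Section max_test_risk.
Context {R : realType} {d1 d2 : nat}.
Local Notation N := (@std_normal R).
Variables (D : R) (s s2 : nat).
Hypotheses (D0 : 0 <= D) (s0 : (0 < s)%N) (sd : (s <= d1)%N) (s20 : (0 < s2)%N)
  (d20 : (0 < d2)%N).

(* Chernoff exponents stay below [exp_scale], the range covered by
   [integral_expR_trunc_sq]. *)
Definition exp_scale : R := 1 / 1024.

Lemma exp_scale_gt0 : 0 < exp_scale. Proof. by rewrite /exp_scale; lra. Qed.
Lemma exp_scale_le : 16 * exp_scale <= 1. Proof. by rewrite /exp_scale; lra. Qed.
Lemma exp_scaleE : exp_scale ^+ 2 * 2 ^+ 22 = 4.
Proof. by rewrite /exp_scale; field. Qed.

(** Each error is to be at most exp (- D). In the quadratic regime 5 = 4 + 1: under the null, 4 L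
    for the columns and L for the union bound; under the alternative, 4 for the noise columns and 1
    for the signal columns. *)
Definition cutoff : R := (5 + D) / exp_scale.

Lemma cutoffE : exp_scale * cutoff = 5 + D.
Proof. by rewrite /cutoff mulrC divfK// gt_eqF// exp_scale_gt0. Qed.

Lemma cutoff_ge : 5 + D <= cutoff.
Proof.
have D0' := D0.
rewrite /cutoff ler_pdivlMr ?exp_scale_gt0// ler_piMr//; last first.
  by have := exp_scale_gt0; have := exp_scale_le; lra.
by lra.
Qed.

Local Notation L := (@log_e_bin R d1 s).
Local Notation x := (d2%:R / s2%:R ^+ 2 * L).
Local Notation tau := (@tau_mtr R 8 s d1 s2 d2).
Local Notation H := (cutoff : R).

Definition scan_tuning : tuning R := Tuning 8 (H * (s2%:R + L)) (H * Num.sqrt L).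

Let L1 : 1 <= L. Proof. exact: log_e_bin_ge1. Qed.
Let L0 : 0 < L. Proof. by apply: lt_le_trans L1. Qed.
Let s2R : 0 < s2%:R :> R. Proof. by rewrite ltr0n. Qed.
Let d2R : 0 < d2%:R :> R. Proof. by rewrite ltr0n. Qed.
Let x0 : 0 < x. Proof. by rewrite mulr_gt0// divr_gt0// exprn_gt0. Qed.
Let H0 : 0 < H. Proof. by have D0' := D0; apply: lt_le_trans cutoff_ge; lra. Qed.

Lemma scan_tuning_pos : tuning_pos scan_tuning.
Proof.
split => /=; first by [].
  by apply: mulr_gt0 => //; exact: addr_gt0.
by apply: mulr_gt0 => //; rewrite sqrtr_gt0.
Qed.

Lemma max_testE (Y : 'M[R]_(d1, d2)) : max_test scan_tuning s s2 Y =
  if 1 <= x then scan_test (trunc_sq tau) s (H * (s2%:R + L)) Y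
  else scan_test (fun y => (Num.sqrt d2%:R)^-1 * y) s (H * Num.sqrt L) Y.
Proof.
rewrite /max_test /t_mtr /t_ml !lt_bigmaxe /scan_test /=; case: ifP => // _.
by apply: eq_existsb => J; rewrite mulr_sumr.
Qed.

Let measurable_lin : measurable_fun [set: R] (fun y : R => (Num.sqrt d2%:R)^-1 * y).
Proof. exact: measurable_funM. Qed.

Lemma is_test_max_test : is_test (@max_test R d1 d2 scan_tuning s s2).
Proof.
have -> : @max_test R d1 d2 scan_tuning s s2 =
  if 1 <= x then scan_test (trunc_sq tau) s (H * (s2%:R + L))
  else scan_test (fun y => (Num.sqrt d2%:R)^-1 * y) s (H * Num.sqrt L).
  by apply/funext => Y; rewrite max_testE; case: ifP.
case: ifP => _; apply: is_test_scan; last exact: measurable_lin.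
exact: measurable_trunc_sq.
Qed.

Let tau2 : tau ^+ 2 = 8 * ln (1 + x).
Proof. by rewrite sqr_sqrtr// mulr_ge0// ln1D_ge0// ltW. Qed.

Let tau_ge1 : 1 <= x -> 1 <= tau.
Proof.
move=> x1; rewrite -(ler_pXn2r (n := 2)) ?nnegrE ?sqrtr_ge0// tau2 expr1n.
by have := ln1D_ge12 x1; lra.
Qed.

Let exp_tau : expR (- (tau ^+ 2 / 4)) = ((1 + x) ^+ 2)^-1.
Proof.
have x0' := x0; rewrite tau2 (_ : 8 * _ / 4 = ln (1 + x) + ln (1 + x)); last by field.
by rewrite expRN expRD lnK ?posrE; [rewrite expr2|lra].
Qed.

Let x_frac : x / (1 + x) ^+ 2 <= 1.
Proof.
exact: ler_div_sqr1D.
Qed.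

Lemma sqrtL_ge1 : 1 <= Num.sqrt L.
Proof. by rewrite -(ler_pXn2r (n := 2)) ?nnegrE ?sqrtr_ge0// sqr_sqrtr ?(ltW L0)// expr1n. Qed.

Lemma integral_expR_lin l : (\int[N]_y (expR (l * ((Num.sqrt d2%:R)^-1 * y)))%:E <=
  (expR (l ^+ 2 / (2 * d2%:R)))%:E)%E.
Proof.
under eq_integral do rewrite mulrA.
rewrite integral_expR_std_normal lee_fin ler_expR exprMn exprVn sqr_sqrtr ?(ltW d2R)//.
by rewrite invfM !mulrA [_ / 2 / _]mulrAC.
Qed.

Lemma max_test_null :
  (law 0%R [set Y : 'M[R]_(d1, d2) | max_test scan_tuning s s2 Y] <= (expR (- D))%:E)%E.
Proof.
have -> : [set Y : 'M[R]_(d1, d2) | max_test scan_tuning s s2 Y] =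
  if 1 <= x then [set Y | scan_test (trunc_sq tau) s (H * (s2%:R + L)) Y]
  else [set Y | scan_test (fun y => (Num.sqrt d2%:R)^-1 * y) s (H * Num.sqrt L) Y].
  by apply/seteqP; split => Y; case: ifPn => h /=; rewrite max_testE ?h ?(negbTE h).
have CL := @bin_le_expR R _ _ sd.
have LD : D <= L * D by rewrite ler_peMl.
have e0 := exp_scale_gt0.
case: ifPn => [x1|]; last rewrite -ltNge => x1.
  (* The ratio is at most 1, which keeps [l] in the admissible range, and at most L / s2, which
     keeps the cost of the columns below 4 L. Times the cutoff it gives exactly (5 + D) L. *)
  pose l := exp_scale * (L / (s2%:R + L)).
  have sL : 0 < s2%:R + L by exact: addr_gt0.
  have l0 : 0 < l by rewrite /l mulr_gt0// divr_gt0.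
  have l1 : `|l| <= 1 / 1024.
    rewrite gtr0_norm// /l ler_piMr//; first exact: ltW.
    by rewrite ler_pdivrMr// mul1r lerDr ltW.
  have lb := integral_expR_trunc_sq (tau_ge1 x1) l1.
  apply: le_trans (scan_test_null (B := 4 * L) _ s0 (measurable_trunc_sq _) l0 lb _) _.
    rewrite exp_tau.
    have h1 : l <= exp_scale * (L / s2%:R).
      rewrite /l; apply: ler_wpM2l; first exact: ltW.
      apply: ler_wpM2l; first exact: ltW.
      by rewrite lef_pV2 ?posrE// lerDl ltW.
    have h2 : l ^+ 2 <= (exp_scale * (L / s2%:R)) ^+ 2.
      by rewrite ler_pXn2r ?nnegrE ?(ltW l0)// (le_trans (ltW l0) h1).
    have y0 : 0 < 1 + x by have := x0; lra.
    have v0 : 0 <= 2 ^+ 22 * ((1 + x) ^+ 2)^-1.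
      by rewrite mulr_ge0 ?exprn_ge0// invr_ge0 exprn_ge0// ltW.
    apply: (@le_trans _ _ (4 * (x / (1 + x) ^+ 2) * L)); last first.
      rewrite -[leRHS]mulr1 mulrAC; apply: ler_wpM2l => //.
      by rewrite mulr_ge0// ltW.
    apply: (@le_trans _ _ (d2%:R * ((exp_scale * (L / s2%:R)) ^+ 2 *
        (2 ^+ 22 * ((1 + x) ^+ 2)^-1)))).
      by apply: ler_wpM2l; [exact: ltW|exact: ler_wpM2r].
    rewrite le_eqVlt; apply/orP; left; apply/eqP.
    rewrite -exp_scaleE; move: ((1 + x) ^+ 2)^-1 (2 ^+ 22) => c v.
    by field; rewrite gt_eqF.
  apply: (@le_trans _ _ (expR L * expR (4 * L - l * (H * (s2%:R + L))))%:E).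
    by rewrite lee_fin ler_wpM2r ?expR_ge0.
  have -> : l * (H * (s2%:R + L)) = (5 + D) * L.
    by rewrite -cutoffE /l; field; rewrite gt_eqF.
  rewrite -expRD lee_fin ler_expR; lra.
have sL2 : Num.sqrt L ^+ 2 = L by rewrite sqr_sqrtr// ltW.
(* The exponent sqrt L costs L / 2 and earns [cutoff] times L, which leaves enough for the union
   bound L. *)
apply: le_trans (scan_test_null (B := L / 2) _ s0 measurable_lin _ (integral_expR_lin (Num.sqrt L)) _) _.
- by rewrite sqrtr_gt0.
- rewrite sL2 le_eqVlt; apply/orP; left; apply/eqP; by field; rewrite gt_eqF.
apply: (@le_trans _ _ (expR L * expR (L / 2 - Num.sqrt L * (H * Num.sqrt L)))%:E).
  by rewrite lee_fin ler_wpM2r ?expR_ge0.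
rewrite mulrCA -expr2 sL2 -expRD lee_fin ler_expR.
have := ler_wpM2r (ltW L0) cutoff_ge; have := L0; lra.
Qed.

Lemma max_test_miss (X : 'M[R]_(d1, d2)) (J : {set 'I_d1}) (S2 : {set 'I_d2}) (th : R) :
  #|J| = s -> #|S2| = s2 -> 0 <= th ->
  (forall j, j \in S2 -> th <= sub_col_mean s J X j) ->
  (forall j, j \notin S2 -> sub_col_mean s J X j = 0) ->
  (1 <= x -> (1024 + 8 * H) * (s2%:R * ln (1 + x) + L) <= s2%:R * th ^+ 2) ->
  (x < 1 -> (2 * H) ^+ 2 * L <= s2%:R ^+ 2 * th ^+ 2 / d2%:R) ->
  (law X [set Y | ~~ max_test scan_tuning s s2 Y] <= (expR (- D))%:E)%E.
Proof.
move=> cJ cS th0 thS th0S hx1 hx2.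
have -> : [set Y : 'M[R]_(d1, d2) | ~~ max_test scan_tuning s s2 Y] =
  if 1 <= x then [set Y | ~~ scan_test (trunc_sq tau) s (H * (s2%:R + L)) Y]
  else [set Y | ~~ scan_test (fun y => (Num.sqrt d2%:R)^-1 * y) s (H * Num.sqrt L) Y].
  by apply/seteqP; split => Y; case: ifPn => h /=; rewrite max_testE ?h ?(negbTE h).
have e0 := exp_scale_gt0.
have sumS (a b : R) : \sum_(j < d2) (if j \in S2 then a else b) <= s2%:R * a + d2%:R * `|b|.
  rewrite (bigID (mem S2)) /=; apply: lerD.
    rewrite (eq_bigr (fun=> a)); last by move=> j ->.
    by rewrite sumr_const cS mulr_natl.
  rewrite (eq_bigr (fun=> b)); last by move=> j /negbTE ->.
  rewrite sumr_const -[leLHS]mulr_natl (le_trans (ler_norm _))// normrM normr_nat.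
  by rewrite ler_wpM2r// ler_nat (leq_trans (max_card _))// card_ord.
have sumS0 (a : R) : \sum_(j < d2) (if j \in S2 then a else 0) = s2%:R * a.
  by rewrite -big_mkcond /= sumr_const cS mulr_natl.
case: ifPn => [x1|]; last rewrite -ltNge => x1.
  have t1 := tau_ge1 x1; have t0 : 0 <= tau by lra.
  (* With a single row set the budget is a constant instead of a multiple of L; this [l] makes the
     s2 signal columns cost at most 1 in total. *)
  pose l := exp_scale / s2%:R.
  have l0 : 0 < l by rewrite divr_gt0.
  have l1 : `|l| <= exp_scale.
    by rewrite gtr0_norm// ler_pdivrMr// ler_peMr ?(ltW e0)// ler1n.
  (* On a signal column (y + z)^2 >= y^2 / 2 - z^2, so the gain is half the squared signal minus
     [nu] and the loss is z^2. Elsewhere the loss is the centred statistic itself. *)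
  pose h j z := if j \in S2 then z ^+ 2 else - trunc_sq tau z.
  pose m j := if j \in S2 then th ^+ 2 / 2 - nu tau else 0.
  pose v := l ^+ 2 * (2 ^+ 22 * expR (- (tau ^+ 2 / 4))).
  have v0 : 0 <= v by rewrite /v mulr_ge0 ?sqr_ge0// mulr_ge0 ?exprn_ge0 ?expR_ge0.
  apply: le_trans (scan_test_miss (m := m) (h := h) (l := l)
    (b := fun j => if j \in S2 then 16 * l else v) (B := 5) (u := 5 + D) s0 cJ
    (measurable_trunc_sq _) l0 _ _ _ _ _) _.
  - move=> j; rewrite /h; case: (j \in S2); first exact: measurable_funX.
    by apply: measurableT_comp => //; exact: measurable_trunc_sq.
  - move=> j z; rewrite /m /h; case: (boolP (j \in S2)) => jS; last first.
      by rewrite (th0S _ jS) !add0r opprK.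
    apply: le_trans (trunc_sq_ge _ t0).
    have := thS j jS; move: (sub_col_mean s J X j) => y ty.
    have : th ^+ 2 <= y ^+ 2 by rewrite ler_pXn2r ?nnegrE// (le_trans th0).
    have := sqr_ge0 (y + 2 * z); lra.
  - move=> j; rewrite /h; case: (j \in S2).
      apply: integral_expR_sqr_le; rewrite (ltW l0) /=.
      have := exp_scale_le; rewrite gtr0_norm// in l1; lra.
    under eq_integral do rewrite mulrN -mulNr.
    apply: le_trans (integral_expR_trunc_sq t1 _) _; first by rewrite normrN.
    by rewrite sqrrN.
  - apply: le_trans (sumS _ _) _; rewrite (ger0_norm v0).
    have a1 : s2%:R * (16 * l) <= 1.
      rewrite (_ : _ * _ = 16 * exp_scale) ?exp_scale_le// /l; field.
      by rewrite gt_eqF.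
    suff : d2%:R * v <= 4 by lra.
    apply: (@le_trans _ _ (4 * (x / (1 + x) ^+ 2))); last by have := x_frac; lra.
    have -> : d2%:R * v = 4 * (d2%:R / s2%:R ^+ 2 / (1 + x) ^+ 2).
      rewrite /v exp_tau -exp_scaleE /l; move: ((1 + x) ^+ 2)^-1 (2 ^+ 22) => c w.
      by field; rewrite gt_eqF.
    apply: ler_wpM2l => //; apply: ler_wpM2r.
      by rewrite invr_ge0 exprn_ge0//; have := x0; lra.
    by apply: ler_peMr => //; rewrite divr_ge0 ?exprn_ge0// ltW.
  - rewrite /m sumS0.
    have -> : l * (s2%:R * (th ^+ 2 / 2 - nu tau) - H * (s2%:R + L)) =
        exp_scale * (th ^+ 2 / 2 - nu tau - H * (1 + L / s2%:R)).
      by rewrite /l; field; rewrite gt_eqF.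
    (* What remains is th^2 >= 2 nu + 4 H + 2 H L / s2. Here 2 nu <= 1024 ln (1 + x) by [nu_le_sqr]
       and the truncation constant 8, and ln (1 + x) >= 1 / 2 pays for 4 H. *)
    rewrite -cutoffE; apply: ler_wpM2l; first exact: ltW.
    have nut := nu_le_sqr t1; rewrite tau2 in nut.
    have lnx := ln1D_ge12 x1.
    have w0 : 0 < L / s2%:R by rewrite divr_gt0.
    have hx : (1024 + 8 * H) * (ln (1 + x) + L / s2%:R) <= th ^+ 2.
      rewrite -(ler_pM2l s2R); apply: le_trans (hx1 x1).
      rewrite le_eqVlt; apply/orP; left; apply/eqP.
      by field; rewrite gt_eqF.
    have p1 := ler_wpM2l (ltW H0) lnx.
    have p2 := mulr_ge0 (ltW H0) (ltW w0).
    have H0' := H0; lra.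
  by rewrite lee_fin ler_expR; lra.
pose c := (Num.sqrt (d2%:R : R))^-1.
have c0 : 0 < c by rewrite invr_gt0 sqrtr_gt0.
have c2 : c ^+ 2 = d2%:R^-1 by rewrite exprVn sqr_sqrtr// ltW.
pose m j := if j \in S2 then c * th else 0.
apply: le_trans (scan_test_miss (m := m) (h := fun _ z => - (c * z)) (l := 1)
  (b := fun _ => (2 * d2%:R)^-1) (B := 1 / 2) (u := 1 / 2 + D) s0 cJ
  measurable_lin _ _ _ _ _ _) _.
- by [].
- by move=> _; apply: measurableT_comp => //; exact: measurable_lin.
- move=> j z; rewrite opprK mulrDr -/c lerD2r /m; case: (boolP (j \in S2)) => jS.
    by rewrite ler_wpM2l ?thS ?(ltW c0).
  by rewrite (th0S _ jS) mulr0.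
- move=> _; under eq_integral do rewrite mul1r -mulN1r.
  by apply: le_trans (integral_expR_lin _) _; rewrite sqrrN expr1n mul1r.
- rewrite sumr_const card_ord -mulr_natl le_eqVlt; apply/orP; left; apply/eqP.
  by field; rewrite gt_eqF.
- rewrite /m sumS0 mul1r.
  have h1 : 2 * H * Num.sqrt L <= s2%:R * (c * th).
    have Hn : 0 <= 2 * H * Num.sqrt L by rewrite mulr_ge0 ?sqrtr_ge0// mulr_ge0// (ltW H0).
    have Hm : 0 <= s2%:R * (c * th).
      by apply: mulr_ge0 => //; apply: mulr_ge0 => //; exact: ltW.
    rewrite -(ler_pXn2r (n := 2)) ?nnegrE//.
    have -> : (2 * H * Num.sqrt L) ^+ 2 = (2 * H) ^+ 2 * L.
      by rewrite [LHS]exprMn sqr_sqrtr ?(ltW L0).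
    have -> : (s2%:R * (c * th)) ^+ 2 = s2%:R ^+ 2 * th ^+ 2 / d2%:R.
      by rewrite !exprMn c2; field; rewrite gt_eqF.
    exact: hx2.
  have p1 := ler_wpM2l (ltW H0) sqrtL_ge1.
  have := cutoff_ge; lra.
by rewrite lee_fin ler_expR; lra.
Qed.

End max_test_risk.

(** * Comparison of the rates *)

Section rate_comparison.
Context {R : realType}.

(** Logarithm of C(n, k) <= (e n / k)^k, which combines C(n, k) k! <= n^k with k^k <= e^k k!, one
    term of the exponential series. *)
Lemma ln_bin_le (n k : nat) : (0 < k <= n)%N ->
  ln 'C(n, k)%:R <= k%:R * (1 + ln (n%:R / k%:R)) :> R.
Proof.
move=> /andP[k0 kn].
have k0R : 0 < k%:R :> R by rewrite ltr0n.
have n0R : 0 < n%:R :> R by rewrite ltr0n (leq_trans k0).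
have C0 : 0 < 'C(n, k)%:R :> R by rewrite ltr0n bin_gt0.
have f0 : 0 < (k`!)%:R :> R by rewrite ltr0n fact_gt0.
have h1 : 'C(n, k)%:R * (k`!)%:R <= n%:R ^+ k :> R.
  rewrite -natrM -natrX ler_nat bin_ffact ffactE.
  elim: k {k0 kn k0R C0 f0} => [|k IH]; first by rewrite expn0.
  by rewrite -ffactE ffactnSr expnSr leq_mul ?ffactE ?leq_subr.
have h2 : k%:R ^+ k <= expR k%:R * (k`!)%:R :> R.
  have := expR_ge1Dxn k.-1 (ltW k0R); rewrite prednK// => h.
  by rewrite -ler_pdivrMr//; lra.
have h3 : 'C(n, k)%:R <= expR k%:R * (n%:R / k%:R) ^+ k :> R.
  rewrite expr_div_n mulrA ler_pdivlMr ?exprn_gt0//.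
  rewrite -(ler_pM2r f0) mulrAC.
  apply: le_trans (ler_wpM2r _ h1) _; first by rewrite exprn_ge0// ltW.
  have := ler_wpM2l (exprn_ge0 k (ltW n0R)) h2.
  by rewrite [leRHS]mulrCA [leRHS]mulrA.
have r0 : 0 < n%:R / k%:R :> R by exact: divr_gt0.
rewrite -[leRHS]expRK ler_ln ?posrE ?expR_gt0//.
apply: le_trans h3 _; rewrite mulrDr mulr1 expRD ler_wpM2l ?expR_ge0//.
by rewrite expRM_natl lnK ?posrE.
Qed.

Lemma log_e_bin_le (n k : nat) : (0 < k <= n)%N ->
  log_e_bin n k <= k%:R * (2 + ln (n%:R / k%:R)) :> R.
Proof.
move=> /[dup] /ln_bin_le h /andP[k0 kn]; rewrite log_e_binE//.
apply: le_trans (_ : 1 + k%:R * (1 + ln (n%:R / k%:R)) <= _); first by rewrite lerD2l.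
have k1 : 1 <= k%:R :> R by rewrite ler1n.
lra.
Qed.

Lemma psi_ge0 s1 d1 s2 d2 : (s1 <= d1)%N -> 0 <= psi s1 d1 s2 d2 :> R.
Proof.
move=> s1d; rewrite mulr_ge0 ?invr_ge0// ln1D_ge0// mulr_ge0//.
exact: le_trans (log_e_bin_ge1 s1d).
Qed.

(** Both sides are compared with r = d1 / s1: beta_21 <= (1 + ln r) / s2 always, and the hypothesis
    raises the argument in psi_21 to at least 1 + r. As r >= 1, ln (1 + r) >= 1 / 2, which gives the
    factor 3. *)
Lemma beta_le_psi s1 d1 s2 d2 : (0 < s1 <= d1)%N -> (0 < s2 <= d2)%N ->
  s1%:R <= log_e_bin d2 s2 :> R -> beta s2 d2 s1 d1 <= 3 * psi s2 d2 s1 d1 :> R.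
Proof.
move=> s1d s2d sL; have /andP[s10 s1d'] := s1d; have /andP[s20 s2d'] := s2d.
have s1R : 0 < s1%:R :> R by rewrite ltr0n.
have s2R : 0 < s2%:R :> R by rewrite ltr0n.
have d1R : 0 < d1%:R :> R by rewrite ltr0n (leq_trans s10).
pose r : R := d1%:R / s1%:R.
have r1 : 1 <= r by rewrite /r ler_pdivlMr// mul1r ler_nat.
have b1 : beta s2 d2 s1 d1 <= s2%:R^-1 * (1 + ln r).
  rewrite /beta; apply: (@le_trans _ _ ((s2%:R * s1%:R)^-1 * ln 'C(d1, s1)%:R)).
    apply: ler_piMr; last by case: (_ < _).
    by rewrite mulr_ge0 ?ln_bin_ge0// invr_ge0 mulr_ge0.
  rewrite invfM -mulrA ler_wpM2l ?invr_ge0//.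
  by rewrite ler_pdivrMl//; exact: ln_bin_le.
have p1 : s2%:R^-1 * ln (1 + r) <= psi s2 d2 s1 d1.
  rewrite /psi ler_wpM2l ?invr_ge0// ler_ln1D//; first by rewrite (le_trans ler01).
  have -> : d1%:R / s1%:R ^+ 2 * log_e_bin d2 s2 = r * (log_e_bin d2 s2 / s1%:R).
    by rewrite /r; field; rewrite gt_eqF.
  apply: ler_peMr; first by rewrite (le_trans ler01).
  by rewrite ler_pdivlMr// mul1r.
apply: le_trans b1 _.
apply: (@le_trans _ _ (3 * (s2%:R^-1 * ln (1 + r)))); last by rewrite ler_pM2l.
rewrite mulrCA ler_wpM2l ?invr_ge0//.
have := ln1D_ge12 r1.
have : ln r <= ln (1 + r) by rewrite ler_ln ?posrE; lra.
by lra.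
Qed.

(** The indicator in beta_12 tests exactly the quantity inside the logarithm of psi_21. When it is
    on, psi_21 >= 1 / (2 s2), while the hypothesis gives beta_12 <= 1 / s2. *)
Lemma beta_le_psi_swap s1 d1 s2 d2 : (0 < s1 <= d1)%N -> (0 < s2 <= d2)%N ->
  log_e_bin d2 s2 <= s1%:R :> R -> beta s1 d1 s2 d2 <= 3 * psi s2 d2 s1 d1 :> R.
Proof.
move=> s1d s2d sL; have /andP[s10 s1d'] := s1d; have /andP[s20 s2d'] := s2d.
have s1R : 0 < s1%:R :> R by rewrite ltr0n.
have s2R : 0 < s2%:R :> R by rewrite ltr0n.
have psi0 := @psi_ge0 s2 d2 s1 d1 s2d'.
rewrite /beta; case: ltP => x1; last by rewrite mulr0 mulr_ge0.
rewrite mulr1 /psi [leRHS]mulrCA invfM mulrAC mulrC ler_wpM2l ?invr_ge0//.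
have := ln1D_ge12 (ltW x1).
have : s1%:R^-1 * ln 'C(d2, s2)%:R <= 1 :> R.
  rewrite ler_pdivrMl// mulr1; apply: le_trans sL; rewrite log_e_binE//; lra.
by lra.
Qed.

Lemma Rtilde_le_rate s1 d1 s2 d2 : (0 < s1 <= d1)%N -> (0 < s2 <= d2)%N ->
  Rtilde s1 d1 s2 d2 <= 4 * rate s1 d1 s2 d2 :> R.
Proof.
move=> s1d s2d; have /andP[s10 s1d'] := s1d; have /andP[s20 s2d'] := s2d.
have p12 := @psi_ge0 s1 d1 s2 d2 s1d'; have p21 := @psi_ge0 s2 d2 s1 d1 s2d'.
have f12 : 0 <= phi s1 d1 s2 d2 :> R.
  by rewrite mulr_ge0 ?divr_ge0 ?exprn_ge0// ln1D_ge0// divr_ge0 ?exprn_ge0.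
have f21 : 0 <= phi s2 d2 s1 d1 :> R.
  by rewrite mulr_ge0 ?divr_ge0 ?exprn_ge0// ln1D_ge0// divr_ge0 ?exprn_ge0.
rewrite /Rtilde /rate !minr_pMr// !le_min !ge_min; apply/and3P; split.
- have [sL|/ltW sL] := leP (s1%:R : R) (log_e_bin d2 s2).
    by have := beta_le_psi s1d s2d sL => h; apply/orP; left; lra.
  have := beta_le_psi_swap s1d s2d sL => h.
  by apply/orP; right; apply/orP; left; lra.
- apply/orP; right; apply/orP; right; apply/orP; left; lra.
- apply/orP; right; apply/orP; right; apply/orP; right; lra.
Qed.

End rate_comparison.

(** * Risk of the tests *)

Section upper_bound.
Context {R : realType} {d1 d2 : nat}.
Variable D : R.
Hypothesis D0 : 0 <= D.
Local Notation H := (cutoff D).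

(** The first summand serves the quadratic regime, where L is absorbed into the rate at the price of
    a factor 3. The second is twice (2 H)^2 for the linear regime, where ln (1 + x) >= x / 2. *)
Definition signal_factor : R := 3 * (1024 + 8 * H) + 8 * H ^+ 2.

Let H0 : 0 < H. Proof. by have D0' := D0; apply: lt_le_trans (cutoff_ge D0); lra. Qed.

Lemma signal_factor_gt0 : 0 < signal_factor.
Proof. rewrite /signal_factor; have H0' := H0; have := sqr_ge0 H; lra. Qed.

Lemma signal_factor_ge1 : 3 * (1024 + 8 * H) <= signal_factor.
Proof. rewrite /signal_factor; have := sqr_ge0 H; lra. Qed.

Lemma signal_factor_ge2 : 2 * (2 * H) ^+ 2 <= signal_factor.
Proof. rewrite /signal_factor; have H0' := H0; have := sqr_ge0 H; lra. Qed.

(** Any J containing the signal rows is allowed, so that the scan uses J = S1 and the global sums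
    use all rows. *)
Lemma Theta_signal s s1 s2 (mu : R) (X : 'M[R]_(d1, d2)) : 0 <= mu -> Theta s1 s2 mu X ->
  exists (S1 : {set 'I_d1}) (S2 : {set 'I_d2}), [/\ #|S1| = s1, #|S2| = s2 &
    forall J : {set 'I_d1}, S1 \subset J ->
      (forall j, j \in S2 -> (Num.sqrt s%:R)^-1 * (s1%:R * mu) <= sub_col_mean s J X j) /\
      (forall j, j \notin S2 -> sub_col_mean s J X j = 0)].
Proof.
move=> mu0 [S1 [S2 [c1 c2 h1 h2]]]; exists S1, S2; split => // J SJ; split => j jS.
  rewrite /sub_col_mean ler_wpM2l ?invr_ge0 ?sqrtr_ge0//.
  rewrite (big_setID S1) /= (finset.setIidPr SJ) -[leLHS]addr0; apply: lerD.
    rewrite -c1 mulr_natl -sumr_const; apply: ler_sum => i iS.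
    by apply: h1; rewrite iS.
  apply: sumr_ge0 => i; rewrite inE => /andP[iS _].
  by rewrite h2// (negbTE iS).
rewrite /sub_col_mean big1 ?mulr0// => i _.
by apply: h2; rewrite (negbTE jS) andbF.
Qed.

Lemma max_test_risk s s1 s2 (mu th : R) :
  (0 < s)%N -> (s <= d1)%N -> (0 < s2)%N -> (0 < d2)%N -> 0 <= th ->
  (forall X : 'M[R]_(d1, d2), Theta s1 s2 mu X ->
    exists (J : {set 'I_d1}) (S2 : {set 'I_d2}), [/\ #|J| = s, #|S2| = s2,
      forall j, j \in S2 -> th <= sub_col_mean s J X j &
      forall j, j \notin S2 -> sub_col_mean s J X j = 0]) ->
  (1 <= d2%:R / s2%:R ^+ 2 * log_e_bin d1 s :> R ->
    (1024 + 8 * H) * (s2%:R * ln (1 + d2%:R / s2%:R ^+ 2 * log_e_bin d1 s) + log_e_bin d1 s)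
      <= s2%:R * th ^+ 2) ->
  (d2%:R / s2%:R ^+ 2 * log_e_bin d1 s < 1 :> R ->
    (2 * H) ^+ 2 * log_e_bin d1 s <= s2%:R ^+ 2 * th ^+ 2 / d2%:R) ->
  (risk s1 s2 (@max_test R d1 d2 (@scan_tuning R d1 D s s2) s s2) mu
     <= (2 * expR (- D))%:E)%E.
Proof.
move=> s0 sd s20 d20 th0 TJ hx1 hx2; rewrite /risk mulr2n mulrDl mul1r EFinD.
apply: leeD; first exact: max_test_null.
apply: ge_ereal_sup => _ [X TX <-]; have [J [S2 [cJ cS h1 h2]]] := TJ X TX.
exact: (max_test_miss D0 s0 sd s20 d20 cJ cS th0 h1 h2 hx1 hx2).
Qed.

Lemma scan_risk s1 s2 (mu : R) : (0 < s1 <= d1)%N -> (0 < s2 <= d2)%N -> 0 < mu ->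
  signal_factor * (psi s1 d1 s2 d2 + beta s2 d2 s1 d1) <= mu ^+ 2 ->
  (risk s1 s2 (@max_test R d1 d2 (@scan_tuning R d1 D s1 s2) s1 s2) mu
     <= (2 * expR (- D))%:E)%E.
Proof.
move=> /andP[s10 s1d] /andP[s20 s2d] mu0 hmu.
have d20 : (0 < d2)%N by exact: leq_trans s2d.
have s1R : 0 < s1%:R :> R by rewrite ltr0n.
have s2R : 0 < s2%:R :> R by rewrite ltr0n.
have d2R : 0 < d2%:R :> R by rewrite ltr0n.
have s21 : 1 <= s2%:R :> R by rewrite ler1n.
pose th := (Num.sqrt s1%:R)^-1 * (s1%:R * mu).
have th0 : 0 <= th by rewrite !mulr_ge0 ?invr_ge0 ?sqrtr_ge0 ?(ltW mu0).
have th2 : th ^+ 2 = s1%:R * mu ^+ 2.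
  by rewrite /th !exprMn exprVn sqr_sqrtr//; field; rewrite gt_eqF.
have lC := @ln_bin_ge0 R _ _ s1d.
have H0' := H0; have F0 := signal_factor_gt0.
have L1 := @log_e_bin_ge1 R _ _ s1d.
have LE := @log_e_binE R _ _ s1d.
move: hmu; rewrite /psi /beta; set L := log_e_bin d1 s1; set x := d2%:R / s2%:R ^+ 2 * L.
set lc := ln 'C(d1, s1)%:R; set b : R := (1 < x)%R%:R => hmu.
have lc0 : 0 <= lc by exact: lC.
have b0 : 0 <= b by rewrite /b; case: (_ < _).
have x0 : 0 < x by rewrite mulr_gt0 ?divr_gt0 ?exprn_gt0// (lt_le_trans _ L1).
have y0 : 0 <= ln (1 + x) by rewrite ln1D_ge0// ltW.
have sig : signal_factor * (s2%:R * ln (1 + x) + lc * b) <= s2%:R * th ^+ 2.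
  rewrite th2 mulrA -ler_pdivrMl ?mulr_gt0//.
  apply: le_trans hmu; rewrite le_eqVlt; apply/orP; left; apply/eqP.
  by field; rewrite !gt_eqF.
apply: (max_test_risk s10 s1d s20 d20 th0).
- move=> X /(Theta_signal s1 (ltW mu0))[S1 [S2 [c1 c2 h]]].
  by have [h1 h2] := h S1 (subxx _); exists S1, S2.
- rewrite -/L -/x => x1; apply: le_trans sig.
  apply: (@le_trans _ _ ((1024 + 8 * H) * (3 * (s2%:R * ln (1 + x) + lc * b)))).
    apply: ler_wpM2l; first by lra.
    have yx := ln1D_ge12 x1.
    have s2y : s2%:R * (1 / 2) <= s2%:R * ln (1 + x) by apply: ler_wpM2l.
    have lb0 : 0 <= lc * b by exact: mulr_ge0.
    (* The indicator in beta_21 is strict, whereas the test is already quadratic at x = 1. At that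
       point the indicator vanishes, but L = s2^2 / d2 <= s2 is paid by s2 ln (1 + x). *)
    have [x1'|x1'] := leP x 1; last first.
      have -> : L = 1 + lc by [].
      have -> : b = 1 by rewrite /b x1'.
      lra.
    have Ls : L <= s2%:R.
      have x2 : L = x * (s2%:R ^+ 2 / d2%:R) by rewrite /x; field; rewrite !gt_eqF.
      rewrite x2; apply: le_trans (_ : s2%:R ^+ 2 / d2%:R <= _).
        by rewrite ler_piMl// divr_ge0// exprn_ge0.
      by rewrite ler_pdivrMr// expr2 ler_wpM2l// ler_nat.
    by lra.
  rewrite mulrCA mulrA; apply: ler_wpM2r; last exact: signal_factor_ge1.
  by rewrite addr_ge0// mulr_ge0.
- rewrite -/L -/x => x1.
  rewrite ler_pdivlMr// -mulrA; apply: (@le_trans _ _ (s2%:R * (signal_factor * (s2%:R * (x / 2))))).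
    have -> : L * d2%:R = s2%:R ^+ 2 * x.
      by rewrite /x; field; rewrite gt_eqF.
    apply: (@le_trans _ _ (signal_factor * (1 / 2) * (s2%:R ^+ 2 * x))).
      apply: ler_wpM2r; first by rewrite mulr_ge0 ?exprn_ge0// ltW.
      by have := signal_factor_ge2; lra.
    by rewrite le_eqVlt; apply/orP; left; apply/eqP; field.
  rewrite expr2 -[leRHS]mulrA ler_pM2l//; apply: le_trans sig.
  rewrite ler_pM2l//; apply: (@le_trans _ _ (s2%:R * ln (1 + x))).
    by rewrite ler_pM2l// ln1D_ge_half// (ltW x0) ltW.
  by rewrite lerDl mulr_ge0.
Qed.

(* For [s = d1] the scan runs over a single row set and [log_e_bin d1 d1 = 1], so
   the analysis of the scan tests covers [t_tr] and [t_lin] as well. *)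
Lemma sum_testE (k : tuning R) s2 : (0 < d1)%N ->
  @sum_test R d1 d2 k s2 = @max_test R d1 d2 k d1 s2.
Proof.
move=> d10; have L1 : log_e_bin d1 d1 = 1 :> R by rewrite /log_e_bin binn mulr1 expRK.
have cardT (J : {set 'I_d1}) : (#|J| == d1) = (J == [set: 'I_d1]%SET).
  by rewrite eqEcard finset.subsetT /= cardsT card_ord eqn_leq -[X in (_ <= X)%N](card_ord d1) max_card.
have colE (Y : 'M[R]_(d1, d2)) j : sub_col_mean d1 [set: 'I_d1]%SET Y j = col_mean Y j.
  by rewrite /sub_col_mean /col_mean; congr (_ * _); apply: eq_bigl => i; rewrite inE.
apply/funext => Y; rewrite /sum_test /max_test L1 mulr1; case: ifP => _.
  rewrite /t_mtr lt_bigmaxe /t_tr.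
  have -> : tau_mtr (trunc_const k) d1 d1 s2 d2 = tau_tr (trunc_const k) s2 d2.
    by rewrite /tau_mtr L1 mulr1.
  apply/idP/existsP => [h|[J /andP[]]].
    by exists [set: 'I_d1]%SET; rewrite cardT eqxx; under eq_bigr do rewrite colE.
  by rewrite cardT => /eqP ->; under eq_bigr do rewrite colE.
rewrite /t_ml lt_bigmaxe.
have linE : (Num.sqrt d2%:R)^-1 * (\sum_(j < d2) sub_col_mean d1 [set: 'I_d1]%SET Y j) = t_lin Y.
  under eq_bigr do rewrite colE /col_mean.
  rewrite -mulr_sumr exchange_big /= mulrA /t_lin sqrtrM// invfM; congr (_ * _).
  by rewrite mulrC.
apply/idP/existsP => [h|[J /andP[]]].
  by exists [set: 'I_d1]%SET; rewrite cardT eqxx linE.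
by rewrite cardT => /eqP ->; rewrite linE.
Qed.

Lemma sum_risk s1 s2 (mu : R) : (0 < s1 <= d1)%N -> (0 < s2 <= d2)%N -> 0 < mu ->
  signal_factor * phi s1 d1 s2 d2 <= mu ^+ 2 ->
  (risk s1 s2 (@sum_test R d1 d2 (@scan_tuning R d1 D d1 s2) s2) mu
     <= (2 * expR (- D))%:E)%E.
Proof.
move=> /andP[s10 s1d] /andP[s20 s2d] mu0 hmu.
have d20 : (0 < d2)%N by exact: leq_trans s2d.
have d10 : (0 < d1)%N by exact: leq_trans s1d.
have s1R : 0 < s1%:R :> R by rewrite ltr0n.
have s2R : 0 < s2%:R :> R by rewrite ltr0n.
have d2R : 0 < d2%:R :> R by rewrite ltr0n.
have d1R : 0 < d1%:R :> R by rewrite ltr0n.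
have s21 : 1 <= s2%:R :> R by rewrite ler1n.
pose th := (Num.sqrt d1%:R)^-1 * (s1%:R * mu).
have th0 : 0 <= th by rewrite !mulr_ge0 ?invr_ge0 ?sqrtr_ge0 ?(ltW mu0).
have th2 : th ^+ 2 = s1%:R ^+ 2 / d1%:R * mu ^+ 2.
  by rewrite /th !exprMn exprVn sqr_sqrtr//; field; rewrite gt_eqF.
have H0' := H0; have F0 := signal_factor_gt0.
have L1 : log_e_bin d1 d1 = 1 :> R by rewrite /log_e_bin binn mulr1 expRK.
move: hmu; rewrite /phi; set x := d2%:R / s2%:R ^+ 2 => hmu.
have x0 : 0 < x by rewrite divr_gt0 ?exprn_gt0.
have sig : signal_factor * ln (1 + x) <= th ^+ 2.
  have a0 : 0 <= s1%:R ^+ 2 / d1%:R :> R by rewrite divr_ge0// exprn_ge0.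
  rewrite th2; apply: le_trans (ler_wpM2l a0 hmu).
  rewrite le_eqVlt; apply/orP; left; apply/eqP.
  by field; rewrite !gt_eqF.
rewrite sum_testE//; apply: (max_test_risk d10 (leqnn _) s20 d20 th0); rewrite ?L1 ?mulr1 -/x.
- move=> X /(Theta_signal d1 (ltW mu0))[S1 [S2 [c1 c2 h]]].
  by have [h1 h2] := h [set: 'I_d1]%SET (finset.subsetT _); exists [set: 'I_d1]%SET, S2; rewrite cardsT card_ord.
- move=> x1; have yx := ln1D_ge12 x1.
  apply: le_trans (ler_wpM2l (ltW s2R) sig).
  apply: (@le_trans _ _ ((1024 + 8 * H) * (3 * (s2%:R * ln (1 + x))))).
    apply: ler_wpM2l; first by lra.
    have s2y : 1 * (1 / 2) <= s2%:R * ln (1 + x) by apply: ler_pM.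
    by lra.
  have z0 : 0 <= s2%:R * ln (1 + x) by apply: mulr_ge0 => //; lra.
  by have := ler_wpM2r z0 signal_factor_ge1; lra.
- move=> x1; have -> : s2%:R ^+ 2 * th ^+ 2 / d2%:R = th ^+ 2 / x.
    by rewrite /x; field; rewrite !gt_eqF.
  rewrite ler_pdivlMr//; apply: le_trans sig.
  apply: (@le_trans _ _ (signal_factor * (x / 2))); last first.
    by rewrite ler_pM2l// ln1D_ge_half// (ltW x0) ltW.
  by have := ler_wpM2r (ltW x0) signal_factor_ge2; lra.
Qed.

End upper_bound.

(** * Overlaps of random sets *)

Section overlap_moments.
Context {R : realType}.

(** Expanding over the subsets A of an overlap reduces its moments to counting the sets S that
    contain A. *)
Lemma expr1D_subsets (T : finType) (B : {set T}) (t : R) :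
  (1 + t) ^+ #|B| = \sum_(A : {set T} | A \subset B) t ^+ #|A|.
Proof.
transitivity (\prod_(i : T) ((if i \in B then t else 0) + 1)).
  rewrite (bigID (mem B)) /= [X in _ * X]big1 ?mulr1; last first.
    by move=> i /negbTE ->; rewrite add0r.
  by under eq_bigr => i iB do rewrite iB addrC; rewrite prodr_const.
rewrite bigA_distr [RHS]big_mkcond /=; apply: eq_bigr => A _.
case: ifPn => AB.
  rewrite -big_mkcond /= -prodr_const; apply: eq_bigr => i iA.
  by rewrite (fintype.subsetP AB).
have [i iA iB] := fintype.subsetPn AB.
by rewrite (bigD1 i) //= iA (negbTE iB) mul0r.
Qed.

Lemma card_supersets (T : finType) (A : {set T}) (s : nat) :
  (#|[set S : {set T} | (A \subset S) && (#|S| == s)]%SET| <= 'C(#|T| - #|A|, s - #|A|))%N.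
Proof.
have -> : (#|T| - #|A|)%N = #|~: A| by rewrite -[in LHS](cardsC A) addKn.
rewrite -cards_draws.
rewrite -(card_in_imset (f := fun S : {set T} => S :\: A)).
  apply: subset_leq_card; apply/fintype.subsetP => _ /imsetP[S + ->].
  rewrite !inE => /andP[AS /eqP cS].
  by rewrite finset.subsetDr cardsD cS (finset.setIidPr AS) eqxx.
move=> S S'; rewrite !inE => /andP[AS _] /andP[AS' _] /= e.
by rewrite -(finset.setID S A) -(finset.setID S' A) e (finset.setIidPr AS) (finset.setIidPr AS').
Qed.

(** Each step multiplies by (s - j) / (d - j) <= s / d: a random s-set contains A at most as often
    as if points were included independently. *)
Lemma bin_sub_le (d s j : nat) : (0 < s <= d)%N -> (j <= s)%N ->
  'C(d - j, s - j)%:R <= 'C(d, s)%:R * (s%:R / d%:R) ^+ j :> R.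
Proof.
move=> /andP[s0 sd]; have d0 : (0 < d)%N by exact: leq_trans sd.
have sR : 0 < s%:R :> R by rewrite ltr0n.
have dR : 0 < d%:R :> R by rewrite ltr0n.
elim: j => [_|j IH js]; first by rewrite !subn0 expr0 mulr1.
have jd : (j < d)%N by exact: leq_trans sd.
have e2 : (s - j.+1).+1 = (s - j)%N by rewrite subnSK.
have := mul_bin_diag (d - j) (s - j.+1); rewrite -subnS e2 => e.
have djR : 0 < (d - j)%:R :> R by rewrite ltr0n subn_gt0.
have -> : 'C(d - j.+1, s - j.+1)%:R = (s - j)%:R / (d - j)%:R * 'C(d - j, s - j)%:R :> R.
  apply: (mulfI (lt0r_neq0 djR)).
  rewrite mulrA mulrCA divff ?lt0r_neq0// mulr1 -!natrM.
  by rewrite e.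
rewrite exprSr mulrA mulrC ler_pM// ?divr_ge0//; first exact: IH (ltnW js).
rewrite ler_pdivrMr// mulrAC ler_pdivlMr// -!natrM ler_nat.
by rewrite mulnBl mulnBr leq_sub2l// [leqLHS]mulnC leq_mul2l sd orbT.
Qed.

(** The hypergeometric generating function is dominated by the binomial one (1 + t s / d)^s, with t
    = y - 1, and this by the Poisson one of the same mean s^2 / d. *)
Lemma sum_overlap_le (d s : nat) (T : {set 'I_d}) (y : R) : (0 < s <= d)%N ->
  #|T| = s -> 1 <= y ->
  \sum_(S : {set 'I_d} | #|S| == s) y ^+ #|S :&: T| <=
    'C(d, s)%:R * expR (s%:R ^+ 2 / d%:R * (y - 1)).
Proof.
move=> sd cT y1; have /andP[s0 sd'] := sd; have d0 : (0 < d)%N by exact: leq_trans sd'.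
have dR : 0 < d%:R :> R by rewrite ltr0n.
pose t := y - 1; have t0 : 0 <= t by rewrite subr_ge0.
have -> : y = 1 + t by rewrite /t subrKC.
under eq_bigr do rewrite expr1D_subsets.
rewrite (exchange_big_dep (fun A : {set 'I_d} => A \subset T)) /=; last first.
  by move=> S A _; rewrite finset.subsetI => /andP[].
apply: (@le_trans _ _ (\sum_(A : {set 'I_d} | A \subset T)
   'C(d, s)%:R * (t * (s%:R / d%:R)) ^+ #|A|)).
  apply: ler_sum => A AT.
  rewrite sumr_const -[leLHS]mulr_natl exprMn mulrCA mulrC.
  rewrite ler_wpM2l ?exprn_ge0//.
  have As : (#|A| <= s)%N by rewrite -cT subset_leq_card.
  apply: le_trans (bin_sub_le sd As); rewrite ler_nat.
  rewrite -[X in 'C(X - _, _)](card_ord d).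
  apply: leq_trans (card_supersets A s).
  apply: subset_leq_card; apply/fintype.subsetP => S.
  move=> h; have {h} : (#|S| == s) && (A \subset S :&: T) := h.
  by move=> /andP[cS]; rewrite finset.subsetI inE cS => /andP[-> _].
rewrite -mulr_sumr -expr1D_subsets cT ler_wpM2l//.
apply: (@le_trans _ _ (expR (t * (s%:R / d%:R)) ^+ s)).
  by rewrite lerXn2r ?nnegrE ?expR_ge0 ?expR_ge1Dx// addr_ge0// mulr_ge0// divr_ge0.
rewrite -expRM_natl ler_expR /t (_ : 1 + (y - 1) - 1 = y - 1); last by ring.
by rewrite le_eqVlt; apply/orP; left; apply/eqP; field; rewrite gt_eqF.
Qed.

End overlap_moments.

(** * Growth of the exponent in the second moment *)

Section exponential_growth.
Context {R : realType}.
Implicit Types (a b c k m p q t u y z : R).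

Lemma expR_convex t a b : 0 <= t <= 1 ->
  expR ((1 - t) * a + t * b) <= (1 - t) * expR a + t * expR b.
Proof.
move=> /andP[t0 t1]; set x := (1 - t) * a + t * b.
have tangent z : expR x * (1 + (z - x)) <= expR z.
  have -> : expR z = expR x * expR (z - x) by rewrite -expRD subrKC.
  by rewrite ler_wpM2l ?expR_ge0 ?expR_ge1Dx.
have t1' : 0 <= 1 - t by lra.
have := ler_wpM2l t1' (tangent a); have := ler_wpM2l t0 (tangent b).
have : (1 - t) * (expR x * (1 + (a - x))) + t * (expR x * (1 + (b - x))) = expR x.
  have -> : (1 - t) * (expR x * (1 + (a - x))) + t * (expR x * (1 + (b - x))) =
      expR x * (1 + ((1 - t) * a + t * b - x)) by ring.
  by rewrite -/x subrr addr0 mulr1.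
lra.
Qed.

Lemma expR_scale_le t y : 0 <= t <= 1 -> expR (t * y) <= 1 + t * (expR y - 1).
Proof.
by move=> t01; have := expR_convex 0 y t01; rewrite mulr0 add0r expR0; lra.
Qed.

Lemma mul_expR_le u : 0 <= u -> u * expR u <= expR (2 * u) - 1.
Proof.
move=> u0; rewrite mulr_natl mulr2n expRD; have := expR_ge1Dx u.
by move: (expR u) => e; nra.
Qed.

Lemma expR1_le4 : expR 1 <= 4 :> R.
Proof.
have h : 1 / 2 <= expR (- (1 / 2)) :> R by apply: le_trans (expR_ge1Dx _); lra.
have e : expR 1 * (expR (- (1 / 2)) * expR (- (1 / 2))) = 1 :> R.
  by rewrite -!expRD (_ : 1 + _ = 0) ?expR0//; lra.
have := expR_gt0 (1 : R); move: (expR 1) (expR _) h e => E F h e E0.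
have : 1 / 4 <= F * F by nra.
nra.
Qed.

Lemma expR_half_le2 : expR (1 / 2) <= 2 :> R.
Proof.
have h : 1 / 2 <= expR (- (1 / 2)) :> R by apply: le_trans (expR_ge1Dx _); lra.
have e : expR (1 / 2) * expR (- (1 / 2)) = 1 :> R by rewrite -expRD subrr expR0.
have := expR_gt0 (1 / 2 : R); nra.
Qed.

Lemma expR1_ge2 : 2 <= expR 1 :> R.
Proof. by apply: le_trans (expR_ge1Dx _); lra. Qed.

(* [x |-> expR (m * expR x)] is convex, so a bound by an affine function of [ln k]
   only needs to be checked at the end points. *)
Lemma expR_chord A m a b k0 k1 k : 0 <= A -> 0 <= m -> 0 < k0 -> k0 <= k <= k1 ->
  A * expR (m * k0) <= a + b * ln k0 -> A * expR (m * k1) <= a + b * ln k1 ->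
  A * expR (m * k) <= a + b * ln k.
Proof.
move=> A0 m0 k00 /andP[k0k kk1] h0 h1.
have kp : 0 < k by exact: lt_le_trans k0k.
have k1p : 0 < k1 by exact: lt_le_trans kk1.
have [k01|k01] := leP k1 k0.
  by have -> : k = k0 by apply/le_anti/andP; split => //; exact: le_trans kk1 k01.
have l01 : 0 < ln k1 - ln k0 by rewrite subr_gt0 ltr_ln ?posrE.
pose t := (ln k - ln k0) / (ln k1 - ln k0).
have t01 : 0 <= t <= 1.
  have kl : 0 <= ln k - ln k0 by rewrite subr_ge0 ler_ln ?posrE.
  have ku : ln k - ln k0 <= ln k1 - ln k0 by rewrite lerB// ler_ln ?posrE.
  by rewrite divr_ge0//= ?(ltW l01)// ler_pdivrMr// mul1r.
have lk : ln k = (1 - t) * ln k0 + t * ln k1.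
  by rewrite /t; field; rewrite gt_eqF.
have kle : k <= (1 - t) * k0 + t * k1.
  have := expR_convex (ln k0) (ln k1) t01; rewrite -lk !lnK ?posrE//.
have e1 : expR (m * k) <= (1 - t) * expR (m * k0) + t * expR (m * k1).
  apply: le_trans (expR_convex _ _ t01); rewrite ler_expR.
  by have := ler_wpM2l m0 kle; lra.
move/andP: t01 => [t0 t1].
have t1' : 0 <= 1 - t by lra.
have := ler_wpM2l A0 e1; have := ler_wpM2l t1' h0; have := ler_wpM2l t0 h1.
rewrite lk; lra.
Qed.

(** A logarithmic bound on u becomes a linear one: u exp u <= exp (2 u) - 1 <= (1 + z / q)^(2 c) - 1
    <= 2 c z / q, the last step because 2 c <= 1. *)
Lemma expR_budget c q u z : 0 < q -> 0 <= c -> 2 * c <= 1 -> 0 <= z -> 0 <= u ->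
  u <= c * ln (1 + z / q) -> q * (u * expR u) <= 2 * c * z.
Proof.
move=> q0 c0 c1 z0 u0 uc.
have zq : 0 <= z / q by rewrite divr_ge0// ltW.
apply: (@le_trans _ _ (q * (2 * c * (z / q)))); last first.
  by rewrite le_eqVlt; apply/orP; left; apply/eqP; field; rewrite gt_eqF.
apply: ler_wpM2l; first exact: ltW.
apply: le_trans (mul_expR_le u0) _; rewrite lerBlDl.
apply: (@le_trans _ _ (expR (2 * c * ln (1 + z / q)))).
  by rewrite ler_expR; lra.
apply: le_trans (expR_scale_le _ _) _; first by apply/andP; split; lra.
by rewrite lnK ?posrE; lra.
Qed.

(** The 6 is the threshold on log (k / p) used when p >= 1, safely past the point where the tail
    wins. The 1/2 makes exp 6 times the constant the largest value that [expR_budget] accepts. *)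
Definition rate_const : R := expR (- 6) / 2.
Local Notation c := rate_const.

Lemma rate_const_gt0 : 0 < c. Proof. by rewrite divr_gt0 ?expR_gt0. Qed.

Lemma rate_constE : expR 6 * c = 1 / 2.
Proof. by rewrite /c mulrA -expRD subrr expR0. Qed.

Lemma rate_const_le : 24 * c <= 1.
Proof.
have h : 12 <= expR 6 :> R.
  have -> : 6 = 1 + (1 + (1 + (1 + (1 + 1)))) :> R by ring.
  rewrite !expRD; have := expR1_ge2; move: (expR 1) => e e2.
  have e4 : 4 <= e * e by nra.
  have : 16 <= (e * e) * (e * e) by nra.
  nra.
have := rate_constE; have := rate_const_gt0; nra.
Qed.

(* [p = s1^2 / d1], [q = s2^2 / d2] and [L = log_e_bin d1 s1]; the hypotheses [mA],
   [mB], [mC] say that [m] is at most [c] times psi_12, phi_12 and phi_21. *)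
Section overlap_growth.
Variables (m p q L : R) (s : nat).
Hypotheses (m0 : 0 <= m) (p0 : 0 < p) (q0 : 0 < q) (s0 : (0 < s)%N) (ps : p <= s%:R)
  (L0 : 0 <= L) (Ls : L <= s%:R * (2 + ln (s%:R / p)))
  (mA : m * s%:R <= c * ln (1 + L / q))
  (mB : m * p <= c * ln (1 + 1 / q))
  (mC : m * q <= c * ln (1 + 1 / p)).

Let sR : 0 < s%:R :> R. Proof. by rewrite ltr0n. Qed.
Let s1 : 1 <= s%:R :> R. Proof. by rewrite ler1n. Qed.
Let qm0 : 0 <= q * m. Proof. by rewrite mulr_ge0// ltW. Qed.

(** [expR_budget] with u = m s and z = L gives q m s exp (m s) <= 2 c L, and L is at most s times
    the bracket. *)
Let right_end : q * m * expR (m * s%:R) <= 2 * c * (2 + ln (s%:R / p)).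
Proof.
have c0 := rate_const_gt0; have c1 := rate_const_le.
have h := @expR_budget c q (m * s%:R) L q0 (ltW c0) _ L0 _ mA.
have {}h : q * (m * s%:R * expR (m * s%:R)) <= 2 * c * L.
  by apply: h; [lra|rewrite mulr_ge0].
rewrite -(ler_pM2l sR); apply: (@le_trans _ _ (2 * c * L)).
  by move: h; rewrite -!mulrA [m * (s%:R * _)]mulrCA [q * (s%:R * _)]mulrCA.
by have := ler_wpM2l (ltW c0) Ls; lra.
Qed.

Let lns_le : ln s%:R <= s%:R - 1 :> R.
Proof.
have := @le_ln1Dx R (s%:R - 1); rewrite subrKC; apply.
by have s1' := s1; lra.
Qed.

(** For m <= 1 the exponential is bounded and [mC] suffices. For m > 1, [mC] bounds q itself, and
    [mA] must control exp m, through q m exp m <= q exp (2 m). *)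
Lemma left_end : p < 1 -> q * m * expR m <= 6 * c * (2 - ln p).
Proof.
move=> p1; set y := - ln p.
have c0 := rate_const_gt0; have c1 := rate_const_le.
have y0 : 0 <= y by rewrite /y oppr_ge0 ln_le0// ltW.
have lp : ln (1 + 1 / p) <= 1 + y.
  apply: (@le_trans _ _ (ln (2 / p))).
    rewrite ler_ln ?posrE ?addr_gt0 ?divr_gt0// ler_pdivlMr// mulrDl divfK ?gt_eqF//; lra.
  rewrite ln_div ?posrE// lerD2r.
  by have := @le_ln1Dx R 1; rewrite (_ : 1 + 1 = 2); [apply; lra|ring].
have mq : m * q <= c * (1 + y) by apply: le_trans mC _; rewrite ler_wpM2l// ltW.
have [m1|m1] := leP m 1.
  have e4 : expR m <= 4 by apply: le_trans expR1_le4; rewrite ler_expR.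
  apply: (@le_trans _ _ (q * m * 4)); first by rewrite ler_wpM2l.
  have : 0 <= c * y by rewrite mulr_ge0// ltW.
  by move: mq; rewrite /y; lra.
have qy : q <= c * (1 + y).
  by apply: le_trans mq; rewrite ler_peMl// ltW.
have Ly : L <= s%:R ^+ 2 * (2 + y).
  apply: le_trans Ls _; rewrite ln_div ?posrE// -/y expr2 -mulrA ler_wpM2l// -/y.
  have := lns_le; have s1' := s1; nra.
(* L / q <= s^2 w, so [mA] gives m <= (c / s) (2 ln s + ln (1 + w)). Since ln s <= s, the dependence
   on s costs only a bounded factor in exp (2 m). *)
pose w := (2 + y) / q.
have w0 : 0 <= w by rewrite divr_ge0 ?(ltW q0)//; lra.
have e2m : expR (2 * m) <= 2 * (1 + 2 * c * w).
  have i1 : s%:R^-1 <= 1 :> R by rewrite invf_le1.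
  have i0 : 0 < s%:R^-1 :> R by rewrite invr_gt0.
  have ln1 : ln (1 + L / q) <= 2 * ln s%:R + ln (1 + w).
    have -> : 2 * ln s%:R = ln (s%:R ^+ 2) :> R by rewrite lnXn// mulr_natl.
    rewrite -lnM ?posrE ?exprn_gt0//; last by lra.
    rewrite ler_ln ?posrE ?mulr_gt0 ?exprn_gt0//; [|have := divr_ge0 L0 (ltW q0); lra|lra].
    rewrite mulrDr mulr1; apply: lerD; first by rewrite expr_ge1.
    by rewrite /w mulrA ler_wpM2r// invr_ge0 ltW.
  have m_le : m <= c * s%:R^-1 * (2 * ln s%:R + ln (1 + w)).
    rewrite mulrAC -ler_pdivrMr ?invr_gt0// invrK; apply: le_trans mA _.
    by rewrite ler_wpM2l// ltW.
  have t1 : c * s%:R^-1 * (2 * ln s%:R) <= 2 * c.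
    have h : s%:R^-1 * ln s%:R <= 1 :> R.
      by rewrite ler_pdivrMl// mulr1; apply: le_trans lns_le _; lra.
    by have := ler_wpM2l (ltW c0) h; lra.
  have t2 : c * s%:R^-1 * ln (1 + w) <= c * ln (1 + w).
    by rewrite ler_wpM2r ?ln1D_ge0// ler_piMr// ltW.
  apply: (@le_trans _ _ (expR (1 / 2 + 2 * c * ln (1 + w)))).
    by rewrite ler_expR; move: m_le; rewrite mulrDr; lra.
  rewrite expRD; apply: ler_pM; rewrite ?expR_ge0 ?expR_half_le2//.
  apply: le_trans (expR_scale_le _ _) _; first by apply/andP; split; lra.
  by rewrite lnK ?posrE; lra.
have me : m * expR m <= expR (2 * m) by have := mul_expR_le m0; lra.
have qw : q * w = 2 + y by rewrite /w; field; rewrite gt_eqF.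
have h1 := ler_wpM2l (ltW q0) me; have h2 := ler_wpM2l (ltW q0) e2m.
have h3 : q * (2 * (1 + 2 * c * w)) = 2 * (q + 2 * c * (q * w)) by ring.
rewrite h3 qw in h2; rewrite mulrA in h1.
apply: le_trans h1 _; apply: le_trans h2 _; rewrite -/y.
by lra.
Qed.

Lemma growth_small k : p < 1 -> 1 <= k <= s%:R ->
  q * m * expR (m * k) <= 6 * c * (2 + ln (k / p)).
Proof.
move=> p1 k1s; have k0 : 0 < k by case/andP: k1s => h _; lra.
have c0 := rate_const_gt0.
rewrite ln_div ?posrE//.
have -> : 6 * c * (2 + (ln k - ln p)) = 6 * c * (2 - ln p) + 6 * c * ln k by ring.
apply: (expR_chord qm0 m0 ltr01 k1s).
  by rewrite mulr1 ln1 mulr0 addr0; exact: left_end.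
apply: le_trans right_end _; rewrite ln_div ?posrE//.
have h : 0 <= ln s%:R - ln p.
  by rewrite subr_ge0 ler_ln ?posrE.
have := mulr_ge0 (ltW c0) h; lra.
Qed.

Let k0 : R := expR 6 * p.

(** [mB] bounds m p, hence m k0 with constant exp 6 * c = 1 / 2, and [expR_budget] applies with z =
    1. *)
Lemma growth_at_k0 : q * m * expR (m * k0) <= 2 * c / p.
Proof.
have e6 := @expR_gt0 R 6; have c0 := rate_const_gt0.
have k00 : 0 < k0 by rewrite mulr_gt0.
have h : q * (m * k0 * expR (m * k0)) <= 2 * (expR 6 * c) * 1.
  apply: expR_budget => //.
  - by rewrite mulr_ge0// ltW.
  - by rewrite rate_constE; lra.
  - by rewrite mulr_ge0// ltW.
  - by rewrite /k0 mulrCA -mulrA ler_pM2l.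
rewrite ler_pdivlMr// -(ler_pM2l e6).
have -> : expR 6 * (q * m * expR (m * k0) * p) = q * (m * k0 * expR (m * k0)).
  by move: (expR (m * k0)) => E; rewrite /k0; ring.
by apply: le_trans h _; lra.
Qed.

Lemma growth_large k : 1 <= p -> k0 <= k <= s%:R ->
  q * m * expR (m * k) <= 6 * c * (2 + ln (k / p)).
Proof.
move=> p1 k0ks; have e6 := @expR_gt0 R 6; have c0 := rate_const_gt0.
have k00 : 0 < k0 by rewrite mulr_gt0.
have kp : 0 < k by case/andP: k0ks => h _; exact: lt_le_trans h.
rewrite ln_div ?posrE//.
have -> : 6 * c * (2 + (ln k - ln p)) = 6 * c * (2 - ln p) + 6 * c * ln k by ring.
apply: (expR_chord qm0 m0 k00 k0ks).
  apply: le_trans growth_at_k0 _; rewrite /k0 lnM ?posrE// expRK.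
  apply: (@le_trans _ _ (2 * c)); last by lra.
  by rewrite ler_pdivrMr// ler_peMr// mulr_ge0// ltW.
apply: le_trans right_end _; rewrite ln_div ?posrE//.
have h : 0 <= ln s%:R - ln p.
  by rewrite subr_ge0 ler_ln ?posrE.
have := mulr_ge0 (ltW c0) h; lra.
Qed.

End overlap_growth.
End exponential_growth.

(* [h] plays the role of the overlap of a random set with a fixed one: its
   generating function is at most [N] times that of a Poisson variable of mean [p].
   When [p >= 1], the values of [h] below [expR 6 * p] are controlled by this bound
   alone, the others by their individual frequencies. *)
Section layer_sum.
Context {R : realType}.
Local Notation c := (@rate_const R).

Lemma sum_expRN_le n : \sum_(k < n) expR (- k%:R) <= 2 :> R.
Proof.
suff : \sum_(k < n) expR (- k%:R) <= 2 - 2 * expR (- n%:R) :> R.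
  by have := @expR_gt0 R (- n%:R); lra.
elim: n => [|n IH]; first by rewrite big_ord0 oppr0 expR0; lra.
rewrite big_ord_recr /= -[n.+1%:R]natr1 opprD expRD.
have e1 : 2 * expR (- 1) <= 1 :> R.
  have : expR 1 * expR (- 1) = 1 :> R by rewrite -expRD subrr expR0.
  by have := @expR1_ge2 R; have := @expR_gt0 R (- 1); nra.
have := @expR_gt0 R (- n%:R); move: IH e1; move: (\sum_(_ < _) _) (expR _) (expR (- 1)) => S E F.
by nra.
Qed.

Variables (I : finType) (P : pred I) (h : I -> nat) (s : nat) (N p : R).
Hypotheses (N0 : 0 <= N) (hs : forall i, P i -> (h i <= s)%N)
  (moment : forall y, 1 <= y -> \sum_(i | P i) y ^+ h i <= N * expR (p * (y - 1))).

Let count k : R := \sum_(i | P i) (h i == k)%:R.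

Let count_ge0 k : 0 <= count k. Proof. exact: sumr_ge0. Qed.

Lemma count_le k y : 1 <= y -> count k * y ^+ k <= N * expR (p * (y - 1)).
Proof.
move=> y1; apply: le_trans (moment y1); rewrite mulr_suml; apply: ler_sum => i _.
case: eqP => [->|_]; first by rewrite mul1r.
by rewrite mul0r exprn_ge0//; lra.
Qed.

Lemma layer_sum (G : nat -> R) (good : pred nat) (a y B : R) :
  0 <= a -> 1 <= y -> 0 <= B -> (forall k, 0 <= G k) ->
  (forall k, (k <= s)%N -> good k -> G k <= a * y ^+ k) ->
  (forall k, (k <= s)%N -> ~~ good k -> G k * count k <= N * B * expR (- k%:R)) ->
  \sum_(i | P i) G (h i) <= N * (a * expR (p * (y - 1)) + 2 * B).
Proof.
move=> a0 y1 B0 G0 Ggood Gbad.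
apply: (@le_trans _ _ (\sum_(i | P i) (a * y ^+ h i +
    \sum_(k < s.+1 | ~~ good k) (h i == k)%:R * G k))).
  apply: ler_sum => i Pi; have [g|g] := boolP (good (h i)).
    apply: le_trans (Ggood _ (hs Pi) g) _; rewrite lerDl.
    by apply: sumr_ge0 => k _; rewrite mulr_ge0.
  have hi : (h i < s.+1)%N by rewrite ltnS hs.
  rewrite (bigD1 (Ordinal hi))//= eqxx mul1r.
  have : 0 <= \sum_(k < s.+1 | ~~ good k && (k != Ordinal hi)) (h i == k)%:R * G k.
    by apply: sumr_ge0 => k _; rewrite mulr_ge0.
  have : 0 <= a * y ^+ h i by rewrite mulr_ge0// exprn_ge0//; lra.
  lra.
rewrite big_split /= mulrDr; apply: lerD.
  by rewrite -mulr_sumr mulrCA ler_wpM2l// moment.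
rewrite exchange_big /=.
apply: (@le_trans _ _ (\sum_(k < s.+1 | ~~ good k) N * B * expR (- k%:R))).
  apply: ler_sum => k gk; rewrite -mulr_suml mulrC.
  by apply: Gbad => //; rewrite -ltnS.
rewrite -mulr_sumr [2 * B]mulrC mulrA; apply: ler_wpM2l; first exact: mulr_ge0.
apply: le_trans (sum_expRN_le s.+1); rewrite [leRHS](bigID (fun k : 'I_s.+1 => ~~ good k)) /=.
by rewrite lerDl sumr_ge0// => k _; exact: expR_ge0.
Qed.

(** The 4 bounds exp 1, the share of the overlaps below [k0] when p >= 1. The exponential is the
    largest excess, over all k, of the bound on one layer over exp (- k) when p < 1. *)
Definition moment_const : R := 4 + 2 * expR (3 / 4 * expR (7 / 3)).

Lemma moment_const_gt0 : 0 < moment_const.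
Proof. by rewrite addr_gt0// mulr_gt0// expR_gt0. Qed.

Variables (m q L : R).
Hypotheses (m0 : 0 <= m) (p0 : 0 < p) (q0 : 0 < q) (s0 : (0 < s)%N) (ps : p <= s%:R)
  (L0 : 0 <= L) (Ls : L <= s%:R * (2 + ln (s%:R / p)))
  (mA : m * s%:R <= c * ln (1 + L / q))
  (mB : m * p <= c * ln (1 + 1 / q))
  (mC : m * q <= c * ln (1 + 1 / p)).

Let G (k : nat) : R := expR (q * (expR (m * k%:R) - 1)).

Let exponent_le (k : nat) : q * (expR (m * k%:R) - 1) <= k%:R * (q * m * expR (m * k%:R)).
Proof.
have h1 : expR (m * k%:R) - 1 <= m * k%:R * expR (m * k%:R).
  by have := expR_le1Dx_expR (m * k%:R); lra.
by have := ler_wpM2l (ltW q0) h1; lra.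
Qed.

(** As 24 c <= 1, the weight adds at most k (2 + l) / 4 to the exponent k - k l of the frequency.
    The latter is [count_le] at its minimizer y = k / p, admissible since p <= k. *)
Let mass_le (k : nat) : p <= k%:R -> (0 < k)%N ->
  q * m * expR (m * k%:R) <= 6 * c * (2 + ln (k%:R / p)) ->
  G k * count k <= N * expR (k%:R * (3 / 2 - 3 / 4 * ln (k%:R / p))).
Proof.
move=> pk k0 growth; set l := ln (k%:R / p).
have kR : 0 < k%:R :> R by rewrite ltr0n.
have kp : 0 < k%:R / p by rewrite divr_gt0.
have l0 : 0 <= l by rewrite ln_ge0// ler_pdivlMr// mul1r.
have y1 : 1 <= k%:R / p by rewrite ler_pdivlMr// mul1r.
have Gk : G k <= expR (k%:R * ((2 + l) / 4)).
  rewrite ler_expR; apply: le_trans (exponent_le k) _; apply: ler_wpM2l; first exact: ltW.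
  apply: le_trans growth _; have := @rate_const_le R; rewrite -/l; nra.
have ck : count k <= N * expR (k%:R - k%:R * l).
  have := count_le k y1.
  have -> : (k%:R / p) ^+ k = expR (k%:R * l).
    by rewrite [k%:R * l]mulrC expRM_natr lnK.
  rewrite -ler_pdivlMr ?expR_gt0// => /le_trans; apply.
  rewrite -expRN -mulrA -expRD; apply: ler_wpM2l => //; rewrite ler_expR lerD2r.
  by rewrite mulrBr mulrCA divff ?gt_eqF// !mulr1; have p0' := p0; lra.
apply: le_trans (ler_pM (expR_ge0 _) (count_ge0 k) Gk ck) _.
rewrite mulrCA -expRD; apply: ler_wpM2l => //; rewrite ler_expR; lra.
Qed.

Let sum_growth_small : p < 1 -> \sum_(i | P i) G (h i) <= N * moment_const.
Proof.
move=> p1; set B := expR (3 / 4 * expR (7 / 3)) : R.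
have B1 : 1 <= B by rewrite -expR0 ler_expR mulr_ge0 ?expR_ge0//; lra.
(* All layers are treated individually. The growth bound starts at k = 1; the layer k = 0 has weight
   1 and contributes at most N. *)
apply: le_trans (@layer_sum G pred0 0 1 B _ _ _ _ _ _) _ => //.
- lra.
- by move=> k; exact: expR_ge0.
- move=> k ks _; have [->|k0] := posnP k.
    rewrite oppr0 expR0 mulr1 /G mulr0 expR0 subrr mulr0 expR0 mul1r.
    have := @count_le 0 1 (lexx _); rewrite expr0 subrr mulr0 expR0 !mulr1 => /le_trans; apply.
    by rewrite ler_peMr.
  have k1 : 1 <= k%:R :> R by rewrite ler1n.
  have ks' : k%:R <= s%:R :> R by rewrite ler_nat.
  have kR : 0 < k%:R :> R by rewrite ltr0n.
  have pk : p <= k%:R by lra.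
  have growth := @growth_small R m p q L s m0 p0 q0 s0 ps L0 Ls mA mC k%:R p1.
  apply: le_trans (mass_le pk k0 (growth _)) _; first by rewrite k1.
  rewrite -[N * B * _]mulrA; apply: ler_wpM2l => //; rewrite -expRD ler_expR.
  have lk : ln k%:R <= ln (k%:R / p).
    by rewrite ler_ln ?posrE ?divr_gt0// ler_pdivlMr// ler_piMr// ltW.
  (* Maximum of t (10/3 - ln t), attained at ln t = 7/3. Here 10/3 = (3/2 + 1) / (3/4), the 1 making
     room for the weight exp (- k). *)
  have tang : k%:R * (10 / 3 - ln k%:R) <= expR (7 / 3) :> R.
    have -> : expR (7 / 3) = k%:R * expR (7 / 3 - ln k%:R) :> R.
      by rewrite -{1}(lnK kR) -expRD subrKC.
    apply: ler_wpM2l; first exact: ltW.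
    by apply: le_trans (expR_ge1Dx _); lra.
  have := ler_wpM2l (ltW kR) lk; lra.
- rewrite mul0r add0r; apply: ler_wpM2l => //; rewrite /moment_const -/B; lra.
Qed.

Let sum_growth_large : 1 <= p -> \sum_(i | P i) G (h i) <= N * moment_const.
Proof.
move=> p1; have c0 := @rate_const_gt0 R; have c1 := @rate_const_le R.
have cp : 0 <= 2 * c / p by rewrite divr_ge0 ?(ltW p0)//; lra.
pose k0 := expR 6 * p.
have e6 : 1 <= expR 6 :> R by rewrite -[leLHS]expR0 ler_expR.
have pk0 : p <= k0 by rewrite /k0 ler_peMl// ltW.
(* Below [k0] the exponent is at most 2 c k / p, so y = exp (2 c / p) dominates these layers. Then p
   (y - 1) <= 2 c (e - 1) <= 1, so their joint moment stays bounded however large p is. *)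
apply: le_trans (@layer_sum G (fun k => k%:R < k0) 1 (expR (2 * c / p)) 1 _ _ _ _ _ _) _ => //.
- by rewrite -[leLHS]expR0 ler_expR.
- by move=> k; exact: expR_ge0.
- move=> k ks kk0; rewrite mul1r -expRM_natr ler_expR.
  apply: le_trans (exponent_le k) _; rewrite [leRHS]mulrC; apply: ler_wpM2l => //.
  apply: le_trans (@growth_at_k0 R m p q m0 p0 q0 mB).
  apply: ler_wpM2l; first by rewrite mulr_ge0// ltW.
  by rewrite ler_expR ler_wpM2l// ltW.
- move=> k ks; rewrite -leNgt => k0k.
  have pk : p <= k%:R by exact: le_trans k0k.
  have kR : 0 < k%:R :> R by lra.
  have kk : (0 < k)%N by rewrite -(ltr0n R).
  have ks' : k%:R <= s%:R :> R by rewrite ler_nat.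
  have growth := @growth_large R m p q L s m0 p0 q0 s0 ps L0 Ls mA mB k%:R p1.
  apply: le_trans (mass_le pk kk (growth _)) _; first by rewrite k0k.
  rewrite mulr1; apply: ler_wpM2l => //; rewrite ler_expR.
  have l6 : 6 <= ln (k%:R / p).
    rewrite -[leLHS]expRK ler_ln ?posrE ?expR_gt0 ?divr_gt0//.
    by rewrite ler_pdivlMr.
  by have := ler_wpM2l (ltW kR) l6; lra.
- apply: ler_wpM2l => //; rewrite mul1r /moment_const.
  have B1 : 1 <= expR (3 / 4 * expR (7 / 3)) :> R.
    by rewrite -expR0 ler_expR mulr_ge0 ?expR_ge0//; lra.
  have t1 : 2 * c / p <= 1.
    by rewrite ler_pdivrMr// mul1r; lra.
  have := @expR_scale_le R (2 * c / p) 1; rewrite mulr1 cp t1 => /(_ isT) h1.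
  have h2 : p * (expR (2 * c / p) - 1) <= 1.
    apply: (@le_trans _ _ (p * (2 * c / p * (expR 1 - 1)))).
      by apply: ler_wpM2l; [exact: ltW|lra].
    have -> : p * (2 * c / p * (expR 1 - 1)) = 2 * c * (expR 1 - 1).
      by field; rewrite gt_eqF.
    by have := @expR1_le4 R; nra.
  have : expR (p * (expR (2 * c / p) - 1)) <= expR 1 by rewrite ler_expR.
  by have := @expR1_le4 R; lra.
Qed.

Lemma sum_growth_le :
  \sum_(i | P i) expR (q * (expR (m * (h i)%:R) - 1)) <= N * moment_const.
Proof. by have [p1|p1] := ltP p 1; [exact: sum_growth_small|exact: sum_growth_large]. Qed.

End layer_sum.

Section second_moment.
Context {R : realType}.
Local Notation c := (@rate_const R).
Local Notation K := (@moment_const R).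

Definition pair_overlap_sum d1 d2 s1 s2 (T1 : {set 'I_d1}) (T2 : {set 'I_d2}) (m : R) : R :=
  \sum_(S1 : {set 'I_d1} | #|S1| == s1) \sum_(S2 : {set 'I_d2} | #|S2| == s2)
    expR (m * (#|S1 :&: T1| * #|S2 :&: T2|)%:R).

Lemma pair_overlap_sumC d1 d2 s1 s2 (T1 : {set 'I_d1}) (T2 : {set 'I_d2}) m :
  pair_overlap_sum s1 s2 T1 T2 m = pair_overlap_sum s2 s1 T2 T1 m.
Proof.
rewrite /pair_overlap_sum exchange_big /=; apply: eq_bigr => S2 _.
by apply: eq_bigr => S1 _; rewrite mulnC.
Qed.

Lemma pair_overlap_sum_psi s1 d1 s2 d2 (T1 : {set 'I_d1}) (T2 : {set 'I_d2}) m :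
  (0 < s1 <= d1)%N -> (0 < s2 <= d2)%N -> #|T1| = s1 -> #|T2| = s2 -> 0 <= m ->
  m <= c * psi s1 d1 s2 d2 -> m <= c * phi s1 d1 s2 d2 -> m <= c * phi s2 d2 s1 d1 ->
  pair_overlap_sum s1 s2 T1 T2 m <= 'C(d1, s1)%:R * 'C(d2, s2)%:R * K.
Proof.
move=> sd1 sd2 cT1 cT2 m0 mpsi mphi mphi'.
have /andP[s10 s1d] := sd1; have /andP[s20 s2d] := sd2.
have s1R : 0 < s1%:R :> R by rewrite ltr0n.
have s2R : 0 < s2%:R :> R by rewrite ltr0n.
have d1R : 0 < d1%:R :> R by rewrite ltr0n (leq_trans s10).
have d2R : 0 < d2%:R :> R by rewrite ltr0n (leq_trans s20).
have s1d' : s1%:R <= d1%:R :> R by rewrite ler_nat.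
pose p : R := s1%:R ^+ 2 / d1%:R; pose q : R := s2%:R ^+ 2 / d2%:R.
have p0 : 0 < p by rewrite divr_gt0// exprn_gt0.
have q0 : 0 < q by rewrite divr_gt0// exprn_gt0.
apply: (@le_trans _ _ (\sum_(S1 : {set 'I_d1} | #|S1| == s1)
    'C(d2, s2)%:R * expR (q * (expR (m * #|S1 :&: T1|%:R) - 1)))).
  apply: ler_sum => S1 _.
  have y1 : 1 <= expR (m * #|S1 :&: T1|%:R).
    by rewrite -expR0 ler_expR mulr_ge0.
  apply: le_trans (sum_overlap_le sd2 cT2 y1).
  by apply: ler_sum => S2 _; rewrite -expRM_natr natrM mulrA.
rewrite -mulr_sumr mulrAC mulrC; apply: ler_wpM2r => //.
have ps : p <= s1%:R by rewrite /p ler_pdivrMr// expr2 ler_wpM2l// ltW.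
have sp : s1%:R / p = d1%:R / s1%:R by rewrite /p; field; rewrite !gt_eqF.
apply: (@sum_growth_le R _ (fun S1 : {set 'I_d1} => #|S1| == s1)
  (fun S1 => #|S1 :&: T1|) s1 'C(d1, s1)%:R p _ _ _ m q (log_e_bin d1 s1)) => //.
- by move=> S /eqP <-; rewrite subset_leq_card// finset.subsetIl.
- by move=> y y1; exact: sum_overlap_le.
- by have := @log_e_bin_ge1 R _ _ s1d; lra.
- by rewrite sp; exact: log_e_bin_le.
- have -> : log_e_bin d1 s1 / q = d2%:R / s2%:R ^+ 2 * log_e_bin d1 s1.
    by rewrite /q; field; rewrite !gt_eqF.
  by rewrite -ler_pdivlMr//; apply: le_trans mpsi _; rewrite /psi [_^-1 * _]mulrC mulrA.
- have -> : 1 / q = d2%:R / s2%:R ^+ 2 by rewrite /q; field; rewrite !gt_eqF.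
  rewrite -ler_pdivlMr//; apply: le_trans mphi _.
  by rewrite /phi /p invf_div mulrCA mulrC.
- have -> : 1 / p = d1%:R / s1%:R ^+ 2 by rewrite /p; field; rewrite !gt_eqF.
  rewrite -ler_pdivlMr//; apply: le_trans mphi' _.
  by rewrite /phi /q invf_div mulrCA mulrC.
Qed.

(** The larger of psi_12 and psi_21 is at least half their sum, whence the factor 1/2; symmetry in
    rows and columns reduces to the case where it is psi_12. *)
Lemma pair_overlap_sum_rate s1 d1 s2 d2 (T1 : {set 'I_d1}) (T2 : {set 'I_d2}) m :
  (0 < s1 <= d1)%N -> (0 < s2 <= d2)%N -> #|T1| = s1 -> #|T2| = s2 -> 0 <= m ->
  m <= c / 2 * rate s1 d1 s2 d2 ->
  pair_overlap_sum s1 s2 T1 T2 m <= 'C(d1, s1)%:R * 'C(d2, s2)%:R * K.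
Proof.
move=> sd1 sd2 cT1 cT2 m0 mr; have c0 := @rate_const_gt0 R.
have /andP[s10 s1d] := sd1; have /andP[s20 s2d] := sd2.
have le_m x : m <= c / 2 * x -> 0 <= x -> m <= c * x.
  by move=> mx x0; apply: le_trans mx _; apply: ler_wpM2r => //; lra.
have [rp rphi rphi'] : [/\ rate s1 d1 s2 d2 <= psi s1 d1 s2 d2 + psi s2 d2 s1 d1 :> R,
    rate s1 d1 s2 d2 <= phi s1 d1 s2 d2 :> R & rate s1 d1 s2 d2 <= phi s2 d2 s1 d1 :> R].
  by rewrite /rate !ge_min !lexx !orbT.
have c2 : 0 <= c / 2 by lra.
have hp := le_trans mr (ler_wpM2l c2 rp).
have h1 := le_trans mr (ler_wpM2l c2 rphi).
have h2 := le_trans mr (ler_wpM2l c2 rphi').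
have phi_ge0 s d s' d' : 0 <= phi s d s' d' :> R.
  by rewrite mulr_ge0 ?divr_ge0 ?exprn_ge0// ln1D_ge0// divr_ge0// exprn_ge0.
have {}h1 := le_m _ h1 (phi_ge0 _ _ _ _); have {}h2 := le_m _ h2 (phi_ge0 _ _ _ _).
have [le12|/ltW le21] := leP (psi s2 d2 s1 d1 : R) (psi s1 d1 s2 d2).
  by apply: pair_overlap_sum_psi => //; have := ler_wpM2l c2 le12; lra.
rewrite pair_overlap_sumC [_ * _%:R]mulrC.
by apply: pair_overlap_sum_psi => //; have := ler_wpM2l c2 le21; lra.
Qed.

(* Shrinking [m] by a factor [A] brings the average from [K] down to [1 + K / A],
   by convexity of the exponential. *)
Lemma pair_overlap_sum_shrink s1 d1 s2 d2 (T1 : {set 'I_d1}) (T2 : {set 'I_d2}) m (A : R) :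
  (0 < s1 <= d1)%N -> (0 < s2 <= d2)%N -> #|T1| = s1 -> #|T2| = s2 -> 0 <= m ->
  1 <= A -> A * m <= c / 2 * rate s1 d1 s2 d2 ->
  pair_overlap_sum s1 s2 T1 T2 m <= 'C(d1, s1)%:R * 'C(d2, s2)%:R * (1 + K / A).
Proof.
move=> sd1 sd2 cT1 cT2 m0 A1 mr; have A0 : 0 < A by lra.
have Am0 : 0 <= A * m by rewrite mulr_ge0// ltW.
have h := pair_overlap_sum_rate sd1 sd2 cT1 cT2 Am0 mr.
apply: (@le_trans _ _ (\sum_(S1 : {set 'I_d1} | #|S1| == s1)
    \sum_(S2 : {set 'I_d2} | #|S2| == s2)
    (1 + A^-1 * expR (A * m * (#|S1 :&: T1| * #|S2 :&: T2|)%:R)))).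
  apply: ler_sum => S1 _; apply: ler_sum => S2 _.
  have Ai : 0 <= A^-1 <= 1 by rewrite invr_ge0 ltW//= invf_le1.
  have := expR_scale_le (A * m * (#|S1 :&: T1| * #|S2 :&: T2|)%:R) Ai.
  rewrite -[A * m * _]mulrA mulKf ?gt_eqF// => /le_trans; apply.
  by case/andP: Ai => Ai _; lra.
under eq_bigr => S1 _ do rewrite big_split /= -mulr_sumr sumr_const.
rewrite big_split /= -mulr_sumr -/(pair_overlap_sum s1 s2 T1 T2 (A * m)) sumr_const.
rewrite !card_subsets_of_size mulrDr mulr1; apply: lerD.
  by rewrite -mulrnA mulnC natrM.
by rewrite [leLHS]mulrC mulrA; apply: ler_wpM2r => //; rewrite invr_ge0 ltW.
Qed.

End second_moment.

(** * Le Cam's method *)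

Section le_cam.
Context d (T : measurableType d) {R : realType} (P : probability T R).
Variables (D : T -> bool) (L : T -> R) (e : R).
Hypotheses (mD : measurable_fun setT D) (mL : measurable_fun setT L) (L0 : forall x, 0 <= L x).
Hypotheses (e0 : 0 < e) (e1 : e <= 1).
Hypotheses (L1 : (\int[P]_x (L x)%:E = 1)%E) (L2 : (\int[P]_x (L x ^+ 2)%:E <= (1 + e ^+ 2)%:E)%E).

(* [min 1 L >= 1 - e / 2 - (L - 1)^2 / (2 e)], written without subtraction *)
Let pointwise x : 1 - e / 2 + e^-1 * L x <=
  (if D x then 1 else L x) + (2 * e)^-1 * (L x ^+ 2 + 1).
Proof.
have e0' := e0; have Lx := L0 x.
set l := L x in Lx *.
have -> : (2 * e)^-1 * (l ^+ 2 + 1) =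
    e^-1 * l + (2 * e)^-1 * (l - 1) ^+ 2 by field; rewrite gt_eqF.
have i0 : 0 < (2 * e)^-1 by rewrite invr_gt0; lra.
case: (D x).
  have h : 0 <= (2 * e)^-1 * (l - 1) ^+ 2 by rewrite mulr_ge0 ?sqr_ge0// ltW.
  lra.
have : 0 <= (2 * e)^-1 * (l - 1 + e) ^+ 2 by rewrite mulr_ge0 ?sqr_ge0// ltW.
have -> : (2 * e)^-1 * (l - 1 + e) ^+ 2 = (2 * e)^-1 * (l - 1) ^+ 2 + (l - 1) + e / 2.
  by field; rewrite gt_eqF.
lra.
Qed.

(** After integration the terms 1 / e cancel, since L has mean 1; the left side has lost e / 2 and
    the second moment costs another e / 2. *)
Lemma le_cam : ((1 - e)%:E <= \int[P]_x (if D x then 1 else L x)%:E)%E.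
Proof.
have e0' := e0; have e1' := e1.
have i0 : 0 < e^-1 by rewrite invr_gt0.
have j0 : 0 < (2 * e)^-1 by rewrite invr_gt0; lra.
have mL2 : measurable_fun setT (fun x => L x ^+ 2) by exact: measurable_funX.
have intc (k : R) : (\int[P]_x k%:E = k%:E)%E.
  by rewrite integral_cst//= probability_setT mule1.
have F0 x : 0 <= (if D x then 1 else L x) by case: (D x).
have mF : measurable_fun setT (fun x => if D x then 1 else L x) by exact: measurable_fun_ifT.
set I := (\int[P]_x (if D x then 1 else L x)%:E)%E.
have lhs : (\int[P]_x (1 - e / 2 + e^-1 * L x)%:E = (1 - e / 2 + e^-1)%:E)%E.
  under eq_integral do rewrite EFinD EFinM.
  rewrite ge0_integralD//; first last.
  - by apply/measurable_EFinP; exact: measurable_funM.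
  - by move=> x _; rewrite lee_fin mulr_ge0// ltW.
  - by move=> x _; rewrite lee_fin; lra.
  rewrite ge0_integralZl_EFin//; first last.
  - exact: ltW.
  - exact/measurable_EFinP.
  - by move=> x _; rewrite lee_fin.
  by rewrite L1 intc mule1.
have rhs : (\int[P]_x ((if D x then 1 else L x) + (2 * e)^-1 * (L x ^+ 2 + 1))%:E <=
    I + ((2 * e)^-1 * (2 + e ^+ 2))%:E)%E.
  under eq_integral do rewrite EFinD EFinM.
  rewrite ge0_integralD//; first last.
  - apply/measurable_EFinP; apply: measurable_funM => //; exact: measurable_funD.
  - by move=> x _; rewrite lee_fin mulr_ge0 ?addr_ge0 ?sqr_ge0// ltW.
  - exact/measurable_EFinP.
  - by move=> x _; rewrite lee_fin.
  rewrite leeD2l// ge0_integralZl_EFin//; first last.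
  - exact: ltW.
  - by apply/measurable_EFinP; exact: measurable_funD.
  - by move=> x _; rewrite lee_fin addr_ge0 ?sqr_ge0.
  rewrite EFinM lee_wpmul2l ?lee_fin ?(ltW j0)//.
  under eq_integral do rewrite EFinD.
  rewrite ge0_integralD//; first last.
  - exact/measurable_EFinP.
  - by move=> x _; rewrite lee_fin sqr_ge0.
  rewrite intc; apply: le_trans (leeD2r _ L2) _.
  by rewrite -EFinD lee_fin; lra.
have : (\int[P]_x (1 - e / 2 + e^-1 * L x)%:E <=
    \int[P]_x ((if D x then 1 else L x) + (2 * e)^-1 * (L x ^+ 2 + 1))%:E)%E.
  apply: ge0_le_integral => //.
  - by move=> x _; rewrite lee_fin addr_ge0 ?mulr_ge0 ?(ltW i0)//; lra.
  - apply/measurable_EFinP; apply: measurable_funD => //; exact: measurable_funM.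
  - apply/measurable_EFinP; apply: measurable_funD => //; apply: measurable_funM => //.
    exact: measurable_funD.
  - by move=> x _; rewrite lee_fin.
rewrite lhs => /le_trans /(_ rhs).
rewrite -leeBlDr// -EFinB; apply: le_trans; rewrite lee_fin le_eqVlt; apply/orP; left.
by apply/eqP; field; rewrite gt_eqF.
Qed.

End le_cam.

(** * Likelihood ratios and mixtures *)

Section likelihood_ratio.
Context {R : realType} {m n : nat}.
Implicit Types (X E : 'M[R]_(m, n)).
Local Notation N := (@std_normal R).

Definition likelihood_ratio X E : R :=
  \prod_(i < m) \prod_(j < n) expR (X i j * E i j - X i j ^+ 2 / 2).

Lemma likelihood_ratio_ge0 X E : 0 <= likelihood_ratio X E.
Proof. by apply: prodr_ge0 => i _; apply: prodr_ge0 => j _; exact: expR_ge0. Qed.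

Lemma likelihood_ratioE X E : ((likelihood_ratio X E)%:E =
  \prod_(i < m) \prod_(j < n) (expR (X i j * E i j - X i j ^+ 2 / 2))%:E)%E.
Proof. by rewrite -prodEFin; apply: eq_bigr => i _; rewrite prodEFin. Qed.

Lemma measurable_likelihood_ratio X : measurable_fun setT (likelihood_ratio X).
Proof.
apply: measurable_prod => i _; apply: measurable_prod => j _.
apply: measurableT_comp => //; apply: measurable_funB => //; apply: measurable_funM => //.
exact: measurable_entry.
Qed.

(** Entrywise, the Gaussian moment at X + X' gives (X + X')^2 / 2, and subtracting both half squares
    leaves the product X X'. *)
Lemma integral_likelihood_ratioM X X' :
  (\int[@gaussian_mx R m n]_E (likelihood_ratio X E * likelihood_ratio X' E)%:E =
  (expR (\sum_(i < m) \sum_(j < n) X i j * X' i j))%:E)%E.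
Proof.
pose f (i : 'I_m) (j : 'I_n) (x : R) : \bar R :=
  (expR (- (X i j ^+ 2 / 2 + X' i j ^+ 2 / 2)) * expR ((X i j + X' i j) * x))%:E.
transitivity (\int[@gaussian_mx R m n]_E (\prod_(i < m) \prod_(j < n) f i j (E i j)))%E.
  apply: eq_integral => E _; rewrite EFinM !likelihood_ratioE -big_split /=.
  apply: eq_bigr => i _; rewrite -big_split /=; apply: eq_bigr => j _.
  by rewrite /f -EFinM -!expRD; congr (expR _)%:E; ring.
have mf (a : R) : measurable_fun [set: R] (fun x : R => (expR (a * x))%:E).
  by apply/measurable_EFinP; apply: measurableT_comp => //; exact: measurable_funM.
rewrite gaussian_mx_entries; last 2 first.
- move=> i j; apply/measurable_EFinP; apply: measurable_funM => //.
  by apply: measurableT_comp => //; exact: measurable_funM.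
- by move=> i j x; rewrite lee_fin mulr_ge0// expR_ge0.
rewrite expR_sum -prodEFin; apply: eq_bigr => i _.
rewrite expR_sum -prodEFin; apply: eq_bigr => j _.
rewrite /f; under eq_integral do rewrite EFinM.
rewrite ge0_integralZl_EFin//.
rewrite integral_expR_std_normal -EFinM -expRD; congr (expR _)%:E; by field.
Qed.

Lemma integral_likelihood_ratio X :
  (\int[@gaussian_mx R m n]_E (likelihood_ratio X E)%:E = 1)%E.
Proof.
transitivity (\int[@gaussian_mx R m n]_E (likelihood_ratio X E * likelihood_ratio 0 E)%:E)%E.
  apply: eq_integral => E _; congr _%:E.
  rewrite [likelihood_ratio 0 E]big1 ?mulr1// => i _; rewrite big1// => j _.
  by rewrite mxE mul0r expr0n mul0r subrr expR0.
rewrite integral_likelihood_ratioM big1 ?expR0// => i _; rewrite big1// => j _.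
by rewrite mxE mulr0.
Qed.

Lemma law_likelihood_ratio X (A : set 'M[R]_(m, n)) : measurable A ->
  law X A = (\int[@gaussian_mx R m n]_E (\1_A E * likelihood_ratio X E)%:E)%E.
Proof.
move=> mA.
have mXA : measurable ((fun E => X + E) @^-1` A).
  by rewrite -[Y in measurable Y]setTI; exact: (measurable_addmx X measurableT).
transitivity (\int[@gaussian_mx R m n]_E (\1_A (X + E))%:E)%E.
  have := @integral_indic _ _ _ (@gaussian_mx R m n) setT measurableT _ mXA.
  rewrite setIT => e; apply: etrans (esym e) _.
  by apply: eq_integral.
rewrite (@gaussian_mx_shift _ _ _ X (fun E => (\1_A E)%:E)).
- by apply: eq_integral => E _; rewrite EFinM likelihood_ratioE.
- exact/measurable_EFinP.
- by move=> E; rewrite lee_fin.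
Qed.

End likelihood_ratio.

Section mixture_bound.
Context {R : realType} {d1 d2 : nat}.
Variables (s1 s2 : nat) (mu e : R) (r : seq 'M[R]_(d1, d2)).
Hypotheses (rT : forall X, X \in r -> Theta s1 s2 mu X) (r0 : (0 < size r)%N)
  (e0 : 0 < e) (e1 : e <= 1).
Hypothesis (chi2 : \sum_(X <- r) \sum_(X' <- r)
  expR (\sum_(i < d1) \sum_(j < d2) X i j * X' i j) <= (size r)%:R ^+ 2 * (1 + e ^+ 2)).
Local Notation G := (@gaussian_mx R d1 d2).
Local Notation n := ((size r)%:R : R).

Let L (E : 'M[R]_(d1, d2)) : R := \sum_(X <- r) n^-1 * likelihood_ratio X E.

Let n0 : 0 < n. Proof. by rewrite ltr0n. Qed.
Let ni : 0 <= n^-1. Proof. by rewrite invr_ge0 ltW. Qed.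

Let L0 E : 0 <= L E.
Proof. by apply: sumr_ge0 => X _; rewrite mulr_ge0// likelihood_ratio_ge0. Qed.

Let mw (X : 'M[R]_(d1, d2)) : measurable_fun setT (fun E => n^-1 * likelihood_ratio X E).
Proof. by apply: measurable_funM => //; exact: measurable_likelihood_ratio. Qed.

Let mL : measurable_fun setT L.
Proof. exact: measurable_sum. Qed.

Let sum_const (k : R) : \sum_(X <- r) k = n * k.
Proof. by rewrite big_const_seq count_predT iter_addr_0 mulr_natl. Qed.

Let L1 : (\int[G]_E (L E)%:E = 1)%E.
Proof.
under eq_integral do rewrite /L -sumEFin.
rewrite ge0_integral_sum//; last 2 first.
- by move=> X; apply/measurable_EFinP.
- by move=> X E _; rewrite lee_fin mulr_ge0// likelihood_ratio_ge0.
rewrite (eq_bigr (fun=> (n^-1)%:E)); last first.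
  move=> X _; under eq_integral do rewrite EFinM.
  rewrite ge0_integralZl_EFin//; last 2 first.
  - by move=> E _; rewrite lee_fin likelihood_ratio_ge0.
  - by apply/measurable_EFinP; exact: measurable_likelihood_ratio.
  by rewrite integral_likelihood_ratio mule1.
by rewrite sumEFin sum_const divff// gt_eqF.
Qed.

Let L2 : (\int[G]_E (L E ^+ 2)%:E <= (1 + e ^+ 2)%:E)%E.
Proof.
have sq E : L E ^+ 2 = \sum_(X <- r) \sum_(X' <- r)
    (n ^- 2 * (likelihood_ratio X E * likelihood_ratio X' E)).
  rewrite expr2 /L mulr_suml; apply: eq_bigr => X _.
  rewrite mulr_sumr; apply: eq_bigr => X' _; rewrite -exprVn; ring.
have w0 (X X' E : 'M[R]_(d1, d2)) : 0 <= n ^- 2 * (likelihood_ratio X E * likelihood_ratio X' E).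
  by rewrite mulr_ge0 ?mulr_ge0 ?likelihood_ratio_ge0// invr_ge0 exprn_ge0// ltW.
have mww (X X' : 'M[R]_(d1, d2)) : measurable_fun setT
    (fun E => likelihood_ratio X E * likelihood_ratio X' E : R).
  by apply: measurable_funM; exact: measurable_likelihood_ratio.
have mw2 (X X' : 'M[R]_(d1, d2)) : measurable_fun setT
    (fun E => n ^- 2 * (likelihood_ratio X E * likelihood_ratio X' E)).
  exact: measurable_funM.
under eq_integral do rewrite sq -sumEFin.
rewrite ge0_integral_sum//; last 2 first.
- by move=> X; apply/measurable_EFinP; exact: measurable_sum.
- by move=> X E _; rewrite lee_fin sumr_ge0.
rewrite (eq_bigr (fun X : 'M[R]_(d1, d2) => (n ^- 2 * \sum_(X' <- r)
    expR (\sum_(i < d1) \sum_(j < d2) X i j * X' i j))%:E)); last first.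
  move=> X _; under eq_integral do rewrite -sumEFin.
  rewrite ge0_integral_sum//; last 2 first.
  - by move=> X'; apply/measurable_EFinP.
  - by move=> X' E _; rewrite lee_fin.
  rewrite mulr_sumr -sumEFin; apply: eq_bigr => X' _.
  under eq_integral do rewrite EFinM.
  rewrite ge0_integralZl_EFin//; last 2 first.
  - by move=> E _; rewrite lee_fin mulr_ge0// likelihood_ratio_ge0.
  - exact/measurable_EFinP.
  by rewrite integral_likelihood_ratioM EFinM.
rewrite sumEFin lee_fin -mulr_sumr mulrC ler_pdivrMr ?exprn_gt0//.
by rewrite mulrC.
Qed.

(** The supremum over [Theta] dominates the average over the prior, whose law has density L under
    the null; [le_cam] then bounds the sum of the two errors. *)
Lemma risk_ge_mixture (D : 'M[R]_(d1, d2) -> bool) : is_test D ->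
  ((1 - e)%:E <= risk s1 s2 D mu)%E.
Proof.
move=> mD; have mA b := @measurable_test R _ _ D b mD.
have mA0 := measurable_testN mD.
have l := le_cam mD mL L0 e0 e1 L1 L2.
apply: le_trans l _.
have split_int : (\int[G]_E (if D E then 1 else L E)%:E =
    law 0%R [set Y | D Y] + \sum_(X <- r) (n^-1)%:E * law X [set Y | ~~ D Y])%E.
  transitivity (\int[G]_E ((\1_[set Y | D Y] E * likelihood_ratio 0 E)%:E +
     \sum_(X <- r) (n^-1 * (\1_[set Y | ~~ D Y] E * likelihood_ratio X E))%:E))%E.
    apply: eq_integral => E _; rewrite sumEFin -EFinD; congr _%:E.
    have lr0 : likelihood_ratio 0 E = 1 :> R.
      rewrite [LHS]big1// => i _; rewrite big1// => j _.
      by rewrite mxE mul0r expr0n mul0r subrr expR0.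
    rewrite !indicE lr0 mulr1; case DE : (D E).
      rewrite mem_set//= big1 ?addr0// => X _; rewrite memNset ?mul0r ?mulr0//.
      by rewrite /= DE.
    rewrite memNset /= ?DE// add0r; apply: eq_bigr => X _.
    by rewrite mem_set ?mul1r//= DE.
  have mi (X : 'M[R]_(d1, d2)) A : measurable A ->
      measurable_fun setT (fun E => \1_A E * likelihood_ratio X E : R).
    by move=> mA'; apply: measurable_funM => //; exact: measurable_likelihood_ratio.
  have i0 (X : 'M[R]_(d1, d2)) A E : 0 <= \1_A E * likelihood_ratio X E :> R.
    by rewrite mulr_ge0// likelihood_ratio_ge0.
  have miX X : measurable_fun setT
      (fun E => n^-1 * (\1_[set Y | ~~ D Y] E * likelihood_ratio X E)).
    by apply: measurable_funM => //; exact: mi.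
  rewrite ge0_integralD//; first last.
  - under eq_fun do rewrite sumEFin.
    by apply/measurable_EFinP; exact: measurable_sum.
  - by move=> E _; apply: sume_ge0 => X _; rewrite lee_fin mulr_ge0.
  - by apply/measurable_EFinP; apply: mi; exact: mA.
  - by move=> E _; rewrite lee_fin.
  rewrite -law_likelihood_ratio; last exact: mA.
  congr (_ + _)%E; rewrite ge0_integral_sum//; last 2 first.
  - by move=> X; apply/measurable_EFinP.
  - by move=> X E _; rewrite lee_fin mulr_ge0.
  apply: eq_bigr => X _; rewrite law_likelihood_ratio//.
  under eq_integral do rewrite EFinM.
  rewrite ge0_integralZl_EFin//.
  - by move=> E _; rewrite lee_fin.
  - by apply/measurable_EFinP; exact: mi.
rewrite split_int /risk leeD2l//.
set S := ereal_sup _.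
have lawS X : X \in r -> (law X [set Y | ~~ D Y] <= S)%E.
  by move=> Xr; apply: ereal_sup_ubound; exists X => //; exact: rT.
(* The supremum could be -oo for an empty family; a member of [r] makes it nonnegative, which allows
   the weights to be summed. *)
have S0 : (0 <= S)%E.
  case: r r0 lawS => // X r' _ /(_ X (mem_head _ _)); apply: le_trans.
  by rewrite /law /pushforward; exact: measure_ge0.
apply: (@le_trans _ _ (\sum_(X <- r) (n^-1)%:E * S)%E).
  rewrite big_seq [leRHS]big_seq; apply: lee_sum => X Xr.
  by apply: lee_wpmul2l => //; exact: lawS.
rewrite -ge0_sume_distrl//.
by rewrite sumEFin sum_const divff ?mul1e// gt_eqF.
Qed.

End mixture_bound.

(** * Separation rate *)

Section rate_positivity.
Context {R : realType}.

Let ratio_gt0 (s d : nat) : (0 < s <= d)%N -> 0 < d%:R / s%:R ^+ 2 :> R.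
Proof.
by move=> /andP[s0 sd]; rewrite divr_gt0 ?exprn_gt0// ltr0n// (leq_trans s0).
Qed.

Lemma phi_gt0 s1 d1 s2 d2 : (0 < s1 <= d1)%N -> (0 < s2 <= d2)%N -> 0 < phi s1 d1 s2 d2 :> R.
Proof. by move=> /ratio_gt0 r1 /ratio_gt0 r2; rewrite mulr_gt0// ln_gt0// ltrDl. Qed.

Lemma psi_gt0 s1 d1 s2 d2 : (0 < s1 <= d1)%N -> (0 < s2 <= d2)%N -> 0 < psi s1 d1 s2 d2 :> R.
Proof.
move=> /andP[s0 sd] /ratio_gt0 r2; rewrite mulr_gt0 ?invr_gt0 ?ltr0n// ln_gt0// ltrDl.
by rewrite mulr_gt0// (lt_le_trans ltr01)// log_e_bin_ge1.
Qed.

Lemma rate_gt0 s1 d1 s2 d2 : (0 < s1 <= d1)%N -> (0 < s2 <= d2)%N -> 0 < rate s1 d1 s2 d2 :> R.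
Proof. by move=> h1 h2; rewrite /rate !lt_min addr_gt0 ?psi_gt0 ?phi_gt0. Qed.

End rate_positivity.

Section block_prior.
Context {R : realType} {d1 d2 : nat}.
Implicit Types (p : {set 'I_d1} * {set 'I_d2}) (mu : R).

Definition block_signal mu p : 'M[R]_(d1, d2) :=
  \matrix_(i, j) (if (i \in p.1) && (j \in p.2) then mu else 0).

Lemma block_signal_inner mu p p' :
  \sum_(i < d1) \sum_(j < d2) block_signal mu p i j * block_signal mu p' i j =
  mu ^+ 2 * (#|p'.1 :&: p.1| * #|p'.2 :&: p.2|)%:R.
Proof.
have cardE n (A : {set 'I_n}) : #|A|%:R = \sum_(i < n) (i \in A)%:R :> R.
  by rewrite -sum1_card natr_sum big_mkcond; apply: eq_bigr => i _; case: (i \in A).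
rewrite natrM !cardE mulr_suml mulr_sumr; apply: eq_bigr => i _.
rewrite !mulr_sumr; apply: eq_bigr => j _; rewrite !mxE !inE.
by do 4 case: (_ \in _); rewrite ?(mul0r, mulr0, mulr1, mul1r).
Qed.

Definition block_pairs (s1 s2 : nat) : pred ({set 'I_d1} * {set 'I_d2}) :=
  fun p => (#|p.1| == s1) && (#|p.2| == s2).

(** A sequence indexed by pairs of sets has the right size even if two pairs give the same matrix,
    as happens for mu = 0. *)
Definition block_prior mu s1 s2 : seq 'M[R]_(d1, d2) :=
  [seq block_signal mu p | p <- enum (block_pairs s1 s2)].

Lemma size_block_prior mu s1 s2 : size (block_prior mu s1 s2) = ('C(d1, s1) * 'C(d2, s2))%N.
Proof.
rewrite size_map -cardE.
by rewrite -!card_subsets_of_size -cardX; apply: eq_card => -[S1 S2].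
Qed.

Lemma block_prior_Theta mu s1 s2 X : X \in block_prior mu s1 s2 -> Theta s1 s2 mu X.
Proof.
move=> /mapP[[S1 S2]]; rewrite mem_enum => /andP[/eqP /= c1 /eqP c2] ->.
exists S1, S2; split => // i j; rewrite mxE /=; first by move=> ->.
by move=> /negbTE ->.
Qed.

Lemma block_prior_chi2 mu (e A : R) s1 s2 : (0 < s1 <= d1)%N -> (0 < s2 <= d2)%N ->
  1 <= A -> @moment_const R / A <= e ^+ 2 ->
  A * mu ^+ 2 <= @rate_const R / 2 * rate s1 d1 s2 d2 ->
  \sum_(X <- block_prior mu s1 s2) \sum_(X' <- block_prior mu s1 s2)
    expR (\sum_(i < d1) \sum_(j < d2) X i j * X' i j) <=
  (size (block_prior mu s1 s2))%:R ^+ 2 * (1 + e ^+ 2).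
Proof.
move=> sd1 sd2 A1 KA hmu; set n : R := (size _)%:R.
rewrite expr2 -mulrA.
have -> : n * (n * (1 + e ^+ 2)) = \sum_(X <- block_prior mu s1 s2) n * (1 + e ^+ 2).
  by rewrite big_const_seq count_predT iter_addr_0 mulr_natl.
rewrite big_seq [leRHS]big_seq; apply: ler_sum => X /mapP[[T1 T2]].
rewrite mem_enum => /andP[/eqP /= c1 /eqP c2] {X}->.
rewrite big_map big_enum /=.
under eq_bigr do rewrite block_signal_inner /=.
rewrite -(pair_big (fun S : {set 'I_d1} => #|S| == s1) (fun S : {set 'I_d2} => #|S| == s2)
  (fun S1 S2 => expR (mu ^+ 2 * (#|S1 :&: T1| * #|S2 :&: T2|)%:R))) /=.
apply: le_trans (pair_overlap_sum_shrink sd1 sd2 c1 c2 (sqr_ge0 mu) A1 hmu) _.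
by rewrite /n size_block_prior natrM; apply: ler_wpM2l; rewrite ?mulr_ge0// lerD2l.
Qed.

Lemma risk_lower mu (e A : R) s1 s2 (D : 'M[R]_(d1, d2) -> bool) :
  (0 < s1 <= d1)%N -> (0 < s2 <= d2)%N -> 0 < e -> e <= 1 ->
  1 <= A -> @moment_const R / A <= e ^+ 2 ->
  A * mu ^+ 2 <= @rate_const R / 2 * rate s1 d1 s2 d2 -> is_test D ->
  ((1 - e)%:E <= risk s1 s2 D mu)%E.
Proof.
move=> sd1 sd2 e0 e1 A1 KA hmu.
apply: (risk_ge_mixture (@block_prior_Theta mu s1 s2) _ e0 e1).
  rewrite size_block_prior muln_gt0 !bin_gt0.
  by case/andP: sd1 => _ ->; case/andP: sd2 => _ ->.
exact: block_prior_chi2 sd1 sd2 A1 KA hmu.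
Qed.

End block_prior.

Section separation_rate.
Context {R : realType}.
Variables (eta : R) (s1 d1 s2 d2 : nat).
Hypotheses (heta : 0 < eta < 1) (sd1 : (0 < s1 <= d1)%N) (sd2 : (0 < s2 <= d2)%N).
Local Notation rate := (@rate R s1 d1 s2 d2).

(** The factor A = 1 + K / (1 - eta)^2 is at least 1 and makes K / A <= e^2 with e = 1 - eta, so
    every test has risk at least eta. *)
Definition lower_const : R := @rate_const R / (2 * (1 + @moment_const R / (1 - eta) ^+ 2)).

Let eta0 : 0 < eta. Proof. by case/andP: heta. Qed.
Let eta1 : 0 < 1 - eta. Proof. by case/andP: heta => _; rewrite subr_gt0. Qed.

Let scale_ge1 : 1 <= 1 + @moment_const R / (1 - eta) ^+ 2.
Proof. by rewrite lerDl divr_ge0 ?exprn_ge0 ?(ltW eta1)// ltW// moment_const_gt0. Qed.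

Lemma lower_const_gt0 : 0 < lower_const.
Proof. by rewrite divr_gt0 ?rate_const_gt0//; have := scale_ge1; lra. Qed.

Lemma mu_star_ge : ((lower_const * rate)%:E <= mu_star eta s1 s2 d1 d2 ^+ 2)%E.
Proof.
have r0 := @rate_gt0 R _ _ _ _ sd1 sd2; have c0 := lower_const_gt0.
have cr0 : 0 <= lower_const * rate by rewrite mulr_ge0 ?ltW.
rewrite -(sqr_sqrtr cr0) EFin_expe.
have le_star : ((Num.sqrt (lower_const * rate))%:E <= mu_star eta s1 s2 d1 d2)%E.
  apply: le_ereal_inf_tmp => _ [mu [mu0 hmu] <-]; rewrite lee_fin.
  rewrite -(ler_pXn2r (n := 2)) ?nnegrE ?sqrtr_ge0 ?(ltW mu0)// sqr_sqrtr//.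
  rewrite leNgt; apply/negP => lt_mu.
  have [_ [D mD <-]] := ereal_inf_lt hmu.
  apply/negP; rewrite -leNgt.
  have -> : eta = 1 - (1 - eta) by ring.
  apply: (risk_lower sd1 sd2 eta1 _ scale_ge1 _ _ mD).
  - by have := eta0; lra.
  - have A0 : 0 < 1 + @moment_const R / (1 - eta) ^+ 2 by have := scale_ge1; lra.
    rewrite ler_pdivrMr// mulrDr mulr1 mulrC divfK ?gt_eqF ?exprn_gt0//.
    by rewrite lerDr exprn_ge0// ltW.
  - have A0 : 0 < 1 + @moment_const R / (1 - eta) ^+ 2 by have := scale_ge1; lra.
    have {}lt_mu := ltW lt_mu.
    apply: le_trans (ler_wpM2l (ltW A0) lt_mu) _.
    rewrite le_eqVlt; apply/orP; left; apply/eqP.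
    rewrite /lower_const; move: A0; set B := 1 + _ => A0.
    by field; rewrite gt_eqF.
by rewrite lee_sqr ?lee_fin ?sqrtr_ge0// (le_trans _ le_star)// lee_fin sqrtr_ge0.
Qed.

Variable D : R.
Hypothesis D0 : 0 <= D.

Local Notation star := (@Delta_star R d1 d2 (@scan_tuning R d1 D d1 s2)
  (@scan_tuning R d2 D d2 s1) (@scan_tuning R d1 D s1 s2) (@scan_tuning R d2 D s2 s1) s1 s2).

Let is_test_sum (d d' s : nat) : (0 < d)%N ->
  is_test (@sum_test R d d' (@scan_tuning R d D d s) s).
Proof.
move=> d0; have -> : @sum_test R d d' (@scan_tuning R d D d s) s =
    @max_test R d d' (@scan_tuning R d D d s) d s by apply/funext => Y; rewrite sum_testE.
exact: is_test_max_test.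
Qed.

Let d10 : (0 < d1)%N. Proof. by case/andP: sd1 => s0; exact: leq_trans. Qed.
Let d20 : (0 < d2)%N. Proof. by case/andP: sd2 => s0; exact: leq_trans. Qed.

Let is_test_b := is_test_trmx (@is_test_sum d2 d1 s1 d20).
Let is_test_d := is_test_trmx (@is_test_max_test R d2 d1 D s2 s1).

(** A general property [Q] serves both measurability and risk. In the final branch, [Rtilde] is a
    minimum of four terms and differs from three of them, so it equals the fourth. *)
Let Delta_star_cases (Q : ('M[R]_(d1, d2) -> bool) -> Prop) :
  (Rtilde s1 d1 s2 d2 = phi s1 d1 s2 d2 :> R ->
     Q (sum_test (@scan_tuning R d1 D d1 s2) s2)) ->
  (Rtilde s1 d1 s2 d2 = phi s2 d2 s1 d1 :> R ->
     Q (fun Y => sum_test (@scan_tuning R d2 D d2 s1) s1 Y^T)) ->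
  (Rtilde s1 d1 s2 d2 = psi s1 d1 s2 d2 + beta s2 d2 s1 d1 :> R ->
     Q (max_test (@scan_tuning R d1 D s1 s2) s1 s2)) ->
  (Rtilde s1 d1 s2 d2 = psi s2 d2 s1 d1 + beta s1 d1 s2 d2 :> R ->
     Q (fun Y => max_test (@scan_tuning R d2 D s2 s1) s2 s1 Y^T)) ->
  Q star.
Proof.
move=> Qa Qb Qc Qd.
have -> : star =
  if Rtilde s1 d1 s2 d2 == phi s1 d1 s2 d2 :> R
  then sum_test (@scan_tuning R d1 D d1 s2) s2
  else if Rtilde s1 d1 s2 d2 == phi s2 d2 s1 d1 :> R
  then fun Y => sum_test (@scan_tuning R d2 D d2 s1) s1 Y^T
  else if Rtilde s1 d1 s2 d2 == psi s1 d1 s2 d2 + beta s2 d2 s1 d1 :> R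
  then max_test (@scan_tuning R d1 D s1 s2) s1 s2
  else fun Y => max_test (@scan_tuning R d2 D s2 s1) s2 s1 Y^T.
  by apply/funext => Y; rewrite /Delta_star; do 3![case: ifP => // _].
case: ifPn => [/eqP|ne1]; first exact: Qa.
case: ifPn => [/eqP|ne2]; first exact: Qb.
case: ifPn => [/eqP|ne3]; first exact: Qc.
apply: Qd; move: ne1 ne2 ne3; rewrite /Rtilde.
set a := psi s1 _ _ _ + _; set b := psi s2 _ _ _ + _.
set f := phi s1 _ _ _; set g := phi s2 _ _ _.
rewrite /Num.min; case: (ltP f g) => _; case: (ltP b _) => _; case: (ltP a _) => _;
  by rewrite ?eqxx.
Qed.

Lemma is_test_Delta_star : is_test star.
Proof.
apply: Delta_star_cases => _; [exact: is_test_sum|exact: is_test_b|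
  exact: is_test_max_test|exact: is_test_d].
Qed.

Definition upper_const : R := 4 * signal_factor D.

Lemma upper_const_gt0 : 0 < upper_const.
Proof. by rewrite mulr_gt0// signal_factor_gt0. Qed.

Lemma Delta_star_risk mu : 0 < mu -> upper_const * rate <= mu ^+ 2 ->
  (risk s1 s2 star mu <= (2 * expR (- D))%:E)%E.
Proof.
move=> mu0 hmu.
have hR : signal_factor D * Rtilde s1 d1 s2 d2 <= mu ^+ 2.
  apply: le_trans hmu; rewrite /upper_const [4 * _]mulrC -mulrA.
  by apply: ler_wpM2l; [rewrite ltW// signal_factor_gt0|exact: Rtilde_le_rate].
apply: (Delta_star_cases (Q := fun T => (risk s1 s2 T mu <= _)%E)) => e.
- by apply: sum_risk; rewrite -?e.
- by apply: le_trans (risk_trmx _ _ _ (@is_test_sum d2 d1 s1 d20)) _; apply: sum_risk; rewrite -?e.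
- by apply: scan_risk; rewrite -?e.
- apply: le_trans (risk_trmx _ _ _ (@is_test_max_test R d2 d1 D s2 s1)) _.
  by apply: scan_risk; rewrite -?e.
Qed.

Lemma mu_star_le : 2 * expR (- D) < eta ->
  (mu_star eta s1 s2 d1 d2 ^+ 2 <= (upper_const * rate)%:E)%E.
Proof.
move=> hD; have r0 := @rate_gt0 R _ _ _ _ sd1 sd2; have c0 := upper_const_gt0.
have cr0 : 0 < upper_const * rate by exact: mulr_gt0.
rewrite -(sqr_sqrtr (ltW cr0)) EFin_expe lee_sqr ?lee_fin ?sqrtr_ge0//.
  apply: ereal_inf_lbound; exists (Num.sqrt (upper_const * rate)) => //.
  have m0 : 0 < Num.sqrt (upper_const * rate) by rewrite sqrtr_gt0.
  split => //; apply: (@le_lt_trans _ _ (2 * expR (- D))%:E); last by rewrite lte_fin.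
  apply: le_trans (Delta_star_risk m0 _); last by rewrite sqr_sqrtr// ltW.
  by apply: ereal_inf_lbound; exists star => //; exact: is_test_Delta_star.
by apply: le_ereal_inf_tmp => _ [mu [mu0 _] <-]; rewrite lee_fin ltW.
Qed.

End separation_rate.

Theorem theorem1 (R : realType) (eta : R) (heta : 0 < eta < 1) :
  (exists c : R, 0 < c /\
    forall s1 d1 s2 d2 : nat,
      (0 < s1 <= d1)%N -> (0 < s2 <= d2)%N ->
      ((c * rate s1 d1 s2 d2)%:E <= mu_star eta s1 s2 d1 d2 ^+ 2)%E)
  /\
  (exists C' : R, 0 < C' /\
    forall s1 d1 s2 d2 : nat,
      (0 < s1 <= d1)%N -> (0 < s2 <= d2)%N ->
      (exists ka kb kc kd : tuning R,
         [/\ tuning_pos ka, tuning_pos kb, tuning_pos kc, tuning_pos kd &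
           is_test (@Delta_star R d1 d2 ka kb kc kd s1 s2) /\
           forall mu : R, 0 < mu -> C' * rate s1 d1 s2 d2 <= mu ^+ 2 ->
             (risk s1 s2 (@Delta_star R d1 d2 ka kb kc kd s1 s2) mu
                <= eta%:E)%E])
      /\ (mu_star eta s1 s2 d1 d2 ^+ 2 <= (C' * rate s1 d1 s2 d2)%:E)%E).
Proof.
have [eta0 eta1] := andP heta.
split.
  exists (lower_const eta); split; first exact: lower_const_gt0 heta.
  by move=> s1 d1 s2 d2 sd1 sd2; exact: mu_star_ge.
(* Makes the risk bound 2 exp (- D) equal to eta / 2, strictly below eta as the definition of
   [mu_star] requires. *)
pose D := ln (4 / eta).
have D0 : 0 <= D by rewrite ln_ge0// ler_pdivlMr//; lra.
have expD : 2 * expR (- D) = eta / 2.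
  by rewrite expRN lnK ?posrE ?divr_gt0// invf_div; field.
exists (upper_const D); split; first exact: upper_const_gt0.
move=> s1 d1 s2 d2 sd1 sd2; split; last by apply: mu_star_le => //; rewrite expD; lra.
have /andP[s10 s1d] := sd1; have /andP[s20 s2d] := sd2.
exists (@scan_tuning R d1 D d1 s2), (@scan_tuning R d2 D d2 s1),
  (@scan_tuning R d1 D s1 s2), (@scan_tuning R d2 D s2 s1).
split; [exact: scan_tuning_pos..|split; first exact: is_test_Delta_star].
move=> mu mu0 hmu; apply: le_trans (Delta_star_risk sd1 sd2 D0 mu0 hmu) _.
by rewrite lee_fin expD; lra.
Qed.
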